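(* (1) There is an absolute constant $K$ such that for every nonzero cube-free integer $m$ and every nontorsion point $R\in C(\mathbb{Q})$, where $C: U^3+V^3=m$, the number of indices $n\ge 1$ for which $W_n$ is a prime power (in particular, the number for which $W_n$ is prime) is at most $K$. (2) Assume the $ABC$ conjecture holds in $\mathbb{Z}$. Then there is an absolute constant $N$ such that for every nonzero cube-free integer $m$, every nontorsion point $R\in C(\mathbb{Q})$ and every $n\ge 1$, if $W_n$ is a prime power then $n\le N$.
   Context: For a nonzero integer $m$, let $C$ be the elliptic curve $C: U^3+V^3=m$ over $\mathbb{Q}$. Its group law is given by the chord and tangent method: the identity is the point at infinity with homogeneous coordinates $(1:-1:0)$, and inversion is reflection in the line $U=V$. For a nontorsion point $R\in C(\mathbb{Q})$ and $n\ge 1$, write, in lowest terms, $$nR=\left(\frac{U_n}{W_n},\frac{V_n}{W_n}\right),$$ with $U_n,V_n,W_n\in\mathbb{Z}$ and $W_n\ge 1$ (this defines $W_n$, which depends on $m$, $R$ and $n$). An integer $m$ is cube-free if it is not divisible by the cube of any prime. A prime power is an integer $p^k$ with $p$ prime and $k\ge1$. ''Absolute'' means independent of $m$, of $R$ and of $n$. The $ABC$ conjecture in $\mathbb{Z}$: for every $\varepsilon>0$ there is a constant $\kappa_\varepsilon>0$ such that for all nonzero coprime integers $a,b,c$ with $a+b=c$ one has $\max(|a|,|b|,|c|)\le \kappa_\varepsilon\left(\prod_{p\mid abc}p\right)^{1+\varepsilon}$, the product being over primes. *)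

(* Defs.v *)
From HB Require Import structures.
From mathcomp Require Import all_boot all_order all_algebra.
From mathcomp Require Import classical_sets cardinality reals exp.
From mathcomp Require Import ring lra.

Set Implicit Arguments.
Unset Strict Implicit.
Unset Printing Implicit Defensive.

Import Order.TTheory GRing.Theory Num.Theory.
Local Open Scope ring_scope.

(* The rational points of C : U^3 + V^3 = m (m <> 0). Since -1 has only one
   rational cube root, the only rational point of C on the line at infinity is
   (1 : -1 : 0), which is Infinity. *)
Inductive rat_point : Type := Infinity | Affine of rat & rat.

Definition on_curve (m : int) (P : rat_point) : Prop :=
  if P is Affine u v then u ^+ 3 + v ^+ 3 = m%:~R else True.

Definition reflect_point (P : rat_point) : rat_point :=
  if P is Affine u v then Affine v u else Infinity.

(* A direction vector of the tangent to C at (u, v), or of the chord. *)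
Definition line_dir (u1 v1 u2 v2 : rat) : rat * rat :=
  if (u1 == u2) && (v1 == v2) then (v1 ^+ 2, - u1 ^+ 2)
  else (u2 - u1, v2 - v1).

(* Substituting (u1, v1) + t * (d1, d2) in U^3 + V^3 - m gives a cubic in t with
   leading coefficient d1^3 + d2^3 and t^2-coefficient 3(u1 d1^2 + v1 d2^2).
   Two of its roots are 0, 0 (tangent) or 0, 1 (chord); line_param is the
   third one, by Vieta (see tangent_lineP and chord_lineP). *)
Definition line_param (u1 v1 u2 v2 : rat) : rat :=
  let: (d1, d2) := line_dir u1 v1 u2 v2 in
  - (3 * (u1 * d1 ^+ 2 + v1 * d2 ^+ 2) / (d1 ^+ 3 + d2 ^+ 3))
  - (~~ ((u1 == u2) && (v1 == v2)))%:R.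

(* The third intersection point of C with the line through P and Q (the tangent
   line if P = Q). The tangent at Infinity is an inflectional one, and the
   affine lines through Infinity are the lines of direction (1, -1). *)
Definition third_point (P Q : rat_point) : rat_point :=
  match P, Q with
  | Infinity, _ => reflect_point Q
  | _, Infinity => reflect_point P
  | Affine u1 v1, Affine u2 v2 =>
      let: (d1, d2) := line_dir u1 v1 u2 v2 in
      if d1 + d2 == 0 then Infinity
      else let t := line_param u1 v1 u2 v2 in
           Affine (u1 + t * d1) (v1 + t * d2)
  end.

Definition add_point (P Q : rat_point) : rat_point :=
  reflect_point (third_point P Q).

Definition mul_point (n : nat) (P : rat_point) : rat_point :=
  iter n (add_point P) Infinity.

Definition nontorsion (P : rat_point) : Prop :=
  forall n : nat, (0 < n)%N -> mul_point n P <> Infinity.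

Definition lowest_terms (P : rat_point) (U V : int) (W : nat) : Prop :=
  [/\ (0 < W)%N, gcdn (gcdn `|U|%N `|V|%N) W = 1%N
    & P = Affine (U%:~R / W%:R) (V%:~R / W%:R)].

(* W = W_n, where nR = (U_n / W_n, V_n / W_n); see lowest_terms_exists and
   lowest_terms_uniq. *)
Definition is_denom (R : rat_point) (n W : nat) : Prop :=
  exists U V : int, lowest_terms (mul_point n R) U V W.

Definition cube_free (m : int) : Prop :=
  forall p : nat, prime p -> ~~ (p%:Z ^+ 3 %| m)%Z.

Definition prime_power (q : nat) : Prop :=
  exists p k : nat, [/\ prime p, (0 < k)%N & q = (p ^ k)%N].

Definition radical (n : nat) : nat := (\prod_(p <- primes n) p)%N.

(* gcd(a, b, c) = 1 amounts to pairwise coprimality here, as a + b = c. *)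
Definition ABC (F : realType) : Prop :=
  forall eps : F, 0 < eps ->
  exists2 kappa : F, 0 < kappa &
  forall a b c : int,
    a != 0 -> b != 0 -> c != 0 -> gcdn (gcdn `|a|%N `|b|%N) `|c|%N = 1%N ->
    a + b = c ->
    (maxn (maxn `|a|%N `|b|%N) `|c|%N)%:R
      <= kappa * ((radical `|(a * b * c)%R|%N)%:R : F) `^ (1 + eps).

Lemma sum_cubes_eq0 (x y : rat) : (x ^+ 3 + y ^+ 3 == 0) = (x + y == 0).
Proof.
have -> : x ^+ 3 + y ^+ 3 = (x + y) * (x ^+ 2 - x * y + y ^+ 2) by ring.
rewrite mulf_eq0; case: eqVneq => //= xy0; apply/negbTE/eqP => h.
have h4 : (2 * x - y) ^+ 2 + 3 * y ^+ 2 = 0.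
  by rewrite -[RHS](mulr0 4) -h; ring.
have y0 : y = 0.
  apply/eqP; rewrite -sqrf_eq0 -(mulrI_eq0 _ (x := 3)); last exact/lregP.
  by rewrite eq_le; have := sqr_ge0 (2 * x - y); have := sqr_ge0 y; lra.
have x0 : x ^+ 2 = 0 by rewrite -h y0; ring.
by move: xy0; rewrite y0 addr0 -sqrf_eq0 x0 eqxx.
Qed.

Lemma chord_lineP (m : int) (u1 v1 u2 v2 t : rat) :
    on_curve m (Affine u1 v1) -> on_curve m (Affine u2 v2) ->
    ~~ ((u1 == u2) && (v1 == v2)) ->
    let: (d1, d2) := line_dir u1 v1 u2 v2 in d1 + d2 != 0 ->
  (u1 + t * d1) ^+ 3 + (v1 + t * d2) ^+ 3 - m%:~R =
  (d1 ^+ 3 + d2 ^+ 3) * t * (t - 1) * (t - line_param u1 v1 u2 v2).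
Proof.
rewrite /= /line_param /line_dir => h1 h2 hne; rewrite (negbTE hne) /=.
rewrite -sum_cubes_eq0; set d := _ + _ => d0; rewrite -h1.
have e : d + 3 * (u1 * (u2 - u1) ^+ 2 + v1 * (v2 - v1) ^+ 2) +
         3 * (u1 ^+ 2 * (u2 - u1) + v1 ^+ 2 * (v2 - v1)) = 0.
  have : u2 ^+ 3 + v2 ^+ 3 - (u1 ^+ 3 + v1 ^+ 3) = 0 by rewrite h1 h2 subrr.
  by move=> <-; rewrite /d; ring.
set q := u1 * _ + v1 * _ in e *.
have -> : d * t * (t - 1) * (t - (- (3 * q / d) - 1)) =
          t * (t - 1) * (t * d + 3 * q + d) by field.
set r := 3 * (u1 ^+ 2 * _ + _) in e.
have -> : t * (t - 1) * (t * d + 3 * q + d) =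
          d * t ^+ 3 + 3 * q * t ^+ 2 + r * t - (d + 3 * q + r) * t by ring.
by rewrite e /r /q /d; ring.
Qed.

Lemma tangent_lineP (m : int) (u v t : rat) :
    on_curve m (Affine u v) ->
    let: (d1, d2) := line_dir u v u v in d1 + d2 != 0 ->
  (u + t * d1) ^+ 3 + (v + t * d2) ^+ 3 - m%:~R =
  (d1 ^+ 3 + d2 ^+ 3) * t ^+ 2 * (t - line_param u v u v).
Proof.
rewrite /= /line_param /line_dir !eqxx /= => h.
rewrite -sum_cubes_eq0; set d := _ + _ => d0; rewrite -h.
set q := u * _ + v * _.
have -> : d * t ^+ 2 * (t - (- (3 * q / d) - 0)) = t ^+ 2 * (t * d + 3 * q)
  by field.
by rewrite /q /d; ring.
Qed.

Lemma reflect_on_curve (m : int) (P : rat_point) :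
  on_curve m P -> on_curve m (reflect_point P).
Proof. by case: P => //= u v; rewrite addrC. Qed.

Lemma add_on_curve (m : int) (P Q : rat_point) :
  on_curve m P -> on_curve m Q -> on_curve m (add_point P Q).
Proof.
move=> hP hQ; apply: reflect_on_curve.
case: P Q hP hQ => [|u1 v1] [|u2 v2] hP hQ; rewrite /third_point //;
  try exact: reflect_on_curve.
have [/andP[/eqP eu /eqP ev]|hne] := boolP ((u1 == u2) && (v1 == v2)).
  subst u2 v2; have := tangent_lineP (line_param u1 v1 u1 v1) hP.
  case: (line_dir _ _ _ _) => d1 d2; case: eqVneq => //= _ /(_ isT).
  by rewrite subrr mulr0 => /eqP; rewrite subr_eq0 => /eqP.
have := chord_lineP (line_param u1 v1 u2 v2) hP hQ hne.
case: (line_dir _ _ _ _) => d1 d2; case: eqVneq => //= _ /(_ isT).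
by rewrite subrr mulr0 => /eqP; rewrite subr_eq0 => /eqP.
Qed.

Lemma lowest_terms_uniq (P : rat_point) (U V U' V' : int) (W W' : nat) :
  lowest_terms P U V W -> lowest_terms P U' V' W' ->
  [/\ U = U', V = V' & W = W'].
Proof.
have dv X Y X' Y' (Z Z' : nat) : lowest_terms P X Y Z ->
    lowest_terms P X' Y' Z' ->
    [/\ X * Z' = X' * Z, Y * Z' = Y' * Z & (Z %| Z')%N].
  move=> [Z0 g ->] [Z'0 g' [eX eY]].
  have cross (a b : int) : a%:~R / Z%:R = b%:~R / Z'%:R :> rat ->
      a * Z' = b * Z.
    move=> e; apply: (@intr_inj rat); rewrite !intrM.
    by move/eqP: e; rewrite eqr_div ?pnatr_eq0 -?lt0n // => /eqP.
  have {}eX := cross _ _ eX; have {}eY := cross _ _ eY; split=> //.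
  have -> : Z' = gcdn (gcdn (`|X| * Z') (`|Y| * Z')) (Z * Z').
    by rewrite -!muln_gcdl g mul1n.
  have absM (a : int) (k : nat) : (`|a| * k)%N = `|(a * k)%R|%N.
    by rewrite abszM.
  rewrite !absM eX eY !abszM !absz_nat !dvdn_gcd.
  by rewrite dvdn_mull // dvdn_mull // dvdn_mulr.
move=> h h'; have [eX eY d] := dv _ _ _ _ _ _ h h'.
have [_ _ d'] := dv _ _ _ _ _ _ h' h.
have eW : W = W' by apply/eqP; rewrite eqn_dvd d d'.
have W0 : W%:Z != 0 by case: h => W0 _ _; rewrite eqz_nat -lt0n.
by move: eX eY; rewrite -eW => /(mulIf W0) -> /(mulIf W0) ->.
Qed.

Lemma lowest_terms_exists (u v : rat) :
  exists (U V : int) (W : nat), lowest_terms (Affine u v) U V W.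
Proof.
pose W0 := `|(denq u * denq v)%R|%N.
have W0gt : (0 < W0)%N by rewrite absz_gt0 mulf_neq0 ?denq_neq0.
have W0E : W0%:Z = denq u * denq v by rewrite /W0 gez0_abs ?mulr_ge0 ?denq_ge0.
pose U0 := numq u * denq v; pose V0 := numq v * denq u.
pose g := gcdn (gcdn `|U0|%N `|V0|%N) W0.
have g0 : (0 < g)%N by rewrite gcdn_gt0 W0gt orbT.
have /dvdzP[U eU] : (g %| U0)%Z.
  by rewrite dvdzE absz_nat (dvdn_trans (dvdn_gcdl _ _)) ?dvdn_gcdl.
have /dvdzP[V eV] : (g %| V0)%Z.
  by rewrite dvdzE absz_nat (dvdn_trans (dvdn_gcdl _ _)) ?dvdn_gcdr.
have /dvdnP[W eW] : (g %| W0)%N by exact: dvdn_gcdr.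
have W0' : (0 < W)%N by move: W0gt; rewrite eW muln_gt0 => /andP[].
have quo (X X0 : int) : X0 = X * g -> X0%:~R / W0%:R = X%:~R / W%:R :> rat.
  move=> ->; rewrite eW natrM intrM -mulf_div divff ?mulr1 //.
  by rewrite pnatr_eq0 -lt0n.
have W0R : W0%:R = (denq u)%:~R * (denq v)%:~R :> rat.
  by rewrite -intrM -W0E.
exists U, V, W; split=> //.
  apply/eqP; rewrite -(eqn_pmul2r g0) mul1n {2}/g eU eV eW !abszM !absz_nat.
  by rewrite !muln_gcdl.
have dn x : (denq x)%:~R != 0 :> rat by rewrite intr_eq0 denq_neq0.
congr Affine.
  rewrite -(quo _ _ eU) W0R intrM.
  by rewrite -mulf_div divff // mulr1 divq_num_den.
rewrite -(quo _ _ eV) W0R intrM.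
by rewrite [X in _ / X]mulrC -mulf_div divff // mulr1 divq_num_den.
Qed.

(* Main.v *)
Require Import Defs.
From mathcomp Require Import all_boot all_order all_algebra.
From mathcomp Require Import algC algnum.
From mathcomp Require Import boolp finmap.
From mathcomp Require Import classical_sets cardinality reals exp.
From mathcomp Require Import ring lra zify.

(** Write q = U^2 - U V + V^2, so that m W^3 = (U + V) q for a point
    (U / W, V / W) in lowest terms. As m is cube-free, U and V are coprime, and the
    two factors share no prime but 3. If W is a prime power, W^3 therefore comes
    from one factor alone (prime_power_denom): either q <= 3 |m|, or U + V divides
    m and q = k W^3 with m = k (U + V). The first case is impossible for large n
    because q grows; in the second case the point n R is very near the point at
    infinity, which is a strong approximation property.

    Growth. The number m / (u + v)^3 is invariant under twisting the curve to
    U^3 + V^3 = 1 over the field of the cube root of m. Its height satisfies one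
    half of the parallelogram law with a constant that does not depend on m
    (height_parallelogram, height_mul_point), and for cube-free m it equals q up to
    a factor (height_qform). Since m is at most 4 q^2, a large height exceeds a
    power of m and also the constant in the parallelogram law, and then the heights
    of the multiples grow geometrically; only finitely many pairs (m, R) have a small
    height, and each contributes finitely many n. Hence for all c and k there is
    an absolute n0 such that q >= c |m|^k at n R for all n > n0 (uniform_growth).

    Part (2). The identity (U + V)^2 + 3 (U - V)^2 = 4 q is an abc relation whose
    radical is at most about m^2 q^(5/6) in the second case, so the conjecture
    bounds q by a power of m (ABC_qform_bound), against the growth of q.

    Part (1). Let omega be a primitive cube root of unity, and e = eta u v the
    linear form over Q(omega) with norm q and trace U + V. Modulo cubes, e / e^* is
    multiplicative along the curve (descent_mul_point), so for two indices that
    agree modulo 3 the number e1^* e2 / (e1 e2^* ) is the cube of some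
    t = K^* / K with K an integer of Q(omega). Because the traces are at most |m|,
    this number is very close to - e1^* / e1, which is itself close to 1. The Padé
    approximants A_r / B_r of the cube root, evaluated at - e1^* / e1, thus
    approximate t, and the integer e1^r (K A_r - K^* B_r) of Q(omega) would be
    smaller than 1 in absolute value if it were not 0, unless an inequality between
    q1 and q2 holds (norm_point_pade). For r = 0 this gives q2^2 >= q1^3
    (pade_gap); for r near log q2 / (2 log q1), where two consecutive approximants
    cannot both vanish (pade_det_neq0), it gives q2 < q1^16 (pade_far). So each class
    modulo 3 contains at most 8 indices beyond an absolute bound. *)

Set Implicit Arguments.
Unset Strict Implicit.
Unset Printing Implicit Defensive.

Import Order.TTheory GRing.Theory Num.Theory.
Local Open Scope ring_scope.

(** * The group law by chords and tangents *)

Lemma sum_neq0_on_curve (m : int) (u v : rat) :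
  m != 0 -> on_curve m (Affine u v) -> u + v != 0.
Proof. by move=> m0 /= h; rewrite -sum_cubes_eq0 h intr_eq0. Qed.

Lemma third_point_chord (u1 v1 u2 v2 : rat) : ~~ ((u1 == u2) && (v1 == v2)) ->
  third_point (Affine u1 v1) (Affine u2 v2) =
  let: (d1, d2) := (u2 - u1, v2 - v1) in
  if d1 + d2 == 0 then Infinity else
  let t := - (3 * (u1 * d1 ^+ 2 + v1 * d2 ^+ 2) / (d1 ^+ 3 + d2 ^+ 3)) - 1 in
  Affine (u1 + t * d1) (v1 + t * d2).
Proof. by move=> h; rewrite /= /line_param /line_dir (negbTE h). Qed.

Lemma third_point_tangent (u v : rat) :
  third_point (Affine u v) (Affine u v) =
  let: (d1, d2) := (v ^+ 2, - u ^+ 2) in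
  if d1 + d2 == 0 then Infinity else
  let t := - (3 * (u * d1 ^+ 2 + v * d2 ^+ 2) / (d1 ^+ 3 + d2 ^+ 3)) in
  Affine (u + t * d1) (v + t * d2).
Proof. by rewrite /= /line_param /line_dir !eqxx /= subr0. Qed.

Local Arguments third_point : simpl never.

(** On a line of direction (1, -1) the sum U + V is constant, and then the
    equation of the curve fixes the product U * V as well. *)
Lemma opposite_of_same_sum (m : int) (u1 v1 u2 v2 : rat) : m != 0 ->
  on_curve m (Affine u1 v1) -> on_curve m (Affine u2 v2) ->
  ~~ ((u1 == u2) && (v1 == v2)) -> (u2 - u1) + (v2 - v1) = 0 ->
  u2 = v1 /\ v2 = u1.
Proof.
move=> m0 h1 h2 hne hs; have s0 := sum_neq0_on_curve m0 h1.
have e2 : v2 = u1 + v1 - u2 by apply/eqP; rewrite -subr_eq0 -hs; apply/eqP; ring.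
have : 3 * (u1 + v1) * ((u2 - u1) * (u2 - v1)) = 0.
  have <- : u2 ^+ 3 + v2 ^+ 3 - (u1 ^+ 3 + v1 ^+ 3) = 0.
    by move: h1 h2 => /= -> ->; rewrite subrr.
  by rewrite e2; ring.
move/eqP; rewrite !mulf_eq0 (negbTE s0) /= => /orP[] h.
   rewrite subr_eq0 in h; move: hne; rewrite e2 (eqP h) eqxx /=.
  by have -> : u1 + v1 - u1 = v1; [ring | rewrite eqxx].
by rewrite subr_eq0 in h; rewrite e2 (eqP h); split=> //; ring.
Qed.

(** The parameters of the three intersection points of a line with the curve add
    up to a value that depends on one point and the direction only, not on how
    the direction is scaled. *)
Lemma third_point_scaled (u v d1 d2 t : rat) : t != 0 -> d1 + d2 != 0 ->
  let t' := - (3 * (u * d1 ^+ 2 + v * d2 ^+ 2) / (d1 ^+ 3 + d2 ^+ 3)) - t in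
  third_point (Affine u v) (Affine (u + t * d1) (v + t * d2)) =
  Affine (u + t' * d1) (v + t' * d2).
Proof.
move=> t0 hd /=; have d0 : d1 ^+ 3 + d2 ^+ 3 != 0 by rewrite sum_cubes_eq0.
rewrite third_point_chord; last first.
  rewrite -!(subr_eq0 _ (_ + _)) !opprD !addrA !subrr !sub0r !oppr_eq0.
  rewrite !mulf_eq0 (negbTE t0) /=; apply/negP => /andP[/eqP e1 /eqP e2].
  by rewrite e1 e2 addr0 eqxx in hd.
have addK (x y : rat) : x + y - x = y by rewrite addrC addKr.
rewrite !addK -mulrDr mulf_eq0.
rewrite (negbTE t0) (negbTE hd) /= !exprMn.
rewrite -mulrDr (mulrCA u) (mulrCA v) -(mulrDr (t ^+ 2)).
move: (d1 ^+ 3 + _) (u * _ + _) d0 => d q d0.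
by congr Affine; field; rewrite d0 t0.
Qed.

Lemma third_point_tangent_scaled (u v d1 d2 : rat) : u + v != 0 ->
  d1 + d2 != 0 -> u ^+ 2 * d1 + v ^+ 2 * d2 = 0 ->
  let t := - (3 * (u * d1 ^+ 2 + v * d2 ^+ 2) / (d1 ^+ 3 + d2 ^+ 3)) in
  third_point (Affine u v) (Affine u v) = Affine (u + t * d1) (v + t * d2).
Proof.
move=> s0 hd e /=; have d0 : d1 ^+ 3 + d2 ^+ 3 != 0 by rewrite sum_cubes_eq0.
have [l l0 [el1 el2]] : exists2 l, l != 0 & v ^+ 2 = l * d1 /\ - u ^+ 2 = l * d2.
  have [d20|d20] := eqVneq d2 0.
    rewrite d20 addr0 in hd; exists (v ^+ 2 / d1); last first.
      split; [by rewrite divfK | apply/eqP].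
      by rewrite d20 mulr0 oppr_eq0 -(mulIr_eq0 _ (mulIf hd)) -e d20 mulr0 addr0.
    rewrite mulf_neq0 ?invr_eq0 // expf_neq0 //; apply: contraNneq s0 => v0.
    move/eqP: e; rewrite d20 mulr0 addr0 mulf_eq0 (negbTE hd) orbF expf_eq0.
    by move=> /= /eqP ->; rewrite v0 addr0.
  exists (- u ^+ 2 / d2); last first.
    split; last by rewrite divfK.
    apply: (mulIf d20); have -> : - u ^+ 2 / d2 * d1 * d2 = - (u ^+ 2 * d1) by field.
    by apply/eqP; rewrite -addr_eq0 addrC e.
  rewrite mulf_neq0 ?invr_eq0 // oppr_eq0 expf_neq0 //.
  apply: contraNneq s0 => u0; move/eqP: e.
  rewrite u0 expr0n mul0r add0r mulf_eq0 (negbTE d20) orbF expf_eq0 /=.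
  by move/eqP ->; rewrite addr0.
rewrite third_point_tangent el1 el2 -mulrDr mulf_eq0 (negbTE l0) (negbTE hd) /=.
rewrite !exprMn.
rewrite -mulrDr (mulrCA u) (mulrCA v) -(mulrDr (l ^+ 2)).
move: (d1 ^+ 3 + _) (u * _ + _) d0 => d q d0.
by congr Affine; field; rewrite d0 l0.
Qed.

(** The chord and tangent construction is involutive in its second argument.
    This stands in for the associativity of the group law: it yields
    (P + Q) - P = Q, which is all that multiples of one point require. *)
Lemma third_point_third (m : int) (P Q : rat_point) : m != 0 ->
  on_curve m P -> on_curve m Q -> third_point P (third_point P Q) = Q.
Proof.
move=> m0; case: P Q => [|u1 v1] [|u2 v2] hP hQ //.
  rewrite [X in third_point _ X]/third_point /=.
  have [/andP[/eqP eu _]|hne] := boolP ((u1 == v1) && (v1 == u1)).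
    by rewrite eu third_point_tangent /= subrr eqxx.
  rewrite third_point_chord //=.
  by have -> : v1 - u1 + (u1 - v1) = 0 by ring.
have s0 := sum_neq0_on_curve m0 hP.
have [/andP[/eqP eu /eqP ev]|hne] := boolP ((u1 == u2) && (v1 == v2)).
  subst u2 v2; rewrite third_point_tangent /=.
  case: eqVneq => [hd|hd].
    rewrite /third_point /=; have : (v1 - u1) * (u1 + v1) = 0 by rewrite -hd; ring.
    by move/eqP; rewrite mulf_eq0 (negbTE s0) orbF subr_eq0 => /eqP ->.
  set t := - (_ / _); have [t0|t0] := eqVneq t 0.
    rewrite t0 !mul0r !addr0 third_point_tangent /= (negbTE hd) -/t t0.
    by rewrite !mul0r !addr0.
  by rewrite (third_point_scaled u1 v1 t0 hd) -/t subrr !mul0r !addr0.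
rewrite third_point_chord //=.
case: eqVneq => [hd|hd].
  by rewrite /third_point /=; have [-> ->] := opposite_of_same_sum m0 hP hQ hne hd.
set t := - (_ / _) - 1; have [t0|t0] := eqVneq t 0.
  rewrite t0 !mul0r !addr0 (third_point_tangent_scaled s0 hd) /=; last first.
    move/eqP: t0; rewrite subr_eq0 eqr_oppLR => /eqP t0.
    have e1 : (u2 - u1) ^+ 3 + (v2 - v1) ^+ 3 + 3 * (u1 * (u2 - u1) ^+ 2 + v1 * (v2 - v1) ^+ 2) = 0.
      by rewrite -[X in _ + X](divfK (_ : (u2 - u1) ^+ 3 + (v2 - v1) ^+ 3 != 0)) ?sum_cubes_eq0 // t0 mulN1r subrr.
    have e2 : u2 ^+ 3 + v2 ^+ 3 - (u1 ^+ 3 + v1 ^+ 3) = 0.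
      by move: hP hQ => /= -> ->; rewrite subrr.
    apply: (mulfI (_ : 3 != 0)) => //; rewrite mulr0 -[RHS](subrr 0) -{1}e2 -e1; ring.
  by move/eqP: t0; rewrite subr_eq0 => /eqP ->; rewrite !mul1r !subrKC.
rewrite (third_point_scaled u1 v1 t0 hd) /=.
have -> : - (3 * (u1 * (u2 - u1) ^+ 2 + v1 * (v2 - v1) ^+ 2) /
          ((u2 - u1) ^+ 3 + (v2 - v1) ^+ 3)) - t = 1 by rewrite /t opprB addrC subrK.
by rewrite !mul1r !subrKC.
Qed.

Lemma reflect_pointK : involutive reflect_point.
Proof. by case. Qed.

Lemma third_pointC P Q : third_point P Q = third_point Q P.
Proof.
case: P Q => [|u1 v1] [|u2 v2] //.
have [/andP[/eqP -> /eqP ->] //|hne] := boolP ((u1 == u2) && (v1 == v2)).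
rewrite !third_point_chord ?[u2 == u1]eq_sym ?[v2 == v1]eq_sym //=.
have -> : u1 - u2 + (v1 - v2) = - (u2 - u1 + (v2 - v1)) by ring.
rewrite oppr_eq0; case: eqVneq => // hd.
have d0 : (u2 - u1) ^+ 3 + (v2 - v1) ^+ 3 != 0 by rewrite sum_cubes_eq0.
have e : (u1 - u2) ^+ 3 + (v1 - v2) ^+ 3 = - ((u2 - u1) ^+ 3 + (v2 - v1) ^+ 3).
  by ring.
by congr Affine; rewrite e; field.
Qed.

Lemma third_point_reflect P Q :
  third_point (reflect_point P) (reflect_point Q) = reflect_point (third_point P Q).
Proof.
case: P Q => [|u1 v1] [|u2 v2] //.
have [/andP[/eqP -> /eqP ->]|hne] := boolP ((u1 == u2) && (v1 == v2)).
  rewrite !third_point_tangent /=.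
  have -> : u2 ^+ 2 - v2 ^+ 2 = - (v2 ^+ 2 - u2 ^+ 2) by ring.
  rewrite oppr_eq0; case: eqVneq => // hd.
  have d0 : (v2 ^+ 2) ^+ 3 + (- u2 ^+ 2) ^+ 3 != 0 by rewrite sum_cubes_eq0.
  have e : (u2 ^+ 2) ^+ 3 + (- v2 ^+ 2) ^+ 3 = - ((v2 ^+ 2) ^+ 3 + (- u2 ^+ 2) ^+ 3).
    by ring.
  by congr Affine; rewrite e; field.
rewrite [LHS]third_point_chord 1?andbC // third_point_chord //=.
rewrite (addrC (v2 - v1)); case: eqVneq => // hd /=.
by rewrite (addrC ((v2 - v1) ^+ 3)) (addrC (v1 * _)).
Qed.

Lemma third_on_curve (m : int) P Q :
  on_curve m P -> on_curve m Q -> on_curve m (third_point P Q).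
Proof.
by move=> hP hQ; rewrite -[third_point _ _]reflect_pointK; apply/reflect_on_curve/add_on_curve.
Qed.

Lemma add_point_subK (m : int) P Q : m != 0 -> on_curve m P -> on_curve m Q ->
  add_point (add_point P Q) (reflect_point P) = Q.
Proof.
move=> m0 hP hQ; rewrite /add_point third_point_reflect reflect_pointK third_pointC.
exact: third_point_third hQ.
Qed.

Lemma mul_point_on_curve (m : int) P n : on_curve m P -> on_curve m (mul_point n P).
Proof. by move=> hP; elim: n => //= n; apply: add_on_curve. Qed.

Lemma mul_point1 P : mul_point 1 P = P.
Proof. by case: P. Qed.

Lemma mul_point_pred (m : int) P n : m != 0 -> on_curve m P ->
  add_point (mul_point n.+1 P) (reflect_point P) = mul_point n P.
Proof. by move=> m0 hP; apply: add_point_subK hP (mul_point_on_curve n hP). Qed.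

Lemma mul_point_inj (m : int) P : m != 0 -> on_curve m P -> nontorsion P ->
  injective (mul_point^~ P).
Proof.
move=> m0 hP ntP; suff lt i k : mul_point i P = mul_point (i + k.+1) P -> False.
  move=> i j e; case: (ltngtP i j) => // h; exfalso.
    by apply: (lt i (j - i.+1)%N); rewrite addnS -addSn subnKC.
  by apply: (lt j (i - j.+1)%N); rewrite addnS -addSn subnKC.
elim: i => [|i IHi] e; first by case: (ntP k.+1).
apply: IHi; rewrite -(mul_point_pred i m0 hP) e.
by rewrite addSn (mul_point_pred _ m0 hP).
Qed.

(** * Chords and tangents in homogeneous coordinates *)

(** The sum of the coordinates of a chord's third point, in terms of the sums
    s1, s2 and the differences of the given points: the latter enter only
    through their product, whose sign tells P + Q from P - Q. *)
Lemma third_point_chord_sum (m : int) (u1 v1 u2 v2 : rat) : m != 0 ->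
    on_curve m (Affine u1 v1) -> on_curve m (Affine u2 v2) ->
    u1 + v1 != u2 + v2 ->
  let s1 := u1 + v1 in let s2 := u2 + v2 in
  exists u3 v3, third_point (Affine u1 v1) (Affine u2 v2) = Affine u3 v3 /\
    (u3 + v3) * (2 * m%:~R * (s1 + s2) - (s1 * s2) ^+ 2
                 - 3 * (s1 * s2) * ((u1 - v1) * (u2 - v2)))
      = 2 * m%:~R * (s1 - s2) ^+ 2.
Proof.
move=> m0 h1 h2 hs /=.
have s10 := sum_neq0_on_curve m0 h1; have s20 := sum_neq0_on_curve m0 h2.
have hd : u2 - u1 + (v2 - v1) != 0.
  have -> : u2 - u1 + (v2 - v1) = (u2 + v2) - (u1 + v1) by ring.
  by rewrite subr_eq0 eq_sym.
rewrite third_point_chord; last first.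
  by apply: contraNN hs => /andP[/eqP -> /eqP ->].
rewrite (negbTE hd); do 2!eexists; split; first by reflexivity.
have {h1} h1 : (u1 + v1) * ((u1 + v1) ^+ 2 + 3 * (u1 - v1) ^+ 2) = 4 * m%:~R.
  by move: h1 => /= <-; ring.
have {h2} h2 : (u2 + v2) * ((u2 + v2) ^+ 2 + 3 * (u2 - v2) ^+ 2) = 4 * m%:~R.
  by move: h2 => /= <-; ring.
have d0 : (u2 - u1) ^+ 3 + (v2 - v1) ^+ 3 != 0 by rewrite sum_cubes_eq0.
have e1 : (u1 + v1) * (u2 + v2) * (4 * ((u2 - u1) ^+ 3 + (v2 - v1) ^+ 3)) =
  2 * (u2 - u1 + (v2 - v1)) * (2 * m%:~R * (u1 + v1 + (u2 + v2)) - ((u1 + v1) * (u2 + v2)) ^+ 2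
                 - 3 * ((u1 + v1) * (u2 + v2)) * ((u1 - v1) * (u2 - v2))).
  transitivity ((u2 - u1 + (v2 - v1)) *
    ((u2 + v2) * ((u1 + v1) * ((u1 + v1) ^+ 2 + 3 * (u1 - v1) ^+ 2)) +
     (u1 + v1) * ((u2 + v2) * ((u2 + v2) ^+ 2 + 3 * (u2 - v2) ^+ 2)) -
     2 * ((u1 + v1) * (u2 + v2)) ^+ 2 -
     6 * ((u1 + v1) * (u2 + v2)) * ((u1 - v1) * (u2 - v2)))); first by ring.
  by rewrite h1 h2; ring.
have e2 : (u1 + v1) * (u2 + v2) *
  ((u1 + v1) * (4 * ((u2 - u1) ^+ 3 + (v2 - v1) ^+ 3)) -
   (u2 - u1 + (v2 - v1)) * (4 * ((u2 - u1) ^+ 3 + (v2 - v1) ^+ 3) +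
     12 * (u1 * (u2 - u1) ^+ 2 + v1 * (v2 - v1) ^+ 2))) =
  4 * m%:~R * (u2 - u1 + (v2 - v1)) ^+ 3.
  transitivity ((u2 - u1 + (v2 - v1)) ^+ 2 *
    ((u2 + v2) * ((u1 + v1) * ((u1 + v1) ^+ 2 + 3 * (u1 - v1) ^+ 2)) -
     (u1 + v1) * ((u2 + v2) * ((u2 + v2) ^+ 2 + 3 * (u2 - v2) ^+ 2)))); first by ring.
  by rewrite h1 h2; ring.
have -> : u1 + v1 - (u2 + v2) = - (u2 - u1 + (v2 - v1)) by ring.
apply: (mulfI (_ : 2 * (u2 - u1 + (v2 - v1)) != 0)); first by rewrite mulf_neq0.
rewrite mulrCA -e1; apply: etrans (_ : 4 * m%:~R * (u2 - u1 + (v2 - v1)) ^+ 3 = _); last by ring.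
rewrite -e2; move: (_ ^+ 3 + _) (u1 * _ + v1 * _) d0 => d q d0.
by field.
Qed.

Lemma third_point_tangent_sum (m : int) (u v : rat) : m != 0 ->
    on_curve m (Affine u v) -> u != v ->
  exists u3 v3, third_point (Affine u v) (Affine u v) = Affine u3 v3 /\
    (u3 + v3) * (m%:~R + 2 * (u + v) ^+ 3) =
      4 * m%:~R * (u + v) - (u + v) ^+ 4.
Proof.
move=> m0 h uv; have s0 := sum_neq0_on_curve m0 h; move: h => /= h.
rewrite third_point_tangent /=.
have d0 : (v ^+ 2) ^+ 3 + (- u ^+ 2) ^+ 3 != 0.
  rewrite sum_cubes_eq0 subr_eq0 eqf_sqr negb_or eq_sym uv /=.
  by rewrite -subr_eq0 opprK addrC.
rewrite -sum_cubes_eq0 (negbTE d0); do 2!eexists; split; first by reflexivity.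
rewrite -h; move: d0.
have -> : (v ^+ 2) ^+ 3 + (- u ^+ 2) ^+ 3 = (u + v) * ((v - u) * (u ^+ 2 - u * v + v ^+ 2) * (u ^+ 2 + u * v + v ^+ 2)) by ring.
have -> : u * (v ^+ 2) ^+ 2 + v * (- u ^+ 2) ^+ 2 = (u + v) * (u * v * (u ^+ 2 - u * v + v ^+ 2)) by ring.
rewrite !mulf_eq0 !negb_or => /and3P[_ /andP[vu q0] r0].
by field; rewrite s0 vu q0 r0.
Qed.

(** Integers (W : s) representing 1 / (U + V) as a point of the projective
    line; this function has a double pole at infinity and is even. *)
Definition represents (P : rat_point) (W s : int) : Prop :=
  if P is Affine u v then s != 0 /\ (u + v) * W%:~R = s%:~R
  else W != 0 /\ s = 0.

(** As the function 1 / (u + v) is even of degree 2, the symmetric functions of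
    its values at P + Q and P - Q are rational in those of its values at P and Q,
    of degree 2; the factors k and l account for the choice of representatives. *)
Lemma represents_add_sub (m : int) P Q (W1 s1 W2 s2 W3 s3 W4 s4 : int) :
    m != 0 -> on_curve m P -> on_curve m Q ->
    P <> Infinity -> Q <> Infinity -> add_point P Q <> Infinity ->
    represents P W1 s1 -> represents Q W2 s2 ->
    represents (add_point P Q) W3 s3 ->
    represents (add_point P (reflect_point Q)) W4 s4 ->
  let a := W1 * W2 in let b := W1 * s2 + W2 * s1 in let c := s1 * s2 in
  exists k l : int, [/\ k != 0, l != 0,
    k * (W3 * W4) = l * (m * a ^+ 2 + b * c),
    k * (W3 * s4 + W4 * s3) = l * (2 * m * a * b - c ^+ 2) &
    k * (s3 * s4) = l * (m * (b ^+ 2 - 4 * a * c))].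
Proof.
case: P Q => [|u1 v1] [|u2 v2] // m0 h1 h2 _ _.
have s10 := sum_neq0_on_curve m0 h1; have s20 := sum_neq0_on_curve m0 h2.
move=> h3 [z1 e1] [z2 e2].
have [es|es] := eqVneq (u1 + v1) (u2 + v2).
  have [/andP[/eqP eu /eqP ev]|hne] := boolP ((u1 == u2) && (v1 == v2)); last first.
    have [e e'] : u2 = v1 /\ v2 = u1.
      apply: opposite_of_same_sum m0 h1 h2 hne _.
      by apply/eqP; rewrite addrACA -opprD es subrr.
    case: h3; rewrite /add_point third_point_chord // e e'.
    by have -> : v1 - u1 + (u1 - v1) = 0 by ring.
  subst u2 v2; have uv : u1 != v1.
    apply/eqP => uv; case: h3.
    by rewrite /add_point third_point_tangent uv /= subrr eqxx.
  have [u3 [v3 [et e3]]] := third_point_tangent_sum m0 h1 uv.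
  rewrite /add_point et /=.
  rewrite third_point_chord 1?(negbTE uv) //= addrC subrKA subrr eqxx /=.
  move=> [z3 e3'] [z4 ->]; have w3 : W3 != 0.
    by apply: contraNneq z3 => w; rewrite w mulr0 in e3'; rewrite -(intr_eq0 rat) -e3'.
  have nz : m%:~R + 2 * (u1 + v1) ^+ 3 != 0.
    apply/eqP => nz; move: e3; rewrite nz mulr0 => e3.
    have : 9 * (u1 + v1) ^+ 4 = 0.
      transitivity (4 * (u1 + v1) * (m%:~R + 2 * (u1 + v1) ^+ 3) -
                    (4 * m%:~R * (u1 + v1) - (u1 + v1) ^+ 4)); first by ring.
      by rewrite nz -e3 mulr0 subrr.
    by apply/eqP; rewrite mulf_neq0 ?expf_neq0.
  have w1 : W1 != 0.
    by apply: contraNneq z1 => w; rewrite w mulr0 in e1; rewrite -(intr_eq0 rat) -e1.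
  have w2 : W2 != 0.
    by apply: contraNneq z2 => w; rewrite w mulr0 in e2; rewrite -(intr_eq0 rat) -e2.
  exists (m * (W1 * W2) ^+ 2 + (W1 * s2 + W2 * s1) * (s1 * s2)), (W3 * W4).
  split; last 3 first.
  - by ring.
  - apply: (@intr_inj rat).
    rewrite !(rmorph_nat, rmorphN, rmorphD, rmorphM, rmorphXn) /=.
    rewrite -e1 -e2 -e3'.
    transitivity (W4%:~R * W3%:~R * (W1%:~R * W2%:~R) ^+ 2 *
      ((u3 + v3) * (m%:~R + 2 * (u1 + v1) ^+ 3))); first by ring.
    by rewrite e3; ring.
  - apply: (@intr_inj rat).
    rewrite !(rmorph_nat, rmorphN, rmorphD, rmorphM, rmorphXn) /=.
    by rewrite -e1 -e2 -e3'; ring.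
  - rewrite -(intr_eq0 rat).
    rewrite !(rmorph_nat, rmorphN, rmorphD, rmorphM, rmorphXn) /= -e1 -e2.
    rewrite (_ : _ + _ = (W1%:~R * W2%:~R) ^+ 2 * (m%:~R + 2 * (u1 + v1) ^+ 3)); last by ring.
    by rewrite mulf_neq0 ?expf_neq0 // mulf_neq0 ?intr_eq0.
  by rewrite mulf_neq0.
have [u3 [v3 [et3 e3]]] := third_point_chord_sum m0 h1 h2 es.
have h2' : on_curve m (Affine v2 u2) by exact: (reflect_on_curve h2).
have es' : u1 + v1 != v2 + u2 by rewrite [v2 + u2]addrC.
have [u4 [v4 [et4 e4]]] := third_point_chord_sum m0 h1 h2' es'.
rewrite /add_point et3 et4 /= => -[z3 e3'] [z4 e4'].
have q1 : (u1 + v1) * ((u1 + v1) ^+ 2 + 3 * (u1 - v1) ^+ 2) = 4 * m%:~R.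
  by move: h1 => /= <-; ring.
have q2 : (u2 + v2) * ((u2 + v2) ^+ 2 + 3 * (u2 - v2) ^+ 2) = 4 * m%:~R.
  by move: h2 => /= <-; ring.
rewrite (addrC v2 u2) in e4; rewrite (addrC v3) in e3'; rewrite (addrC v4) in e4'.
have f2 : 2 * m%:~R * (u1 + v1 - (u2 + v2)) ^+ 2 != 0.
  by rewrite !mulf_neq0 ?intr_eq0 ?subr_eq0.
move: (u1 + v1) (u2 + v2) (u3 + v3) (u4 + v4) (u1 - v1) (u2 - v2) (opprB u2 v2)
  s10 s20 es e1 e2 e3 e4 e3' e4' q1 q2 f2 => S1 S2 S3 S4 x y ey S10 S20 es e1 e2 e3 e4 e3' e4' q1 q2 f2.
rewrite -ey in e4.
have g1 : (S3 + S4) * (m%:~R * (S1 - S2) ^+ 2) =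
          S3 * S4 * (2 * m%:~R * (S1 + S2) - (S1 * S2) ^+ 2).
  apply: (mulfI (_ : 2 != 0)) => //.
  transitivity (S3 * (2 * m%:~R * (S1 - S2) ^+ 2) + S4 * (2 * m%:~R * (S1 - S2) ^+ 2)); first by ring.
  by rewrite -{1}e4 -e3; ring.
have g0 : S3 * S4 * (m%:~R + (S1 + S2) * (S1 * S2)) = m%:~R * (S1 - S2) ^+ 2.
  apply: (mulfI (_ : 2 * (2 * m%:~R * (S1 - S2) ^+ 2) != 0)); first by rewrite mulf_neq0.
  transitivity (S3 * S4 * ((2 * m%:~R * (S1 + S2) - (S1 * S2) ^+ 2) ^+ 2 -
     S1 * S2 * ((4 * m%:~R - S1 ^+ 3) * (4 * m%:~R - S2 ^+ 3)))); first by ring.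
  transitivity ((2 * m%:~R * (S1 - S2) ^+ 2) * (2 * m%:~R * (S1 - S2) ^+ 2)); last by ring.
  have -> : 4 * m%:~R - S1 ^+ 3 = 3 * S1 * x ^+ 2 by rewrite -q1; ring.
  have -> : 4 * m%:~R - S2 ^+ 3 = 3 * S2 * y ^+ 2 by rewrite -q2; ring.
  by rewrite -{1}e3 -e4; ring.
have w0 (S : rat) (W s : int) : s != 0 -> S * W%:~R = s%:~R -> W != 0.
  by move=> z e; apply: contraNneq z => w; rewrite w mulr0 in e; rewrite -(intr_eq0 rat) -e.
exists (m * (W1 * s2 - W2 * s1) ^+ 2), (s3 * s4); split.
- rewrite mulf_neq0 ?expf_neq0 // -(intr_eq0 rat) rmorphB !rmorphM /= -e1 -e2.
  have -> : W1%:~R * (S2 * W2%:~R) - W2%:~R * (S1 * W1%:~R) =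
    (W1%:~R * W2%:~R) * (S2 - S1) :> rat by ring.
  by rewrite !mulf_neq0 ?intr_eq0 ?(w0 _ _ _ z1 e1) ?(w0 _ _ _ z2 e2) // subr_eq0 eq_sym.
- by rewrite mulf_neq0.
- apply: (@intr_inj rat).
  rewrite !(rmorph_nat, rmorphN, rmorphD, rmorphM, rmorphXn) /=.
  rewrite -e1 -e2 -e3' -e4'.
  transitivity (W3%:~R * W4%:~R * (W1%:~R * W2%:~R) ^+ 2 * (m%:~R * (S1 - S2) ^+ 2));
    first by ring.
  by rewrite -g0; ring.
- apply: (@intr_inj rat).
  rewrite !(rmorph_nat, rmorphN, rmorphD, rmorphM, rmorphXn) /=.
  rewrite -e1 -e2 -e3' -e4'.
  transitivity (W3%:~R * W4%:~R * (W1%:~R * W2%:~R) ^+ 2 * ((S3 + S4) * (m%:~R * (S1 - S2) ^+ 2)));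
    first by ring.
  by rewrite g1; ring.
by ring.
Qed.

(** * Sizes of products and sums *)

Lemma dvdz_cube (d a : int) : (d ^+ 3 %| a ^+ 3)%Z -> (d %| a)%Z.
Proof. by rewrite !dvdzE !abszX dvdn_pexp2r. Qed.

(** In terms of the cube root of k, which need not be rational, k * a ^ 3 is the
    cube of k^(1/3) a; so this is closure of a fractional ideal under sums. *)
Lemma dvdz_cubeD (d k a b : int) :
  (d %| k * a ^+ 3)%Z -> (d %| k * b ^+ 3)%Z -> (d %| k * (a + b) ^+ 3)%Z.
Proof.
have mixed x y : (d %| k * x ^+ 3)%Z -> (d %| k * y ^+ 3)%Z -> (d %| k * (x ^+ 2 * y))%Z.
  move=> hx hy; apply: dvdz_cube.
  have -> : (k * (x ^+ 2 * y)) ^+ 3 = (k * x ^+ 3) * (k * x ^+ 3) * (k * y ^+ 3) by ring.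
  have -> : d ^+ 3 = d * d * d by ring.
  by rewrite !dvdz_mul.
move=> ha hb.
have -> : k * (a + b) ^+ 3 = k * a ^+ 3 + k * b ^+ 3 +
   3 * (k * (a ^+ 2 * b) + k * (b ^+ 2 * a)) by ring.
by rewrite rpredD ?rpredD // dvdz_mull // rpredD ?mixed.
Qed.

Lemma dvdz_cubeM (d k c a : int) :
  (d %| k * a ^+ 3)%Z -> (d %| k * (c * a) ^+ 3)%Z.
Proof. by move=> h; rewrite exprMn mulrCA dvdz_mull. Qed.

(** The archimedean counterpart of dvdz_cubeD. *)
Lemma leq_cubeD (k a b D p q : nat) : (k * a ^ 3 <= p ^ 3 * D -> k * b ^ 3 <= q ^ 3 * D ->
  k * (a + b) ^ 3 <= (p + q) ^ 3 * D)%N.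
Proof.
have mixed x y p' q' : (k * x ^ 3 <= p' ^ 3 * D -> k * y ^ 3 <= q' ^ 3 * D ->
    k * (x ^ 2 * y) <= p' ^ 2 * q' * D)%N.
  move=> hx hy; rewrite -(@leq_exp2r _ _ 3) //.
  have -> : ((k * (x ^ 2 * y)) ^ 3 = (k * x ^ 3) * (k * x ^ 3) * (k * y ^ 3))%N by ring.
  have -> : ((p' ^ 2 * q' * D) ^ 3 = (p' ^ 3 * D) * (p' ^ 3 * D) * (q' ^ 3 * D))%N by ring.
  by apply: leq_mul => //; apply: leq_mul.
move=> ha hb; have h1 := mixed _ _ _ _ ha hb; have h2 := mixed _ _ _ _ hb ha.
have -> : (k * (a + b) ^ 3 = k * a ^ 3 + k * b ^ 3 + 3 * (k * (a ^ 2 * b)) +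
  3 * (k * (b ^ 2 * a)))%N by ring.
have -> : ((p + q) ^ 3 * D = p ^ 3 * D + q ^ 3 * D + 3 * (p ^ 2 * q * D) +
   3 * (q ^ 2 * p * D))%N by ring.
by apply: leq_add; [apply: leq_add; [apply: leq_add|]|]; rewrite ?leq_pmul2l.
Qed.

Lemma leq_cubeDz (k : nat) (a b : int) (D p q : nat) :
  (k * `|a|%N ^ 3 <= p ^ 3 * D -> k * `|b|%N ^ 3 <= q ^ 3 * D ->
   k * `|(a + b)%R|%N ^ 3 <= (p + q) ^ 3 * D)%N.
Proof.
move=> ha hb; apply: leq_trans (leq_cubeD ha hb).
by rewrite leq_mul // leq_exp2r //; lia.
Qed.

Lemma leq_cubeMz (k : nat) (c a : int) (D : nat) :
  (k * `|a|%N ^ 3 <= D -> k * `|(c * a)%R|%N ^ 3 <= `|c|%N ^ 3 * D)%N.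
Proof. by move=> h; rewrite abszM expnMn mulnCA leq_mul. Qed.

(** A root of a monic integral quadratic polynomial that is rational is
    integral: apply this to X / d and Y / d. *)
Lemma dvdz_of_sum_prod (d x y : int) :
  (d %| x + y)%Z -> (d ^+ 2 %| x * y)%Z -> (d %| x)%Z.
Proof.
have [->|d0] := eqVneq d 0.
  rewrite expr0n /= !dvd0z => /eqP e /eqP; rewrite (_ : y = - x); last first.
    by apply/eqP; rewrite -addr_eq0 addrC e.
  by move/eqP; rewrite mulrN oppr_eq0 mulf_eq0 orbb.
move=> /dvdzP[z h1] /dvdzP[l h2].
have [d' ed] : exists d', d = d' * gcdz d x by apply/dvdzP; apply: dvdz_gcdl.
have [x' ex] : exists x', x = x' * gcdz d x by apply/dvdzP; apply: dvdz_gcdr.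
have cop : coprimez d' x'.
  have g0 : `|gcdz d x|%N != 0%N by rewrite absz_eq0 gcdz_eq0 negb_and d0.
  have ed' : `|d|%N = (`|d'| * `|gcdz d x|)%N by rewrite {1}ed abszM.
  have ex' : `|x|%N = (`|x'| * `|gcdz d x|)%N by rewrite {1}ex abszM.
  have : (gcdn `|d'| `|x'| * `|gcdz d x| = 1 * `|gcdz d x|)%N.
    by rewrite muln_gcdl -ed' -ex' mul1n.
  by move/eqP; rewrite eqn_pmul2r ?lt0n // => /eqP e; rewrite /coprimez /gcdz e.
set g := gcdz d x in ed ex.
have g0 : g ^+ 2 != 0.
  by rewrite expf_neq0 //; apply: contraNneq d0 => g0; rewrite ed g0 mulr0.
have h4 : (d' %| x' ^+ 2)%Z.
  apply/dvdzP; exists (x' * z - d' * l); apply: (mulIf g0).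
  transitivity (x * (x + y) - x * y); first by rewrite ex; ring.
  by rewrite h1 h2 ed ex; ring.
have : (d' %| 1)%Z by rewrite -(Gauss_dvdzl _ (coprimezXr 2 cop)) mul1r.
by rewrite ed ex dvdz1 => /eqP e; rewrite dvdz_mul // dvdzE e dvd1n.
Qed.

(** The quadratic forms x^2 + y z, 2 x y - z^2 and y^2 - 4 x z have no common
    zero: 9 x^4, 9 y^4 and 9 z^4 lie in the ideal they span. Here the variables
    are m^(2/3) a, m^(1/3) b and c, and the lemma bounds from above the p-adic
    content of the values of the forms; cubing makes everything integral. *)
Lemma forms_content (m a b c d e : int) :
    (d %| m * (m * a ^+ 2 + b * c) ^+ 3)%Z ->
    (d %| (2 * m * a * b - c ^+ 2) ^+ 3)%Z ->
    (d %| m ^+ 2 * (b ^+ 2 - 4 * a * c) ^+ 3)%Z ->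
    (e %| m ^+ 2 * a ^+ 3)%Z -> (e %| m * b ^+ 3)%Z -> (e %| c ^+ 3)%Z ->
  [/\ (d * e ^+ 2 %| 9 ^+ 3 * (m ^+ 2 * a ^+ 3) ^+ 4)%Z,
      (d * e ^+ 2 %| 9 ^+ 3 * (m * b ^+ 3) ^+ 4)%Z &
      (d * e ^+ 2 %| 9 ^+ 3 * (c ^+ 3) ^+ 4)%Z].
Proof.
set g0 := m * _ + _; set g1 := _ - c ^+ 2; set g2 := _ - _ * c.
move=> d0 d1 d2 e0 e1 e2.
have mul x y z : (d %| x)%Z -> (e %| y)%Z -> (e %| z)%Z -> (d * e ^+ 2 %| x * (y * z))%Z.
  by move=> *; rewrite expr2; apply: dvdz_mul => //; apply: dvdz_mul.
split.
- have -> : 9 ^+ 3 * (m ^+ 2 * a ^+ 3) ^+ 4 = m ^+ 2 * (9 * (m * a ^+ 2 * g0) +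
      (-1) * (b * c * g0) + (-4) * (a * c * g1) + 1 * (c ^+ 2 * g2)) ^+ 3.
    by rewrite /g0 /g1 /g2; ring.
  apply: dvdz_cubeD; [apply: dvdz_cubeD; [apply: dvdz_cubeD|]|]; apply: dvdz_cubeM.
  + have -> : m ^+ 2 * (m * a ^+ 2 * g0) ^+ 3 =
      m * g0 ^+ 3 * ((m ^+ 2 * a ^+ 3) * (m ^+ 2 * a ^+ 3)) by ring.
    exact: mul.
  + have -> : m ^+ 2 * (b * c * g0) ^+ 3 = m * g0 ^+ 3 * ((m * b ^+ 3) * c ^+ 3) by ring.
    exact: mul.
  + have -> : m ^+ 2 * (a * c * g1) ^+ 3 = g1 ^+ 3 * ((m ^+ 2 * a ^+ 3) * c ^+ 3) by ring.
    exact: mul.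
  + have -> : m ^+ 2 * (c ^+ 2 * g2) ^+ 3 = m ^+ 2 * g2 ^+ 3 * (c ^+ 3 * c ^+ 3) by ring.
    exact: mul.
- have -> : 9 ^+ 3 * (m * b ^+ 3) ^+ 4 = m * (9 * (m * b ^+ 2 * g2) +
      4 * (m * a * c * g2) + 16 * (c ^+ 2 * g0) + 16 * (b * c * g1)) ^+ 3.
    by rewrite /g0 /g1 /g2; ring.
  apply: dvdz_cubeD; [apply: dvdz_cubeD; [apply: dvdz_cubeD|]|]; apply: dvdz_cubeM.
  + have -> : m * (m * b ^+ 2 * g2) ^+ 3 =
      m ^+ 2 * g2 ^+ 3 * ((m * b ^+ 3) * (m * b ^+ 3)) by ring.
    exact: mul.
  + have -> : m * (m * a * c * g2) ^+ 3 = m ^+ 2 * g2 ^+ 3 * ((m ^+ 2 * a ^+ 3) * c ^+ 3) by ring.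
    exact: mul.
  + have -> : m * (c ^+ 2 * g0) ^+ 3 = m * g0 ^+ 3 * (c ^+ 3 * c ^+ 3) by ring.
    exact: mul.
  + have -> : m * (b * c * g1) ^+ 3 = g1 ^+ 3 * (m * b ^+ 3 * c ^+ 3) by ring.
    exact: mul.
have -> : 9 ^+ 3 * (c ^+ 3) ^+ 4 = 1 * (4 * (m * b ^+ 2 * g0) +
      (-4) * (m * b * c * g2) + (-2) * (m * a * b * g1) + (-9) * (c ^+ 2 * g1)) ^+ 3.
  by rewrite /g0 /g1 /g2; ring.
apply: dvdz_cubeD; [apply: dvdz_cubeD; [apply: dvdz_cubeD|]|]; apply: dvdz_cubeM; rewrite ?mul1r.
+ have -> : (m * b ^+ 2 * g0) ^+ 3 = m * g0 ^+ 3 * ((m * b ^+ 3) * (m * b ^+ 3)) by ring.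
  exact: mul.
+ have -> : (m * b * c * g2) ^+ 3 = m ^+ 2 * g2 ^+ 3 * ((m * b ^+ 3) * c ^+ 3) by ring.
  exact: mul.
+ have -> : (m * a * b * g1) ^+ 3 = g1 ^+ 3 * ((m ^+ 2 * a ^+ 3) * (m * b ^+ 3)) by ring.
  exact: mul.
+ have -> : (c ^+ 2 * g1) ^+ 3 = g1 ^+ 3 * (c ^+ 3 * c ^+ 3) by ring.
  exact: mul.
Qed.

(** The archimedean counterpart of forms_content, by the same identities. *)
Lemma forms_size (m a b c : int) (D E : nat) :
    (`|(m * (m * a ^+ 2 + b * c) ^+ 3)%R| <= D)%N ->
    (`|((2 * m * a * b - c ^+ 2) ^+ 3)%R| <= D)%N ->
    (`|(m ^+ 2 * (b ^+ 2 - 4 * a * c) ^+ 3)%R| <= D)%N ->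
    (`|(m ^+ 2 * a ^+ 3)%R| <= E)%N -> (`|(m * b ^+ 3)%R| <= E)%N -> (`|(c ^+ 3)%R| <= E)%N ->
  [/\ (`|(m ^+ 2 * a ^+ 3)%R| ^ 4 <= 125 * (D * E ^ 2))%N,
      (`|(m * b ^+ 3)%R| ^ 4 <= 125 * (D * E ^ 2))%N &
      (`|(c ^+ 3)%R| ^ 4 <= 125 * (D * E ^ 2))%N].
Proof.
set g0 := m * _ + _; set g1 := _ - c ^+ 2; set g2 := _ - _ * c.
move=> d0 d1 d2 e0 e1 e2.
have mul (k t x y z : int) : k * t ^+ 3 = x * (y * z) -> (`|x| <= D)%N -> (`|y| <= E)%N -> (`|z| <= E)%N ->
    (`|k| * `|t| ^ 3 <= D * E ^ 2)%N.
  move=> e hx hy hz; rewrite -abszX -abszM e !abszM.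
  by apply: leq_mul => //; apply: leq_mul.
have fin (k y t : int) (N : nat) : 9 ^+ 3 * y ^+ 4 = k * t ^+ 3 -> (N <= 45)%N ->
    (`|k| * `|t| ^ 3 <= N ^ 3 * (D * E ^ 2))%N -> (`|y| ^ 4 <= 125 * (D * E ^ 2))%N.
  move=> e hN h; rewrite -(@leq_pmul2l (9 ^ 3)) // mulnA.
  have -> : (9 ^ 3 * `|y| ^ 4)%N = `|(9 ^+ 3 * y ^+ 4)%R|%N by rewrite abszM !abszX.
  rewrite e abszM abszX; apply: leq_trans h _.
  by rewrite leq_mul // -[125%N]/(5 ^ 3)%N -expnMn leq_exp2r.
have sum (k t1 t2 t3 t4 c1 c2 c3 c4 : int) :
    (`|k| * `|t1| ^ 3 <= D * E ^ 2)%N -> (`|k| * `|t2| ^ 3 <= D * E ^ 2)%N ->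
    (`|k| * `|t3| ^ 3 <= D * E ^ 2)%N -> (`|k| * `|t4| ^ 3 <= D * E ^ 2)%N ->
    (`|k| * `|(c1 * t1 + c2 * t2 + c3 * t3 + c4 * t4)%R| ^ 3 <=
      (`|c1| + `|c2| + `|c3| + `|c4|) ^ 3 * (D * E ^ 2))%N.
  move=> h1 h2 h3 h4.
  by do 3?apply: leq_cubeDz; apply: leq_cubeMz.
split.
- apply: (fin (m ^+ 2) _ (9 * (m * a ^+ 2 * g0) +
      (-1) * (b * c * g0) + (-4) * (a * c * g1) + 1 * (c ^+ 2 * g2)) 15); last 1 first.
  + apply: sum.
    * by apply: (@mul _ _ (m * g0 ^+ 3) (m ^+ 2 * a ^+ 3) (m ^+ 2 * a ^+ 3)) => //; ring.
    * by apply: (@mul _ _ (m * g0 ^+ 3) (m * b ^+ 3) (c ^+ 3)) => //; ring.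
    * by apply: (@mul _ _ (g1 ^+ 3) (m ^+ 2 * a ^+ 3) (c ^+ 3)) => //; ring.
    * by apply: (@mul _ _ (m ^+ 2 * g2 ^+ 3) (c ^+ 3) (c ^+ 3)) => //; ring.
  + by rewrite /g0 /g1 /g2; ring.
  + by [].
- apply: (fin m _ (9 * (m * b ^+ 2 * g2) +
      4 * (m * a * c * g2) + 16 * (c ^+ 2 * g0) + 16 * (b * c * g1)) 45); last 1 first.
  + apply: sum.
    * by apply: (@mul _ _ (m ^+ 2 * g2 ^+ 3) (m * b ^+ 3) (m * b ^+ 3)) => //; ring.
    * by apply: (@mul _ _ (m ^+ 2 * g2 ^+ 3) (m ^+ 2 * a ^+ 3) (c ^+ 3)) => //; ring.
    * by apply: (@mul _ _ (m * g0 ^+ 3) (c ^+ 3) (c ^+ 3)) => //; ring.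
    * by apply: (@mul _ _ (g1 ^+ 3) (m * b ^+ 3) (c ^+ 3)) => //; ring.
  + by rewrite /g0 /g1 /g2; ring.
  + by [].
apply: (fin 1 _ (4 * (m * b ^+ 2 * g0) +
      (-4) * (m * b * c * g2) + (-2) * (m * a * b * g1) + (-9) * (c ^+ 2 * g1)) 19); last 1 first.
+ apply: sum.
  * by apply: (@mul _ _ (m * g0 ^+ 3) (m * b ^+ 3) (m * b ^+ 3)) => //; ring.
  * by apply: (@mul _ _ (m ^+ 2 * g2 ^+ 3) (m * b ^+ 3) (c ^+ 3)) => //; ring.
  * by apply: (@mul _ _ (g1 ^+ 3) (m ^+ 2 * a ^+ 3) (m * b ^+ 3)) => //; ring.
  * by apply: (@mul _ _ (g1 ^+ 3) (c ^+ 3) (c ^+ 3)) => //; ring.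
+ by rewrite /g0 /g1 /g2; ring.
+ by [].
Qed.

(** The size and the content of the projective point (m^(1/3) W : s), cubed;
    their quotient is the cube of its height. *)
Definition size3 (m W s : int) : nat := maxn `|(m * W ^+ 3)%R|%N `|(s ^+ 3)%R|%N.
Definition content3 (m W s : int) : nat := gcdn `|(m * W ^+ 3)%R|%N `|(s ^+ 3)%R|%N.

Lemma gcdn_expn (a b n : nat) : gcdn (a ^ n) (b ^ n) = (gcdn a b ^ n)%N.
Proof.
have [->|n0] := posnP n; first by rewrite !expn0.
have [g0|g0] := posnP (gcdn a b).
  have : ~~ ((0 < a) || (0 < b))%N by rewrite -gcdn_gt0 g0.
  by rewrite negb_or !lt0n !negbK => /andP[/eqP -> /eqP ->]; rewrite !gcdnn.
have /dvdnP[a' ea] := dvdn_gcdl a b; have /dvdnP[b' eb] := dvdn_gcdr a b.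
set g := gcdn a b in g0 ea eb *.
have cop : coprime a' b'.
  by rewrite /coprime -(eqn_pmul2r g0) mul1n muln_gcdl -ea -eb.
rewrite ea eb !expnMn -muln_gcdl.
by have /eqP -> : coprime (a' ^ n) (b' ^ n); rewrite ?mul1n // coprimeXl ?coprimeXr.
Qed.

(** Gauss's lemma for the product of two linear forms: the content of the
    symmetric functions of a pair is the product of the two contents. *)
Lemma content3_mul (m W1 s1 W2 s2 : int) (d : nat) :
    (d %| m ^+ 2 * (W1 * W2) ^+ 3)%Z -> (d %| m * (W1 * s2 + W2 * s1) ^+ 3)%Z ->
    (d %| (s1 * s2) ^+ 3)%Z ->
  (d %| content3 m W1 s1 * content3 m W2 s2)%N.
Proof.
move=> h0 h1 h2.
pose x := m * W1 ^+ 3 * s2 ^+ 3; pose y := s1 ^+ 3 * (m * W2 ^+ 3).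
have hsum : (d %| x + y)%Z.
  have -> : x + y = m * (W1 * s2 + W2 * s1) ^+ 3 -
      3 * (m * (W1 * s2 * (W2 * s1)) * (W1 * s2 + W2 * s1)) by rewrite /x /y; ring.
  rewrite rpredB // dvdz_mull //; apply: dvdz_cube.
  have -> : (m * (W1 * s2 * (W2 * s1)) * (W1 * s2 + W2 * s1)) ^+ 3 =
    (m ^+ 2 * (W1 * W2) ^+ 3) * (s1 * s2) ^+ 3 * (m * (W1 * s2 + W2 * s1) ^+ 3) by ring.
  have -> : (d : int) ^+ 3 = d%:Z * d * d by ring.
  by apply: dvdz_mul => //; apply: dvdz_mul.
have hprod : (d%:Z ^+ 2 %| x * y)%Z.
  have -> : x * y = (m ^+ 2 * (W1 * W2) ^+ 3) * (s1 * s2) ^+ 3 by rewrite /x /y; ring.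
  by rewrite expr2; apply: dvdz_mul.
have hx := dvdz_of_sum_prod hsum hprod.
have hy : (d %| y)%Z by rewrite addrC mulrC in hsum hprod; apply: dvdz_of_sum_prod hsum hprod.
have dv z : (d %| `|z|)%N = (d%:Z %| z)%Z by rewrite dvdzE absz_nat.
rewrite /content3 muln_gcdl !muln_gcdr -!abszM !dvdn_gcd !dv.
rewrite hx hy; apply/andP; split; last by rewrite -exprMn.
rewrite andbT (_ : m * W1 ^+ 3 * (m * W2 ^+ 3) = m ^+ 2 * (W1 * W2) ^+ 3) //; ring.
Qed.

(** The archimedean counterpart of dvdz_of_sum_prod. *)
Lemma leq_of_sum_prod (x y : int) (E : nat) :
  (`|(x + y)%R| <= 4 * E)%N -> (`|x| * `|y| <= E ^ 2)%N ->
  (`|x| <= 5 * E)%N /\ (`|y| <= 5 * E)%N.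
Proof.
move=> hsum hprod.
have key (p q : nat) : (p <= q + 4 * E)%N -> (p * q <= E ^ 2)%N -> (p <= 5 * E)%N.
  move=> {hsum hprod} h h'; case: (leqP q E) => hq; first by lia.
  by rewrite leqNgt; apply/negP => hp; move: h'; rewrite leqNgt -mulnn ltn_mul //; lia.
by split; [apply: (key _ `|y|%N) | apply: (key _ `|x|%N)]; rewrite 1?mulnC //; lia.
Qed.

(** The archimedean counterpart of content3_mul. *)
Lemma size3_mul (m W1 s1 W2 s2 : int) (E : nat) :
    (`|(m ^+ 2 * (W1 * W2) ^+ 3)%R| <= E)%N ->
    (`|(m * (W1 * s2 + W2 * s1) ^+ 3)%R| <= E)%N ->
    (`|((s1 * s2) ^+ 3)%R| <= E)%N ->
  (size3 m W1 s1 * size3 m W2 s2 <= 5 * E)%N.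
Proof.
move=> h0 h1 h2.
pose x := m * W1 ^+ 3 * s2 ^+ 3; pose y := s1 ^+ 3 * (m * W2 ^+ 3).
have hsum : (`|(x + y)%R| <= 4 * E)%N.
  have -> : x + y = m * (W1 * s2 + W2 * s1) ^+ 3 -
      3 * (m * (W1 * s2 * (W2 * s1)) * (W1 * s2 + W2 * s1)) by rewrite /x /y; ring.
  suff : (`|(m * (W1 * s2 * (W2 * s1)) * (W1 * s2 + W2 * s1))%R| <= E)%N.
    by move: h1; move: (m * _ ^+ 3) (m * _ * _) => p q; clear; lia.
  rewrite -(@leq_exp2r _ _ 3) // -abszX.
  have -> : (m * (W1 * s2 * (W2 * s1)) * (W1 * s2 + W2 * s1)) ^+ 3 =
    (m ^+ 2 * (W1 * W2) ^+ 3) * (s1 * s2) ^+ 3 * (m * (W1 * s2 + W2 * s1) ^+ 3) by ring.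
  have -> : (E ^ 3 = E * E * E)%N by ring.
  by rewrite abszM; apply: leq_mul => //; rewrite abszM; apply: leq_mul.
have hprod : (`|x| * `|y| <= E ^ 2)%N.
  rewrite -abszM.
  have -> : x * y = (m ^+ 2 * (W1 * W2) ^+ 3) * (s1 * s2) ^+ 3 by rewrite /x /y; ring.
  by rewrite abszM -mulnn leq_mul.
have [hx hy] := leq_of_sum_prod hsum hprod.
rewrite /size3 maxnMl !maxnMr -!abszM !geq_max hx hy /=.
apply/andP; split; last by rewrite -exprMn (leq_trans h2) ?leq_pmull.
have -> : m * W1 ^+ 3 * (m * W2 ^+ 3) = m ^+ 2 * (W1 * W2) ^+ 3 by ring.
by rewrite (leq_trans h0) ?leq_pmull.
Qed.

(** Over all places together: the heights of the two points of a pair multiply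
    to the height of the pair's symmetric functions up to a constant, and the
    three quadratic forms square that height up to a constant. *)
Lemma height_parallelogram : exists C : nat, forall
  (m W1 s1 W2 s2 W3 s3 W4 s4 k l : int) (h1 h2 h3 h4 : nat),
  let a := W1 * W2 in let b := W1 * s2 + W2 * s1 in let c := s1 * s2 in
  m != 0 -> k != 0 -> l != 0 ->
  k * (W3 * W4) = l * (m * a ^+ 2 + b * c) ->
  k * (W3 * s4 + W4 * s3) = l * (2 * m * a * b - c ^+ 2) ->
  k * (s3 * s4) = l * (m * (b ^+ 2 - 4 * a * c)) ->
  (0 < size3 m W1 s1)%N -> (0 < size3 m W2 s2)%N ->
  (size3 m W1 s1 = h1 * content3 m W1 s1)%N ->
  (size3 m W2 s2 = h2 * content3 m W2 s2)%N ->
  (size3 m W3 s3 = h3 * content3 m W3 s3)%N ->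
  (size3 m W4 s4 = h4 * content3 m W4 s4)%N ->
  ((h1 * h2) ^ 2 <= C * (h3 * h4))%N.
Proof.
exists (5 ^ 2 * (125 * (729 * 8)))%N => m W1 s1 W2 s2 W3 s3 W4 s4 k l h1 h2 h3 h4 a b c m0 k0 l0 e0 e1 e2 p1 p2 E1 E2 E3 E4.
(* The letters x, y, z refer to the symmetric functions of points 3 and 4, to
   those of points 1 and 2, and to the quadratic forms in the latter; capitals are
   sizes, small letters contents. *)
pose z0 := m * (m * a ^+ 2 + b * c) ^+ 3.
pose z1 := (2 * m * a * b - c ^+ 2) ^+ 3.
pose z2 := m ^+ 2 * (b ^+ 2 - 4 * a * c) ^+ 3.
pose y0 := m ^+ 2 * a ^+ 3; pose y1 := m * b ^+ 3; pose y2 := c ^+ 3.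
pose x0 := m ^+ 2 * (W3 * W4) ^+ 3; pose x1 := m * (W3 * s4 + W4 * s3) ^+ 3.
pose x2 := (s3 * s4) ^+ 3.
pose D := maxn (maxn `|z0| `|z1|) `|z2|; pose d := gcdn (gcdn `|z0| `|z1|) `|z2|.
pose Y := maxn (maxn `|y0| `|y1|) `|y2|; pose e := gcdn (gcdn `|y0| `|y1|) `|y2|.
pose X := maxn (maxn `|x0| `|x1|) `|x2|; pose f := gcdn (gcdn `|x0| `|x1|) `|x2|.
have [K [L [K0 L0 g0 g1 g2]]] : exists K L : nat, [/\ (0 < K)%N, (0 < L)%N,
   (K * `|x0| = L * `|z0|)%N, (K * `|x1| = L * `|z1|)%N & (K * `|x2| = L * `|z2|)%N].
  exists `|(k ^+ 3)%R|%N, `|(l ^+ 3 * m)%R|%N; rewrite !absz_gt0 (mulf_eq0 (l ^+ 3)) !expf_eq0 /= negb_or k0 l0 m0.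
  rewrite -!abszM; split=> //; apply: (congr1 absz).
  - transitivity (m ^+ 2 * (k * (W3 * W4)) ^+ 3); first by rewrite /x0; ring.
    by rewrite e0 /z0; ring.
  - transitivity (m * (k * (W3 * s4 + W4 * s3)) ^+ 3); first by rewrite /x1; ring.
    by rewrite e1 /z1; ring.
  - transitivity ((k * (s3 * s4)) ^+ 3); first by rewrite /x2; ring.
    by rewrite e2 /z2; ring.
have eX : (K * X = L * D)%N by rewrite /X /D !maxnMr g0 g1 g2.
have ef : (K * f = L * d)%N by rewrite /f /d !muln_gcdr g0 g1 g2.
have hX : (X <= 8 * (size3 m W3 s3 * size3 m W4 s4))%N.
  have hm W s : (`|m| * `|W| ^ 3 <= size3 m W s)%N.
    by rewrite -abszX -abszM leq_maxl.
  have hs W s : (`|s| ^ 3 <= size3 m W s)%N by rewrite -abszX leq_maxr.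
  rewrite !geq_max; apply/andP; split; last first.
    by rewrite /x2 exprMn abszM !abszX (leq_trans (leq_mul (hs W3 s3) (hs W4 s4))) ?leq_pmull.
  apply/andP; split.
    have -> : x0 = m * W3 ^+ 3 * (m * W4 ^+ 3) by rewrite /x0; ring.
    by rewrite abszM !(abszM m) !abszX (leq_trans (leq_mul (hm W3 s3) (hm W4 s4))) ?leq_pmull.
  rewrite abszM abszX; apply: (@leq_cubeDz _ _ _ _ 1 1); rewrite mul1n abszM expnMn.
    by rewrite mulnA leq_mul.
  by rewrite mulnA mulnC leq_mul.
have hf : (content3 m W3 s3 * content3 m W4 s4 %| f)%N.
  have hm W s : (content3 m W s %| m * W ^+ 3)%Z by rewrite dvdzE dvdn_gcdl.
  have hs W s : (content3 m W s %| s ^+ 3)%Z by rewrite dvdzE dvdn_gcdr.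
  have dv z : (content3 m W3 s3 * content3 m W4 s4 %| `|z|)%N =
      ((content3 m W3 s3)%:Z * (content3 m W4 s4)%:Z %| z)%Z.
    by rewrite dvdzE abszM !absz_nat.
  rewrite !dvdn_gcd !dv; apply/andP; split; last first.
    by rewrite /x2 exprMn; apply: dvdz_mul.
  apply/andP; split.
    have -> : x0 = m * W3 ^+ 3 * (m * W4 ^+ 3) by rewrite /x0; ring.
    by apply: dvdz_mul.
  apply: dvdz_cubeD.
    have -> : m * (W3 * s4) ^+ 3 = m * W3 ^+ 3 * s4 ^+ 3 by ring.
    by apply: dvdz_mul.
  have -> : m * (W4 * s3) ^+ 3 = s3 ^+ 3 * (m * W4 ^+ 3) by ring.
  by apply: dvdz_mul.
have hY : (size3 m W1 s1 * size3 m W2 s2 <= 5 * Y)%N.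
  by apply: size3_mul; rewrite /Y !leq_max leqnn ?orbT.
have Y0 : (0 < Y)%N by move: hY; rewrite -(@ltn_pmul2l 5) // muln0; apply: leq_trans; rewrite muln_gt0 p1.
have he : (e %| content3 m W1 s1 * content3 m W2 s2)%N.
  apply: content3_mul; rewrite dvdzE /e ?dvdn_gcdr //.
    by rewrite (dvdn_trans (dvdn_gcdl _ _)) ?dvdn_gcdl.
  by rewrite (dvdn_trans (dvdn_gcdl _ _)) ?dvdn_gcdr.
have hYD : (Y ^ 2 <= 125 * D)%N.
  have [f0 f1 f2] : [/\ (`|y0| ^ 4 <= 125 * (D * Y ^ 2))%N,
     (`|y1| ^ 4 <= 125 * (D * Y ^ 2))%N & (`|y2| ^ 4 <= 125 * (D * Y ^ 2))%N].
    by apply: forms_size; rewrite ?leq_max leqnn ?orbT.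
  have max_ind (P : pred nat) x y : P x -> P y -> P (maxn x y) by rewrite /maxn; case: ifP.
  have : (Y ^ 4 <= 125 * (D * Y ^ 2))%N.
    rewrite {1}/Y; move: (125 * (D * Y ^ 2))%N f0 f1 f2 => B f0 f1 f2.
    by apply: (max_ind (fun z => z ^ 4 <= B)%N) => //; apply: (max_ind (fun z => z ^ 4 <= B)%N).
  by rewrite mulnA -[4%N]/(2 + 2)%N expnD leq_pmul2r // expn_gt0 Y0.
have e_gt0 : (0 < e)%N.
  rewrite /e !gcdn_gt0; move: Y0; rewrite /Y !leq_max.
  by case/orP => [/orP[]|] ->; rewrite ?orbT.
have hde : (d <= 729 * e ^ 2)%N.
  have [f0 f1 f2] : [/\ (d%:Z * e%:Z ^+ 2 %| 9 ^+ 3 * y0 ^+ 4)%Z,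
     (d%:Z * e%:Z ^+ 2 %| 9 ^+ 3 * y1 ^+ 4)%Z & (d%:Z * e%:Z ^+ 2 %| 9 ^+ 3 * y2 ^+ 4)%Z].
    apply: forms_content; rewrite dvdzE ?dvdn_gcdr //.
    - by rewrite (dvdn_trans (dvdn_gcdl _ _)) ?dvdn_gcdl.
    - by rewrite (dvdn_trans (dvdn_gcdl _ _)) ?dvdn_gcdr.
    - by rewrite (dvdn_trans (dvdn_gcdl _ _)) ?dvdn_gcdl.
    - by rewrite (dvdn_trans (dvdn_gcdl _ _)) ?dvdn_gcdr.
  have : (d * e ^ 2 %| 729 * e ^ 4)%N.
    have toN (y : int) : (d%:Z * e%:Z ^+ 2 %| 9 ^+ 3 * y ^+ 4)%Z ->
        (d * e ^ 2 %| 729 * `|y| ^ 4)%N.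
      by rewrite dvdzE (abszM (9 ^+ 3)) (abszM d) !abszX.
    move: f0 f1 f2 => /toN f0 /toN f1 /toN f2.
    have ee : (e ^ 4 = gcdn (gcdn (`|y0| ^ 4) (`|y1| ^ 4)) (`|y2| ^ 4))%N.
      by rewrite !gcdn_expn.
    by rewrite ee !muln_gcdr !dvdn_gcd f0 f1 f2.
  move/dvdn_leq; rewrite muln_gt0 expn_gt0 e_gt0 => /(_ isT).
  by rewrite -[4%N]/(2 + 2)%N expnD mulnA leq_pmul2r // expn_gt0 e_gt0.
have D0 : (0 < D)%N by move: hYD; case: (D) => //; rewrite muln0 leqn0 expn_eq0 (gtn_eqF Y0).
have d0 : (0 < d)%N.
  rewrite /d !gcdn_gt0; move: D0; rewrite /D !leq_max.
  by case/orP => [/orP[]|] ->; rewrite ?orbT.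
have f0 : (0 < f)%N by rewrite -(ltn_pmul2l K0) muln0 ef muln_gt0 L0.
move: p1 p2 hX hf hY he; rewrite E1 E2 E3 E4 !muln_gt0 => /andP[_ p1] /andP[_ p2].
move: (content3 m W1 s1) (content3 m W2 s2) (content3 m W3 s3) (content3 m W4 s4) p1 p2.
move=> c1 c2 c3 c4 p1 p2 hX /(dvdn_leq f0) hf hY he.
have c0 : (0 < c1 * c2)%N by rewrite muln_gt0 p1.
have {}he := dvdn_leq c0 he.
have hD : (D <= 8 * (h3 * h4) * d)%N.
  rewrite -(leq_pmul2l L0) -eX (mulnCA L) -ef (mulnCA _ K) leq_pmul2l //.
  by apply: leq_trans hX _; rewrite mulnACA mulnA leq_mul.
rewrite -(@leq_pmul2r ((c1 * c2) ^ 2)); last by rewrite expn_gt0 c0.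
rewrite -expnMn mulnACA.
apply: leq_trans (_ : 5 ^ 2 * (125 * (8 * (h3 * h4) * (729 * (c1 * c2) ^ 2))) <= _)%N; last first.
  by apply: eq_leq; ring.
apply: leq_trans (_ : (5 * Y) ^ 2 <= _)%N; first by rewrite leq_exp2r.
rewrite expnMn leq_mul // (leq_trans hYD) // leq_mul // (leq_trans hD) // leq_mul //.
by rewrite (leq_trans hde) // leq_mul // leq_exp2r.
Qed.

(** * Growth of the multiples of a point *)

(** Up to a constant, m / (u + v)^3 is the cube of the Weierstrass x-coordinate of
    the point that corresponds to P on the curve twisted to m = 1. The logarithm
    of this height therefore differs from a multiple of the canonical height by an
    amount that is bounded independently of m. *)
Definition height (m : int) (P : rat_point) : nat :=
  if P is Affine u v then
    let x := m%:~R / (u + v) ^+ 3 in maxn `|numq x| `|denq x|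
  else 1%N.

Lemma height_gt0 m P : (0 < height m P)%N.
Proof. by case: P => //= u v; rewrite leq_max !absz_gt0 denq_neq0 orbT. Qed.

Lemma maxn_gcdn_numq_denq (a b : int) (x : rat) : b != 0 -> x = a%:~R / b%:~R ->
  (maxn `|a| `|b| = maxn `|numq x| `|denq x| * gcdn `|a| `|b|)%N.
Proof.
move=> b0 ex; have e : a * denq x = numq x * b.
  apply: (@intr_inj rat); rewrite !intrM; move: (divq_num_den x); rewrite {3}ex => /eqP.
  by rewrite eqr_div ?intr_eq0 ?denq_neq0 // => /eqP ->; rewrite mulrC.
have {}e : (`|a| * `|denq x| = `|numq x| * `|b|)%N by rewrite -!abszM e.
have cop := coprime_num_den x; have d0 : (0 < `|denq x|)%N by rewrite absz_gt0 denq_neq0.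
have eb : (`|b| = `|denq x| * gcdn `|a| `|b|)%N.
  by rewrite muln_gcdr [(`|denq x| * `|a|)%N]mulnC e -muln_gcdl; move/eqP: cop => ->; rewrite mul1n.
have ea : (`|a| = `|numq x| * gcdn `|a| `|b|)%N.
  by apply/eqP; rewrite -(eqn_pmul2r d0) e {1}eb mulnA mulnAC.
by rewrite maxnMl -ea -eb.
Qed.

Lemma size3_height m P W s : m != 0 -> represents P W s ->
  size3 m W s = (height m P * content3 m W s)%N.
Proof.
move=> m0; case: P => [|u v] /=.
  by case=> W0 ->; rewrite /size3 /content3 expr0n /= maxn0 gcdn0 mul1n.
case=> s0 e; have w0 : W != 0.
  by apply: contraNneq s0 => w; rewrite w mulr0 in e; rewrite -(intr_eq0 rat) -e.
apply: maxn_gcdn_numq_denq; first by rewrite expf_neq0.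
have {}e : u + v = s%:~R / W%:~R by rewrite -e mulfK ?intr_eq0.
by rewrite e (intrM _ m) !rmorphXn /= expr_div_n invfM invrK mulrA mulrAC.
Qed.

Lemma size3_gt0 m P W s : m != 0 -> represents P W s -> (0 < size3 m W s)%N.
Proof.
move=> m0 h; rewrite leq_max !absz_gt0; apply/orP; case: P h => [|u v] [h _].
  by left; rewrite mulf_neq0 ?expf_neq0.
by right; rewrite expf_neq0.
Qed.

Lemma represents_lowest (m : int) P U V W : m != 0 -> on_curve m P ->
  lowest_terms P U V W -> represents P W%:Z (U + V).
Proof.
move=> m0 hP [W0 _ e]; subst P; have s0 := sum_neq0_on_curve m0 hP.
have w0 : W%:R != 0 :> rat by rewrite pnatr_eq0 -lt0n.
have e : (U%:~R / W%:R + V%:~R / W%:R) * W%:R = (U + V)%:~R :> rat.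
  by rewrite mulrDl !divfK // intrD.
by split=> //; rewrite -(intr_eq0 rat) -e mulf_neq0.
Qed.

Lemma exists_represents m P : m != 0 -> on_curve m P ->
  exists W s, represents P W s.
Proof.
move=> m0; case: P => [|u v] hP; first by exists 1, 0.
have [U [V [W h]]] := lowest_terms_exists u v.
by exists W%:Z, (U + V); apply: represents_lowest m0 hP h.
Qed.

Lemma add_pointC P Q : add_point P Q = add_point Q P.
Proof. by rewrite /add_point third_pointC. Qed.

(** The parallelogram law at (n + 1) R and R. *)
Lemma height_mul_point : exists C : nat, forall (m : int) R n, m != 0 ->
    on_curve m R -> nontorsion R ->
  ((height m (mul_point n.+1 R) * height m R) ^ 2 <=
   C * (height m (mul_point n.+2 R) * height m (mul_point n R)))%N.
Proof.
have [C hC] := height_parallelogram; exists C => m R n m0 hR nt.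
have hn k := mul_point_on_curve k hR.
have [W1 [s1 r1]] := exists_represents m0 (hn n.+1).
have [W2 [s2 r2]] := exists_represents m0 hR.
have [W3 [s3 r3]] := exists_represents m0 (hn n.+2).
have [W4 [s4 r4]] := exists_represents m0 (hn n).
have e3 : mul_point n.+2 R = add_point (mul_point n.+1 R) R by rewrite add_pointC.
have e4 : mul_point n R = add_point (mul_point n.+1 R) (reflect_point R).
  by rewrite (mul_point_pred _ m0 hR).
rewrite e3 in r3; rewrite e4 in r4.
have [] := represents_add_sub m0 (hn n.+1) hR _ _ _ r1 r2 r3 r4.
- exact: nt.
- by move=> R0; apply: (nt 1%N); rewrite // mul_point1.
- by rewrite -e3; apply: nt.
move=> k [l [k0 l0 f0 f1 f2]]; rewrite e3 e4.
apply: (hC _ _ _ _ _ _ _ _ _ _ _ _ _ _ _ m0 k0 l0 f0 f1 f2).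
- exact: size3_gt0 m0 r1.
- exact: size3_gt0 m0 r2.
- exact: size3_height m0 r1.
- exact: size3_height m0 r2.
- exact: size3_height m0 r3.
- exact: size3_height m0 r4.
Qed.

(** The second difference of the logarithmic height of n R is at least twice the
    height of R up to a constant; when the latter dominates that constant, the
    height grows quadratically. An exponential bound is all that is needed. *)
Lemma height_mul_point_large : exists C : nat, forall (m : int) R n, m != 0 ->
    on_curve m R -> nontorsion R -> (C <= height m R)%N ->
  (height m R ^ n <= height m (mul_point n R))%N.
Proof.
have [C hC] := height_mul_point; exists C => m R n m0 hR nt hCR.
set a := fun n => height m (mul_point n R).
have a1 : a 1%N = height m R by rewrite /a mul_point1.
rewrite -a1 in hCR *; rewrite -/(a n).
have a_gt0 k : (0 < a k)%N by exact: height_gt0.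
have step k : (a k * a 1%N ^ k.+1 <= a k.+1)%N.
  suff h : (a k * a 1 ^ (2 * k + 1) <= a k.+1 * C ^ k)%N.
    have hC0 : (0 < a 1 ^ k)%N by rewrite expn_gt0 a_gt0.
    rewrite -(leq_pmul2r hC0) -mulnA -expnD.
    rewrite (_ : k.+1 + k = 2 * k + 1)%N; last by lia.
    by rewrite (leq_trans h) // leq_mul //; case: (k) => // k'; rewrite leq_exp2r.
  elim: k => [|k IHk]; first by rewrite muln0 add0n expn0 muln1 expn1 {1}/a /= mul1n.
  rewrite -(leq_pmul2l (a_gt0 k)).
  have h := hC m R k m0 hR nt; rewrite -/(a _) -/(a k.+2) -/(a k) -a1 in h.
  apply: (@leq_trans (a k.+1 * (a k.+1 * C ^ k) * a 1 ^ 2)).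
    rewrite (_ : 2 * k.+1 + 1 = 2 * k + 1 + 2)%N; last by lia.
    rewrite expnD; move: IHk; move: (a 1 ^ _)%N (a 1 ^ 2)%N (C ^ k)%N => x y z IHk.
    rewrite (_ : a k * _ = a k.+1 * (a k * x) * y)%N; last by ring.
    by rewrite leq_mul // leq_mul.
  apply: (@leq_trans ((a k.+1 * a 1) ^ 2 * C ^ k)).
    by apply: eq_leq; move: (C ^ k)%N (a k.+1) (a 1%N) => x y z; ring.
  apply: leq_trans (leq_mul h (leqnn _)) _; rewrite expnS; apply: eq_leq.
  by move: (C ^ k)%N (a k.+2) (a k) => x y z; ring.
elim: n => [|n IHn]; first by rewrite expn0.
rewrite (leq_trans _ (step n)) // -[X in (X <= _)%N]mul1n leq_mul //.
Qed.

(** * Growth uniform in m and in the point *)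

(** The norm of U + V w from Q(w), where w is a primitive cube root of unity. *)
Definition qform (U V : int) : int := U ^+ 2 - U * V + V ^+ 2.

Lemma four_qform U V : 4 * qform U V = (U + V) ^+ 2 + 3 * (U - V) ^+ 2.
Proof. by rewrite /qform; ring. Qed.

Lemma qform_ge0 U V : 0 <= qform U V.
Proof.
have := four_qform U V; have := sqr_ge0 (U + V); have := sqr_ge0 (U - V).
by move: ((U + V) ^+ 2) ((U - V) ^+ 2) (qform _ _) => x y z; lia.
Qed.

Lemma lowest_cubes (m : int) P U V W : on_curve m P -> lowest_terms P U V W ->
  m * W%:Z ^+ 3 = (U + V) * qform U V.
Proof.
move=> hP [W0 _ e]; move: hP; rewrite e /= => h.
have w0 : W%:R != 0 :> rat by rewrite pnatr_eq0 -lt0n.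
apply: (@intr_inj rat); rewrite intrM -h /qform.
rewrite !(rmorphXn, rmorphM, rmorphB, rmorphD) /= -[W%:~R]/(W%:R).
by field.
Qed.

Lemma lowest_sum_neq0 (m : int) P U V W : m != 0 -> on_curve m P ->
  lowest_terms P U V W -> U + V != 0.
Proof.
by move=> m0 hP lt; have := represents_lowest m0 hP lt; case: lt => _ _ -> [].
Qed.

Lemma lowest_qform_gt0 (m : int) P U V W : m != 0 -> on_curve m P ->
  lowest_terms P U V W -> 0 < qform U V.
Proof.
move=> m0 hP lt; have := lowest_cubes hP lt; case: lt => W0 _ _ e.
rewrite lt0r qform_ge0 andbT.
apply: contraNneq m0 => q0; move/eqP: e; rewrite q0 mulr0 mulf_eq0 expf_eq0 /=.
by rewrite eqz_nat eqn0Ngt W0 orbF.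
Qed.

(** If a prime p divided U and V, it would not divide W, and p^3 would divide m. *)
Lemma lowest_coprime (m : int) P U V W : m != 0 -> cube_free m -> on_curve m P ->
  lowest_terms P U V W -> coprimez U V.
Proof.
move=> m0 cfm hP lt; case: (lt) => W0 g _; rewrite coprimezE /coprime.
apply: contraT => g1; have s0 := lowest_sum_neq0 m0 hP lt.
have g0 : (0 < gcdn `|U| `|V|)%N.
  rewrite gcdn_gt0 !absz_gt0 -negb_and; apply: contraNN s0.
  by move=> /andP[/eqP -> /eqP ->].
have [p pr_p pg] : exists2 p, prime p & (p %| gcdn `|U| `|V|)%N.
  exists (pdiv (gcdn `|U| `|V|)); last exact: pdiv_dvd.
  by apply: pdiv_prime; rewrite ltn_neqAle eq_sym g1.
have pW : coprime p W.
  rewrite prime_coprime //; apply/negP => pW.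
  have : (p %| 1)%N by rewrite -g dvdn_gcd pg pW.
  by rewrite dvdn1 => /eqP p1; rewrite p1 in pr_p.
have /dvdzP[U' eU] : (p %| U)%Z by rewrite dvdzE; apply: dvdn_trans pg (dvdn_gcdl _ _).
have /dvdzP[V' eV] : (p %| V)%Z by rewrite dvdzE; apply: dvdn_trans pg (dvdn_gcdr _ _).
have : (p%:Z ^+ 3 %| m * W%:Z ^+ 3)%Z.
  rewrite (lowest_cubes hP lt) eU eV; apply/dvdzP; exists (U' ^+ 3 + V' ^+ 3).
  by rewrite /qform; ring.
by rewrite Gauss_dvdzl ?(negbTE (cfm p pr_p)) // coprimezXl // coprimezXr.
Qed.

Lemma gcd_sum_sqr_qform (U V : int) (d : int) : coprimez U V ->
  (d %| (U + V) ^+ 2)%Z -> (d %| qform U V)%Z -> (d %| 3)%Z.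
Proof.
move=> cop d1 d2.
have d3 : (d %| 3 * (U * V))%Z.
  have -> : 3 * (U * V) = (U + V) ^+ 2 - qform U V by rewrite /qform; ring.
  by rewrite rpredB.
have {}cop : coprimez ((U + V) ^+ 2) (U * V).
  rewrite coprimezXl // coprimezMr /coprimez ![gcdz (U + V) _]gcdzC gcdzDl gcdzDr.
  by rewrite [gcdz V U]gcdzC andbb.
have {}cop : coprimez d (U * V) by apply: coprimez_dvdl cop.
by rewrite -(Gauss_dvdzl _ cop).
Qed.

(** The height of a point against the size of its coordinates; the gain over a
    general estimate, no loss depending on m, comes from m being cube-free. *)
Lemma height_qform (m : int) P U V W : m != 0 -> cube_free m -> on_curve m P ->
    lowest_terms P U V W ->
  (`|qform U V| <= 3 * height m P)%N /\ (height m P <= 4 * `|qform U V|)%N.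
Proof.
move=> m0 cfm hP lt; have s0 := lowest_sum_neq0 m0 hP lt.
have := size3_height m0 (represents_lowest m0 hP lt).
have cop := lowest_coprime m0 cfm hP lt.
rewrite /size3 /content3 (lowest_cubes hP lt) !exprS expr0 mulr1 !abszM.
rewrite -maxnMr -muln_gcdr mulnCA -abszM => /eqP.
rewrite eqn_pmul2l ?absz_gt0 // => /eqP.
set g := gcdn _ _; set q := qform U V in g *; set h := height m P => e.
have g3 : (g <= 3)%N.
  apply: dvdn_leq => //; rewrite -[g]absz_nat -[3%N]absz_nat -dvdzE.
  by apply: gcd_sum_sqr_qform cop _ _; rewrite dvdzE ?dvdn_gcdr ?dvdn_gcdl.
have g0 : (0 < g)%N by rewrite gcdn_gt0 orbC absz_gt0 mulf_neq0.
split.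
  by apply: (@leq_trans (h * g)); rewrite -?e ?leq_maxl // e mulnC leq_mul.
apply: (@leq_trans (h * g)); first by rewrite leq_pmulr.
rewrite -e geq_max leq_pmull //=.
have := four_qform U V; rewrite -/q (expr2 (U + V)).
have := sqr_ge0 (U - V); have := sqr_ge0 (U + V); rewrite (expr2 (U + V)).
by move: ((U - V) ^+ 2) ((U + V) * (U + V)) q {e g3 g0 g} => x y q; lia.
Qed.

Lemma qform_bound U V : (`|U| <= 2 * `|qform U V|)%N /\ (`|V| <= 2 * `|qform U V|)%N.
Proof.
have key (x y : int) : (`|y| <= 2 * `|qform x y|)%N.
  have le_sqr (z : int) : (`|z| <= `|z ^+ 2|)%N by rewrite abszX -mulnn; case: (`|z|)%N => // n; rewrite leq_pmulr.
  apply: leq_trans (le_sqr y) _.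
  have e : 4 * qform x y = (2 * x - y) ^+ 2 + 3 * y ^+ 2 by rewrite /qform; ring.
  have := sqr_ge0 (2 * x - y); have := sqr_ge0 y; move: e.
  by move: ((2 * x - y) ^+ 2) (y ^+ 2) (qform x y) => a b q; clear; lia.
split=> //; have -> : qform U V = qform V U by rewrite /qform; ring.
exact: key.
Qed.

Lemma bounded_choice (N : nat) (Q : int -> nat -> Prop) :
  (forall x n n', Q x n -> (n <= n')%N -> Q x n') ->
  (forall x, (`|x| <= N)%N -> exists n, Q x n) ->
  exists n, forall x, (`|x| <= N)%N -> Q x n.
Proof.
move=> mono; elim: N => [|N IHN] h.
  have [n hn] := h 0 isT; exists n => x; rewrite leqn0 absz_eq0 => /eqP ->.
  exact: hn.
have [x hx|n hn] := IHN; first by apply: h; apply: leqW.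
have [n1 hn1] := h N.+1%:Z (leqnn _).
have [n2 hn2] := h (- N.+1%:Z) (leqnn _).
exists (maxn n (maxn n1 n2)) => x; rewrite leq_eqVlt => /orP[/eqP e|lt].
  have [->|->] : x = N.+1%:Z \/ x = - N.+1%:Z by lia.
    by apply: mono hn1 _; lia.
  by apply: mono hn2 _; lia.
by apply: mono (hn x lt) _; lia.
Qed.

Lemma lowest_coords_bound (m : int) P U V W : m != 0 -> on_curve m P ->
    lowest_terms P U V W -> (`|m| <= 4 * `|qform U V| ^ 2)%N /\ (W <= 4 * `|qform U V| ^ 2)%N.
Proof.
move=> m0 hP lt; have := lowest_cubes hP lt; case: lt => W0 _ _.
move/(congr1 absz); rewrite (abszM m) abszX absz_nat (abszM (U + V)) => e.
have [hU hV] := qform_bound U V.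
have hs : (`|m| * W ^ 3 <= 4 * `|qform U V| ^ 2)%N.
  rewrite e -mulnn mulnA leq_mul //; move: hU hV; clear.
  by move: (`|qform U V|)%N => q; lia.
split; apply: leq_trans hs; first by rewrite leq_pmulr // expn_gt0 W0.
apply: (@leq_trans (W ^ 3)); last by rewrite leq_pmull // absz_gt0.
by rewrite -[X in (X <= _)%N]expn1 leq_pexp2l.
Qed.

(** The multiples of a nontorsion point are distinct, so only finitely many lie in
    a given finite set. *)
Lemma qform_mul_point_unbounded (m : int) R (X : nat) : m != 0 -> on_curve m R ->
    nontorsion R ->
  exists n0, forall n U V W, (n0 < n)%N -> lowest_terms (mul_point n R) U V W ->
    (X <= `|qform U V|)%N.
Proof.
move=> m0 hR nt; pose N := (4 * X ^ 2 + 2 * X)%N.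
pose Q0 U V W n0 := forall n, lowest_terms (mul_point n R) U V W -> (n <= n0)%N.
have [n0 hn0] : exists n0, forall U, (`|U| <= N)%N -> forall V, (`|V| <= N)%N ->
    forall w : int, (`|w| <= N)%N -> Q0 U V `|w|%N n0.
  apply: bounded_choice => [U n n' h le V hV w hw k /(h V hV w hw)|U hU]; first by lia.
  apply: bounded_choice => [V n n' h le w hw k /(h w hw)|V hV]; first by lia.
  apply: bounded_choice => [w n n' h le k /h|w hw]; first by lia.
  have [[n lt]|h] := EM (exists n, lowest_terms (mul_point n R) U V `|w|%N).
    exists n => n' lt'; rewrite (_ : n' = n) //.
    by apply: (mul_point_inj m0 hR nt); case: lt lt' => _ _ -> [_ _ ->].
  by exists 0%N => n lt; case: h; exists n.
exists n0 => n U V W ltn lt; rewrite leqNgt; apply/negP => ltX.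
have hP := mul_point_on_curve n hR.
have [hU hV] := qform_bound U V; have [_ hW] := lowest_coords_bound m0 hP lt.
have hX : (4 * `|qform U V| ^ 2 <= 4 * X ^ 2)%N by rewrite leq_mul // leq_exp2r // ltnW.
suff : (n <= n0)%N by rewrite leqNgt ltn.
apply: (hn0 U _ V _ W%:Z) => //; rewrite ?absz_nat /N; move: hU hV hW hX ltX; clear;
  by move: (`|qform U V| ^ 2)%N (X ^ 2)%N (`|qform U V|)%N => a b c; lia.
Qed.

(** The growth of the coordinates of n R beyond any power of m, uniformly. If the
    height of R is large, it exceeds a power of m and dominates the constant in
    the parallelogram law; the remaining pairs (m, R) are finite in number. *)
Lemma uniform_growth (c k : nat) : exists n0, forall (m : int) R n U V W,
    m != 0 -> cube_free m -> on_curve m R -> nontorsion R -> (n0 < n)%N ->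
    lowest_terms (mul_point n R) U V W ->
  (c * `|m| ^ k <= `|qform U V|)%N.
Proof.
have [C hC] := height_mul_point_large.
pose B := (C + c + 36)%N.
have [n1 hn1] : exists n1, forall m, (`|m| <= 36 * B ^ 2)%N ->
    forall U, (`|U| <= 36 * B ^ 2)%N -> forall V, (`|V| <= 36 * B ^ 2)%N ->
    forall w : int, (`|w| <= 36 * B ^ 2)%N ->
    forall R, m != 0 -> on_curve m R -> nontorsion R -> lowest_terms R U V `|w|%N ->
    forall n U' V' W', (n1 < n)%N -> lowest_terms (mul_point n R) U' V' W' ->
    (c * `|m| ^ k <= `|qform U' V'|)%N.
  apply: bounded_choice => [m n n' h le U hU V hV w hw R m0 hR nt lt p U' V' W' ltp|m hm].
    by apply: (h U hU V hV w hw R) => //; lia.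
  apply: bounded_choice => [U n n' h le V hV w hw R m0 hR nt lt p U' V' W' ltp|U hU].
    by apply: (h V hV w hw R) => //; lia.
  apply: bounded_choice => [V n n' h le w hw R m0 hR nt lt p U' V' W' ltp|V hV].
    by apply: (h w hw R) => //; lia.
  apply: bounded_choice => [w n n' h le R m0 hR nt lt p U' V' W' ltp|w hw].
    by apply: (h R) => //; lia.
  have [[R [m0 hR nt lt]]|h] := EM (exists R, [/\ m != 0, on_curve m R, nontorsion R & lowest_terms R U V `|w|%N]).
    have [n0 hn0] := qform_mul_point_unbounded (c * `|m| ^ k) m0 hR nt.
    exists n0 => R' _ _ _ lt'; have -> : R' = R by case: lt lt' => _ _ -> [_ _ ->].
    by move=> n U' V' W'; apply: hn0.
  by exists 0%N => R m0 hR nt lt; case: h; exists R.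
exists (n1 + (3 * k + 2))%N => m R n U V W m0 cfm hR nt ltn lt.
have hn := mul_point_on_curve n hR.
have [U1 [V1 [W1 lt1]]] : exists U1 V1 W1, lowest_terms R U1 V1 W1.
  case: R hR nt {lt hn} => [|u v] hR nt; first by case: (nt 1%N).
  exact: lowest_terms_exists.
have [hq1 hq1'] := height_qform m0 cfm hR lt1.
have [_ hq] := height_qform m0 cfm hn lt.
have [hU hV] := qform_bound U1 V1; have [hm hW] := lowest_coords_bound m0 hR lt1.
have [hB|hB] := leqP B (height m R); last first.
  have hq1B : (`|qform U1 V1| <= 3 * B)%N by lia.
  have hB2 : (4 * `|qform U1 V1| ^ 2 <= 36 * B ^ 2)%N.
    by rewrite -[36%N]/(4 * 3 ^ 2)%N -mulnA -expnMn leq_mul // leq_exp2r.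
  have hB3 : (2 * `|qform U1 V1| <= 36 * B ^ 2)%N.
    apply: leq_trans hB2; case: (`|_|)%N => // q; rewrite -mulnn; nia.
  apply: (hn1 m _ U1 _ V1 _ W1%:Z _ R _ _ _ _ n U V W) => //; by lia.
have ha : (height m R ^ n <= 4 * `|qform U V|)%N.
  by apply: leq_trans hq; apply: hC => //; apply: leq_trans hB; rewrite /B -addnA leq_addr.
move: (height m R) hB hq1 ha => a hB hq1 ha.
have [ca a4 a36] : [/\ c <= a, 4 <= a & 36 <= a]%N by split; rewrite /B in hB; lia.
have ma : (`|m| <= a ^ 3)%N.
  apply: (leq_trans hm); apply: (@leq_trans (4 * (3 * a) ^ 2)).
    by rewrite leq_mul // leq_exp2r.
  by rewrite expnMn mulnA (expnS a 2) leq_mul.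
rewrite -(@leq_pmul2l 4) //; apply: leq_trans ha.
apply: (@leq_trans (a * (a * (a ^ 3) ^ k))).
  by do 2!apply: leq_mul => //; case: (k) => // k'; rewrite leq_exp2r.
by rewrite -expnM -!expnS leq_pexp2l //; lia.
Qed.

(** * Prime power denominators, and the ABC bound *)

(** In m W^3 = (U + V) (U^2 - U V + V^2) the two factors have no common prime but
    3, so the cube of a prime power must divide one of them, up to a factor 3.
    The other one then divides 3 m. *)
Lemma prime_power_denom (m : int) P U V W : m != 0 -> cube_free m ->
    on_curve m P -> lowest_terms P U V W -> prime_power W ->
  (`|qform U V| <= 3 * `|m|)%N \/
  exists k : int, m = k * (U + V) /\ qform U V = k * W%:Z ^+ 3.
Proof.
move=> m0 cfm hP lt [p [e [pr_p e0 eW]]].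
have cop := lowest_coprime m0 cfm hP lt; have eq := lowest_cubes hP lt.
have s0 := lowest_sum_neq0 m0 hP lt; have q0 := lowest_qform_gt0 m0 hP lt.
have W0 : W%:Z ^+ 3 != 0 by case: lt => W0 _ _; rewrite expf_neq0 // eqz_nat -lt0n.
have copW x : ~~ (p %| x)%Z -> coprimez (W%:Z ^+ 3) x.
  move=> px; rewrite coprimezXl // coprimezE absz_nat eW coprimeXl //.
  by rewrite prime_coprime // -dvdzE.
have le_dvd (x y : int) : y != 0 -> (x %| y)%Z -> (`|x| <= `|y|)%N.
  by move=> y0; rewrite dvdzE => /dvdn_leq; apply; rewrite absz_gt0.
have [ps|ps] := boolP (p %| U + V)%Z; last first.
  right; have /dvdzP[k ek] : (W%:Z ^+ 3 %| qform U V)%Z.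
    by rewrite -(Gauss_dvdzr _ (copW _ ps)) -eq dvdz_mull.
  exists k; split=> //; apply: (mulIf W0).
  by rewrite eq ek; ring.
left; have [pq|pq] := boolP (p %| qform U V)%Z; last first.
  have /dvdzP[z ez] : (W%:Z ^+ 3 %| U + V)%Z.
    by rewrite -(Gauss_dvdzl _ (copW _ pq)) -eq dvdz_mull.
  apply: (@leq_trans `|m|); last by rewrite leq_pmull.
  apply: le_dvd => //; apply/dvdzP; exists z; apply: (mulIf W0).
  by rewrite eq ez; ring.
have p3 : p = 3%N.
  have : (p %| 3)%Z.
    by apply: gcd_sum_sqr_qform cop _ pq; rewrite expr2 dvdz_mull.
  by rewrite dvdzE -[ `|3|%N]/3%N dvdn_prime2 // => /eqP.
rewrite p3 in ps pq copW.
have /dvdzP[z ez] := ps; have /dvdzP[q' eq'] := pq.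
have q'3 : ~~ (3 %| q')%Z.
  apply/negP => /dvdzP[q'' e''].
  have h3 : (3 %| U * V)%Z.
    apply/dvdzP; exists (z ^+ 2 - q''); apply: (@mulfI _ 3) => //.
    transitivity ((U + V) ^+ 2 - qform U V); first by rewrite /qform; ring.
    by rewrite ez eq' e''; ring.
  have h3' : (3 %| U)%Z || (3 %| V)%Z by move: h3; rewrite !dvdzE abszM Euclid_dvdM.
  have [hU hV] : (3 %| U)%Z /\ (3 %| V)%Z.
    case/orP: h3' => h; split=> //.
      by have -> : V = (U + V) - U; [ring | rewrite rpredB].
    by have -> : U = (U + V) - V; [ring | rewrite rpredB].
  have : (3 %| gcdn `|U| `|V|)%N.
    by rewrite dvdn_gcd; apply/andP; split; [exact: hU | exact: hV].
  by move: cop; rewrite coprimezE => /eqP ->.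
have /dvdzP[y ey] : (W%:Z ^+ 3 %| 3 * (U + V))%Z.
  rewrite -(Gauss_dvdzl _ (copW _ q'3)); apply/dvdzP; exists m.
  by rewrite eq eq'; ring.
have -> : (3 * `|m|)%N = `|(3 * m)%R|%N by rewrite abszM.
apply: le_dvd; first by rewrite mulf_neq0.
apply/dvdzP; exists y; apply: (mulIf W0).
transitivity (3 * (U + V) * qform U V); first by rewrite -!mulrA -eq.
by rewrite ey; ring.
Qed.

Lemma radical_leq (n N : nat) : (0 < N)%N ->
  (forall p, prime p -> (p %| n)%N -> (p %| N)%N) -> (radical n <= N)%N.
Proof.
move=> N0 h; rewrite dvdn_leq // /radical.
have : {in primes n, forall p, prime p && (p %| N)%N}.
  by move=> p; rewrite mem_primes => /and3P[pr_p _ pn]; rewrite pr_p h.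
elim: (primes n) (primes_uniq n) => [|p s IHs] /=; first by rewrite big_nil dvd1n.
move=> /andP[ps us] hs; rewrite big_cons Gauss_dvd.
  have /andP[_ ->] := hs p (mem_head _ _); apply: IHs => // q qs.
  by apply: hs; rewrite inE qs orbT.
have /andP[pr_p _] := hs p (mem_head _ _).
rewrite big_seq; apply: (big_ind (fun x => coprime p x)) => [|x y hx hy|q qs].
- by rewrite coprimen1.
- by rewrite coprimeMr hx.
have /andP[pr_q _] : prime q && (q %| N)%N by apply: hs; rewrite inE qs orbT.
rewrite prime_coprime // dvdn_prime2 //; apply: contraNneq ps => ->.
exact: qs.
Qed.

(** The gcd of the squares of U + V and U - V divides 4. *)
Lemma gcd_abc_terms (U V : int) : coprimez U V ->
  (gcdn `|((U + V) ^+ 2)%R| `|(3 * (U - V) ^+ 2)%R| <= 12)%N.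
Proof.
move=> cop; set d := gcdn `|(U + V)%R| `|(U - V)%R|.
have dU : (d %| U + V)%Z by rewrite dvdzE dvdn_gcdl.
have dV : (d %| U - V)%Z by rewrite dvdzE dvdn_gcdr.
have d2 : (d %| 2)%N.
  have h1 : (d %| 2 * U)%Z by have -> : 2 * U = (U + V) + (U - V); [ring | rewrite rpredD].
  have h2 : (d %| 2 * V)%Z by have -> : 2 * V = (U + V) - (U - V); [ring | rewrite rpredB].
  move: h1 h2; rewrite !dvdzE !(abszM 2) absz_nat => h1 h2.
  have : (d %| gcdn (2 * `|U|) (2 * `|V|))%N by rewrite dvdn_gcd; apply/andP.
  by rewrite -muln_gcdr; move: cop; rewrite coprimezE => /eqP ->.
rewrite (abszM 3) !abszX; apply: dvdn_leq => //.
apply: (@dvdn_trans (3 * d ^ 2)); last first.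
  by rewrite -[12%N]/(3 * 2 ^ 2)%N dvdn_pmul2l // dvdn_exp2r.
by rewrite /d -gcdn_expn muln_gcdr dvdn_gcd dvdn_gcdr andbT dvdn_mull // dvdn_gcdl.
Qed.

(** The abc conjecture for s^2 + 3 (U - V)^2 = 4 q: if s divides m and q is a
    divisor of m times a cube, the radical is about m^2 q^(5/6) at most. *)
Lemma ABC_qform_bound (F : realType) : ABC F -> exists c : nat,
  forall (m U V k : int) (W : nat), m != 0 -> (0 < W)%N -> coprimez U V ->
    m = k * (U + V) -> qform U V = k * W%:Z ^+ 3 ->
  (`|qform U V| <= c * `|m| ^ 24)%N.
Proof.
(* The choice 1/11 makes the exponent 5/6 (1 + 1/11) = 10/11 of q less than 1. *)
move=> abc; have [|kappa kappa0 hk] := abc (11%:R^-1); first by rewrite invr_gt0.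
pose K := Num.bound (3 * kappa).
have hK : 3 * kappa <= K%:R by apply: ltW; apply: archi_boundP; rewrite mulr_ge0 // ltW.
have [A hA] : exists A, (6 ^ 6 * 8 <= A)%N by eexists; exact: leqnn.
exists (K ^ 11 * A ^ 2).+1 => m U V k W m0 W0 cop em eq.
have [eUV|neUV] := eqVneq U V.
  have : `|U|%N = 1%N by move: cop; rewrite -eUV coprimezE /coprime gcdnn => /eqP.
  have -> : qform U V = U ^+ 2 by rewrite /qform eUV; ring.
  by rewrite abszX => ->; rewrite exp1n muln_gt0 expn_gt0 absz_gt0 m0.
have [k0 s0] : k != 0 /\ U + V != 0.
  by apply/andP; rewrite -negb_or -mulf_eq0 -em.
have t0 : U - V != 0 by rewrite subr_eq0.
have := gcd_abc_terms cop; set g := gcdn _ _ => g12.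
have g0 : (0 < g)%N by rewrite gcdn_gt0 absz_gt0 expf_neq0.
have /dvdzP[x ex] : (g %| (U + V) ^+ 2)%Z by rewrite dvdzE dvdn_gcdl.
have /dvdzP[y ey] : (g %| 3 * (U - V) ^+ 2)%Z by rewrite dvdzE dvdn_gcdr.
have ez : 4 * qform U V = (x + y) * g by rewrite four_qform ex ey; ring.
have q0 : qform U V != 0 by rewrite eq mulf_neq0 // expf_neq0 // eqz_nat -lt0n.
have x0 : x != 0.
  by apply: contraNneq (expf_neq0 2 s0) => x0; rewrite ex x0 mul0r.
have y0 : y != 0.
  apply: contraNneq (_ : 3 * (U - V) ^+ 2 != 0) => [y0|]; first by rewrite ey y0 mul0r.
  by rewrite mulf_neq0 // expf_neq0.
have z0 : x + y != 0.
  apply: contraNneq (_ : 4 * qform U V != 0) => [z0|]; first by rewrite ez z0 mul0r.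
  by rewrite mulf_neq0.
have cxy : gcdn `|x| `|y| = 1%N.
  apply/eqP; rewrite -(eqn_pmul2r g0) mul1n muln_gcdl.
  have -> : (`|x| * g = `|((U + V) ^+ 2)%R|)%N by rewrite ex abszM.
  suff -> : (`|y| * g = `|(3 * (U - V) ^+ 2)%R|)%N by [].
  by rewrite ey abszM.
have := hk x y (x + y) x0 y0 z0 _ erefl; rewrite cxy gcd1n => /(_ erefl).
pose N := (6 * `|(U + V)%R| * `|(U - V)%R| * `|m| * W)%N.
set r := radical _ => habc.
have N0 : (0 < N)%N by rewrite /N !muln_gt0 !absz_gt0 s0 t0 m0.
have rN : (r <= N)%N.
  apply: radical_leq => // p pr_p; rewrite !abszM !Euclid_dvdM //.
  have dvd_g (a b : int) : a = b * g -> (p %| `|b|)%N -> (p %| `|a|)%N.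
    by move=> ->; rewrite abszM; apply: dvdn_mulr.
  case/orP => [/orP[]|] h.
  - have := dvd_g _ _ ex h; rewrite abszX Euclid_dvdX // => /andP[h' _].
    by rewrite h' !orbT.
  - have := dvd_g _ _ ey h; rewrite (abszM 3) abszX Euclid_dvdM // Euclid_dvdX // andbT.
    case/orP => h'; last by rewrite h' !orbT.
    have -> : (p %| 6)%N by apply: (@dvdn_trans 3).
    by [].
  have := dvd_g _ _ ez h; rewrite eq (abszM 4) (abszM k) abszX absz_nat Euclid_dvdM // Euclid_dvdM //.
  rewrite Euclid_dvdX // andbT => /or3P[] h'.
  - have /andP[h2 _] : (p %| 2)%N && (0 < 2)%N by rewrite -Euclid_dvdX.
    have -> : (p %| 6)%N by apply: (@dvdn_trans 2).
    by [].
  - by have -> : (p %| `|m|)%N; rewrite ?orbT // em abszM dvdn_mulr.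
  - by rewrite h' !orbT.
have hq : (`|qform U V| <= 3 * `|(x + y)%R|)%N.
  have : (4 * `|qform U V| <= 12 * `|(x + y)%R|)%N.
    by rewrite -[X in (X * _ <= _)%N]/(`|4|%N) -abszM ez abszM absz_nat mulnC leq_mul.
  by clear; lia.
have hs : (`|(U + V)%R| <= `|m|)%N by rewrite em abszM leq_pmull // absz_gt0.
have ht : (`|(U - V)%R| ^ 2 <= 2 * `|qform U V|)%N.
  rewrite -abszX; have := four_qform U V; have := sqr_ge0 (U - V); have := sqr_ge0 (U + V).
  by move: ((U + V) ^+ 2) ((U - V) ^+ 2) (qform U V) => a b c; clear; lia.
have hW : (W ^ 3 <= `|qform U V|)%N.
  by rewrite eq abszM abszX absz_nat leq_pmull // absz_gt0.
have q1 : (0 < `|qform U V|)%N by rewrite absz_gt0.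
move: (`|qform U V|)%N q1 hq ht hW => q q1 hq ht hW.
(* The sixth power clears the exponents 1/2 of U - V and 1/3 of W. *)
have hN6 : (N ^ 6 <= A * (`|m| ^ 12 * q ^ 5))%N.
  apply: (@leq_trans (6 ^ 6 * 8 * (`|m| ^ 12 * q ^ 5))); last by rewrite leq_mul2r hA orbT.
  rewrite /N; move: (`|(U - V)%R|)%N (`|(U + V)%R|)%N (`|m|)%N hs ht => t s' m' hs ht.
  have -> : ((6 * s' * t * m' * W) ^ 6 = 6 ^ 6 * (s' ^ 6 * (t ^ 2) ^ 3 * m' ^ 6 * (W ^ 3) ^ 2))%N.
    by rewrite -!expnM !expnMn -!mulnA.
  have -> : (6 ^ 6 * 8 * (m' ^ 12 * q ^ 5) = 6 ^ 6 * (m' ^ 6 * (2 * q) ^ 3 * m' ^ 6 * q ^ 2))%N.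
    by rewrite expnMn -[12%N]/(6 + 6)%N -[5%N]/(3 + 2)%N !expnD; move: (m' ^ 6)%N (q ^ 3)%N (q ^ 2)%N (6 ^ 6)%N => a b c d; ring.
  rewrite leq_mul2l; apply/orP; right.
  apply: leq_mul; last by rewrite leq_exp2r.
  by apply: leq_mul => //; apply: leq_mul; rewrite leq_exp2r.
have hF : (q ^ 11 <= K ^ 11 * N ^ 12)%N.
  have h1 : q%:R <= K%:R * N%:R `^ (1 + 11%:R^-1) :> F.
    apply: (@le_trans _ _ (3 * (kappa * r%:R `^ (1 + 11%:R^-1)))).
      apply: le_trans (_ : 3 * (`|(x + y)%R|)%:R <= _).
        by rewrite -natrM ler_nat.
      rewrite ler_pM2l //; apply: le_trans habc.
      by rewrite ler_nat leq_maxr.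
    rewrite mulrA ler_pM ?powR_ge0 // ?mulr_ge0 ?(ltW kappa0) //.
    by rewrite ge0_ler_powR ?nnegrE ?ler0n ?ler_nat // addr_ge0 ?invr_ge0.
  rewrite -(@ler_nat F) natrM !natrX.
  have -> : N%:R ^+ 12 = (N%:R `^ (1 + 11%:R^-1)) ^+ 11 :> F.
    rewrite -!powR_mulrn ?powR_ge0 ?ler0n // -powRrM; congr (_ `^ _).
    by field.
  by rewrite -exprMn lerXn2r // nnegrE ?mulr_ge0 ?powR_ge0.
have hN12 : (N ^ 12 <= A ^ 2 * (`|m| ^ 24 * q ^ 10))%N.
  rewrite -[12%N]/(6 * 2)%N -[24%N]/(12 * 2)%N -[10%N]/(5 * 2)%N !expnM -!expnMn.
  by rewrite leq_exp2r // -[(12 * 2)%N]/24.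
have : (q * q ^ 10 <= K ^ 11 * A ^ 2 * `|m| ^ 24 * q ^ 10)%N.
  rewrite -expnS; apply: (leq_trans hF); rewrite -2!(mulnA (K ^ 11)%N) leq_mul //.
  by rewrite -mulnA.
rewrite leq_pmul2r ?expn_gt0 ?q1 // => h; apply: leq_trans h _.
by rewrite leq_mul.
Qed.

(** * Padé approximants of the cube root *)

(** For 3 k <= p + 3 this is 9^k times the binomial coefficient of p / 3 over k. *)
Definition binom3 (p k : nat) : nat := (3 ^ k * \prod_(j < k) (p - 3 * j)) %/ k`!.

Lemma logn3_fact_leq n : (logn 3 n`! <= n)%N.
Proof.
rewrite logn_fact //.
suff h N : (\sum_(1 <= i < N.+1) n %/ 3 ^ i + n %/ 3 ^ N <= n)%N.
  by apply: leq_trans (h n); apply: leq_addr.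
elim: N => [|N IHN]; first by rewrite big_geq // expn0 divn1.
rewrite big_nat_recr //= -addnA; apply: leq_trans IHN; rewrite leq_add2l.
rewrite expnSr divnMA; move: (n %/ 3 ^ N)%N => x; lia.
Qed.

(** Modulo the prime-to-3 part of k!, dividing by 3 turns the product into a
    falling factorial; the powers of 3 are supplied by the factor 3^k. *)
Lemma fact_dvd_binom3 (p k : nat) : (k`! %| 3 ^ k * \prod_(j < k) (p - 3 * j))%N.
Proof.
have [hp|hp] := leqP (3 * k) (p + 3); last first.
  suff -> : (\prod_(j < k) (p - 3 * j) = 0)%N by rewrite muln0 dvdn0.
  have kk : (k.-1 < k)%N by lia.
  rewrite (bigD1 (Ordinal kk)) //= (_ : p - 3 * k.-1 = 0)%N ?mul0n //; lia.
have k0 := fact_gt0 k.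
set M := ((k`!)`_3^')%N; have M0 : (0 < M)%N by exact: part_gt0.
have cop : coprime (k`!)`_3%N M by exact: coprime_partC.
rewrite -{1}(partnC 3%N k0) Gauss_dvd //; apply/andP; split.
  by apply: dvdn_mulr; rewrite p_part dvdn_exp2l // logn3_fact_leq.
have {cop} cop : coprime 3 M by rewrite (@pnat_coprime 3%N) ?pnat_id // part_pnat.
have [e z ez _] := egcdnP M (isT : 0 < 3)%N; rewrite (eqP cop) in ez.
apply: dvdn_mull.
have ex : (\prod_(j < k) (p - 3 * j) = 3 ^ k * (p * e) ^_ k %[mod M])%N.
  rewrite ffact_prod -[k in (3 ^ k)%N]card_ord -prod_nat_const -big_split /=.
  apply: (big_ind2 (fun x y => x = y %[mod M])) => // [x1 x2 y1 y2 h1 h2|j _].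
    by rewrite -modnMm h1 h2 modnMm.
  have hj : (3 * j <= p)%N by have := ltn_ord j; lia.
  have -> : (3 * (p * e - j) = p - 3 * j + p * z * M)%N.
    by rewrite mulnBr (_ : 3 * (p * e) = p + p * z * M)%N; [lia|nia].
  by rewrite addnC modnMDl.
rewrite /dvdn ex -/(dvdn _ _) dvdn_mull // -bin_ffact dvdn_mull //.
exact: dvdn_part.
Qed.

Lemma binom3E p k : (binom3 p k * k`! = 3 ^ k * \prod_(j < k) (p - 3 * j))%N.
Proof. by rewrite /binom3 divnK // fact_dvd_binom3. Qed.

Lemma binom3_0 p : binom3 p 0 = 1%N.
Proof. by rewrite /binom3 big_ord0. Qed.

Lemma binom3S p k : (k.+1 * binom3 p k.+1 = 3 * (p - 3 * k) * binom3 p k)%N.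
Proof.
apply/eqP; rewrite -(eqn_pmul2r (fact_gt0 k)); apply/eqP.
transitivity (binom3 p k.+1 * (k.+1)`!)%N; first by rewrite factS; ring.
rewrite binom3E -(mulnA (3 * _)) binom3E big_ord_recr /= expnS.
by move: (3 ^ k)%N (\prod_(_ < k) _)%N => x y; ring.
Qed.

(** Replacing the first factor p by p + 3 and the number of factors k by k + 1
    leaves all other factors in place. *)
Lemma binom3_shift p k : (k.+1 * binom3 (p + 3) k.+1 = 3 * (p + 3) * binom3 p k)%N.
Proof.
apply/eqP; rewrite -(eqn_pmul2r (fact_gt0 k)); apply/eqP.
transitivity (binom3 (p + 3) k.+1 * (k.+1)`!)%N; first by rewrite factS; ring.
rewrite binom3E -(mulnA (3 * _)) binom3E big_ord_recl /= expnS muln0 subn0.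
rewrite (eq_bigr (fun i : 'I_k => p - 3 * i)%N); last first.
  by move=> i _; rewrite /bump /=; lia.
by move: (3 ^ k)%N (\prod_(_ < k) _)%N => x y; ring.
Qed.

Lemma binom3_gt0 p k : (3 * k < p + 3)%N -> (0 < binom3 p k)%N.
Proof.
move=> h; suff : (0 < binom3 p k * k`!)%N by rewrite muln_gt0 => /andP[].
rewrite binom3E muln_gt0 expn_gt0 /= prodn_gt0 // => i.
by have := ltn_ord i; lia.
Qed.

Lemma binom3_leq p k n : (p <= 3 * n)%N -> (binom3 p k <= 9 ^ k * 'C(n, k))%N.
Proof.
move=> h; rewrite -(leq_pmul2r (fact_gt0 k)) binom3E -mulnA bin_ffact ffact_prod.
rewrite -[9%N]/(3 * 3)%N expnMn -mulnA leq_mul //.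
rewrite -[X in (3 ^ X)%N](card_ord k) -prod_nat_const -big_split /=.
by apply: leq_prod => i _; lia.
Qed.

(** The coefficients of the Padé approximants of the cube root: up to the factor
    9^r they are the products of the binomial coefficients of r + 1/3 over k and of
    r - 1/3 over r - k. *)
Definition pade_coef (r k : nat) : nat :=
  (binom3 (3 * r + 1) k * binom3 (3 * r - 1) (r - k))%N.

Lemma pade_coefS r k : (k < r)%N ->
  (k.+1 * (3 * k + 2) * pade_coef r k.+1 =
   (r - k) * (3 * (r - k) + 1) * pade_coef r k)%N.
Proof.
move=> kr; rewrite /pade_coef (_ : r - k = (r - k.+1).+1)%N; last by lia.
have h1 := binom3S (3 * r + 1) k; have h2 := binom3S (3 * r - 1) (r - k.+1).
rewrite (_ : 3 * r - 1 - 3 * (r - k.+1) = 3 * k + 2)%N in h2; last by lia.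
rewrite (_ : 3 * r + 1 - 3 * k = 3 * (r - k.+1).+1 + 1)%N in h1; last by lia.
move: (r - k.+1)%N (binom3 (3 * r + 1)) (binom3 (3 * r - 1)) h1 h2 => j f g h1 h2.
apply/eqP; rewrite -(@eqn_pmul2l 3) //; apply/eqP.
transitivity (k.+1 * f k.+1 * (3 * (3 * k + 2) * g j))%N; first by ring.
by rewrite h1 -h2; ring.
Qed.

Lemma pade_coef_leq r k : (k <= r)%N -> (pade_coef r k <= 2 * 36 ^ r)%N.
Proof.
move=> kr; have bin_leq n j : ('C(n, j) <= 2 ^ n)%N.
  have := Pascal 1 1 n; rewrite addn1 => ->.
  have [jn|jn] := ltnP n j; first by rewrite bin_small.
  rewrite (bigD1 (Ordinal (jn : (j < n.+1)%N))) //= !exp1n !muln1; exact: leq_addr.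
apply: (@leq_trans (9 ^ k * 2 ^ r.+1 * (9 ^ (r - k) * 2 ^ r))).
  apply: leq_mul.
    apply: (@leq_trans (9 ^ k * 'C(r.+1, k))); first by apply: binom3_leq; lia.
    by rewrite leq_mul.
  apply: (@leq_trans (9 ^ (r - k) * 'C(r, r - k))); first by apply: binom3_leq; lia.
  by rewrite leq_mul.
rewrite mulnACA -expnD subnKC // -expnD -[36%N]/(9 * 2 * 2)%N !expnMn expnD expnS.
by move: (9 ^ r)%N (2 ^ r)%N => x y; apply: eq_leq; ring.
Qed.

(** Consecutive approximants are not proportional: their constant terms are not. *)
Lemma pade_coef_det r :
  (pade_coef r.+1 0 * pade_coef r r < pade_coef r 0 * pade_coef r.+1 r.+1)%N.
Proof.
rewrite /pade_coef !subnn !subn0 !binom3_0 !mul1n !muln1.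
have h1 := binom3_shift (3 * r + 1) r; have h2 := binom3_shift (3 * r - 1) r.
have [r0|r0] := posnP r.
  subst r; rewrite !binom3_0 /= muln1 mul1n; move: h1; rewrite binom3_0 muln1 mul1n => ->.
  by have := binom3S 2 0; rewrite mul1n => ->; rewrite binom3_0.
rewrite (_ : 3 * r - 1 + 3 = 3 * r.+1 - 1)%N in h2; last by lia.
rewrite (_ : 3 * r + 1 + 3 = 3 * r.+1 + 1)%N in h1; last by lia.
have p1 : (0 < binom3 (3 * r + 1) r)%N by rewrite binom3_gt0 //; lia.
have p2 : (0 < binom3 (3 * r - 1) r)%N by rewrite binom3_gt0 //; lia.
have p12 : (0 < binom3 (3 * r + 1) r * binom3 (3 * r - 1) r)%N by rewrite muln_gt0 p1.
rewrite -(@ltn_pmul2l r.+1) // mulnA h2 (mulnCA r.+1) h1.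
rewrite (_ : 3 * r.+1 + 1 = 3 * r.+1 - 1 + 2)%N; last by lia.
move: (binom3 _ r) (binom3 _ r) (3 * r.+1 - 1)%N p12 {h1 h2 p1 p2} => x y z p12.
rewrite (_ : 3 * z * x * y = x * y * (3 * z))%N; last by ring.
rewrite (_ : x * (3 * (z + 2) * y) = x * y * (3 * (z + 2)))%N; last by ring.
by rewrite ltn_pmul2l 1?mulnC //; lia.
Qed.

(** For t near 1, t is close to padeA r (t^3) / padeB r (t^3). *)
Definition padeA (R : numFieldType) (r : nat) : {poly R} :=
  \poly_(k < r.+1) (pade_coef r k)%:R.
Definition padeB (R : numFieldType) (r : nat) : {poly R} :=
  \poly_(k < r.+1) (pade_coef r (r - k))%:R.
Definition padeF (R : numFieldType) (r : nat) : {poly R} :=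
  (padeA R r \Po 'X^3) - 'X * (padeB R r \Po 'X^3).

Lemma coef_XD (R : nzRingType) (p : {poly R}) k : ('X * p^`())`_k = p`_k *+ k.
Proof. by rewrite coefXM; case: k => //= k; rewrite coef_deriv. Qed.

Lemma coef_XDD (R : nzRingType) (p : {poly R}) k :
  ('X * p^`()^`())`_k = p`_k.+1 *+ (k.+1 * k).
Proof. by rewrite coef_XD coef_deriv -mulrnA. Qed.

Lemma coef_X2DD (R : nzRingType) (p : {poly R}) k :
  ('X^2 * p^`()^`())`_k = p`_k *+ (k * (k - 1)).
Proof.
by rewrite expr2 -mulrA coefXM; case: k => //= k; rewrite coef_XDD subn1.
Qed.

(** The hypergeometric equations of the two polynomials. *)
Lemma padeA_ode (R : numFieldType) r : let p := padeA R r in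
  (1 - 'X) * (2%:R * p^`() + 3%:R * ('X * p^`()^`())) + 6 * r%:R * ('X * p^`())
   - (r%:R * (3 * r%:R + 1)) * p = 0.
Proof.
move=> p.
have -> : (1 - 'X) * (2%:R * p^`() + 3%:R * ('X * p^`()^`())) + 6 * r%:R * ('X * p^`())
   - (r%:R * (3 * r%:R + 1)) * p =
  p^`() *+ 2 + ('X * p^`()^`()) *+ 3 - ('X * p^`()) *+ 2 - ('X^2 * p^`()^`()) *+ 3
   + ('X * p^`()) *+ (6 * r) - p *+ (r * (3 * r + 1)).
  move: p (p^`()) (p^`()^`()) => p p' p''; ring.
apply/polyP => k.
rewrite !(coefB, coefD, coefMn) coef_XDD coef_X2DD !coef_XD coef_deriv coef0.
have rec : p`_k.+1 * (k.+1%:R * (3 * k%:R + 2)) =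
    p`_k * ((r%:R - k%:R) * (3 * (r%:R - k%:R) + 1)).
  rewrite !coef_poly !ltnS; have [kr|kr|->] := ltngtP k r; rewrite ?mul0r //.
  - have := congr1 (fun n => n%:R : R) (pade_coefS kr).
    by rewrite !(natrM, natrD) natrB ?(ltnW kr) // => e; rewrite mulrC e mulrC.
  by rewrite subrr !mul0r mulr0.
have -> : p`_k *+ (k * (k - 1)) = p`_k * (k%:R * (k%:R - 1)).
  rewrite -[LHS]mulr_natr; congr (_ * _).
  by case: k {rec} => [|k]; rewrite ?mul0r // natrM subn1 -(natr1 k) addrK.
rewrite -(natr1 k) in rec; transitivity (p`_k.+1 * ((k%:R + 1) * (3 * k%:R + 2)) -
    p`_k * ((r%:R - k%:R) * (3 * (r%:R - k%:R) + 1))); last by rewrite rec subrr.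
by move: p`_k p`_k.+1 => x y; ring.
Qed.

Lemma padeB_ode (R : numFieldType) r : let p := padeB R r in
  (1 - 'X) * (4%:R * p^`() + 3%:R * ('X * p^`()^`())) + 6 * r%:R * ('X * p^`())
   - (r%:R * (3 * r%:R - 1)) * p = 0.
Proof.
move=> p.
have -> : (1 - 'X) * (4%:R * p^`() + 3%:R * ('X * p^`()^`())) + 6 * r%:R * ('X * p^`())
   - (r%:R * (3 * r%:R - 1)) * p =
  p^`() *+ 4 + ('X * p^`()^`()) *+ 3 - ('X * p^`()) *+ 4 - ('X^2 * p^`()^`()) *+ 3
   + ('X * p^`()) *+ (6 * r) - p *+ (3 * r * r) + p *+ r.
  move: p (p^`()) (p^`()^`()) => p p' p''; ring.
apply/polyP => k.
rewrite !(coefB, coefD, coefMn) coef_XDD coef_X2DD !coef_XD coef_deriv coef0.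
have rec : p`_k.+1 * (k.+1%:R * (3 * k%:R + 4)) =
    p`_k * ((r%:R - k%:R) * (3 * (r%:R - k%:R) - 1)).
  rewrite !coef_poly !ltnS; have [kr|kr|->] := ltngtP k r; rewrite ?mul0r //.
  - have rk : (r - k.+1 < r)%N by lia.
    have := pade_coefS rk.
    rewrite (_ : (r - k.+1).+1 = r - k)%N; last by lia.
    rewrite (_ : r - (r - k.+1) = k.+1)%N; last by lia.
    rewrite (_ : 3 * (r - k.+1) + 2 = 3 * (r - k) - 1)%N; last by lia.
    move: (pade_coef r (r - k)) (pade_coef r (r - k.+1)) => x y /(congr1 (fun n => n%:R : R)).
    have -> : ((r - k) * (3 * (r - k) - 1) * x)%:R =
        (r%:R - k%:R) * (3 * (r%:R - k%:R) - 1) * x%:R :> R.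
      have e1 : (r - k)%:R = r%:R - k%:R :> R by rewrite natrB // ltnW.
      have e2 : (3 * (r - k) - 1)%:R = 3 * (r - k)%:R - 1 :> R.
        by rewrite natrB ?natrM //; move: kr; clear; lia.
      by rewrite !natrM e2 e1.
    by rewrite !(natrM, natrD) -(natr1 k) => e; rewrite [RHS]mulrC e; ring.
  by rewrite subrr !mul0r mulr0.
have -> : p`_k *+ (k * (k - 1)) = p`_k * (k%:R * (k%:R - 1)).
  rewrite -[LHS]mulr_natr; congr (_ * _).
  by case: k {rec} => [|k]; rewrite ?mul0r // natrM subn1 -(natr1 k) addrK.
rewrite -(natr1 k) in rec; transitivity (p`_k.+1 * ((k%:R + 1) * (3 * k%:R + 4)) -
    p`_k * ((r%:R - k%:R) * (3 * (r%:R - k%:R) - 1))); last by rewrite rec subrr.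
by move: p`_k p`_k.+1 => x y; ring.
Qed.

(** Substituting t^3 turns both equations into one for padeA r (t^3) and for
    t padeB r (t^3). Its exponents at t = 1 are 0 and 2 r + 1. *)
Lemma padeF_ode (R : numFieldType) r : let f := padeF R r in
  (1 - 'X^3) * f^`()^`() + 6 * r%:R * 'X^2 * f^`()
    - 3 * r%:R * (3 * r%:R + 1) * 'X * f = 0.
Proof.
move=> f.
pose comp3 (p : {poly R}) := p \Po 'X^3.
have dcomp p : (comp3 p)^`() = comp3 p^`() * ('X^2 *+ 3).
  by rewrite /comp3 deriv_comp derivXn.
have hA := congr1 comp3 (padeA_ode R r); have hB := congr1 comp3 (padeB_ode R r).
have cB p q : comp3 (p - q) = comp3 p - comp3 q by exact: comp_polyB.
have cD p q : comp3 (p + q) = comp3 p + comp3 q by exact: comp_polyD.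
have cM p q : comp3 (p * q) = comp3 p * comp3 q by exact: comp_polyM.
have cn n : comp3 n%:R = n%:R by rewrite /comp3 rmorph_nat.
have cX : comp3 'X = 'X^3 by exact: comp_polyX.
have c1 : comp3 1 = 1 by exact: (cn 1%N).
have c0 : comp3 0 = 0 by exact: (cn 0%N).
move: hA hB; rewrite !(cB, cD, cM, cX, c1, c0) !cn.
have -> : f = comp3 (padeA R r) - 'X * comp3 (padeB R r) by [].
have d2 p : (comp3 p)^`()^`() = comp3 p^`()^`() * ('X^2 *+ 3) ^+ 2 + comp3 p^`() * ('X *+ 6).
  by rewrite dcomp derivM dcomp derivMn derivXn /= -mulrnA -mulrA -expr2.
have dX p : ('X * p)^`() = p + 'X * p^`() :> {poly R} by rewrite derivM derivX mul1r.
rewrite !derivB !dX derivD dX !d2 !dcomp.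
move: (comp3 _) (comp3 _) (comp3 _) (comp3 _) (comp3 _) (comp3 _) => a2 a1 a0 b2 b1 b0 hA hB.
transitivity (3 * 'X *
   ((1 - 'X^3) * (2 * b0 + 3 * ('X^3 * b1)) + 6 * r%:R * ('X^3 * b0) -
    r%:R * (3 * r%:R + 1) * b2) - 3 * 'X^2 *
   ((1 - 'X^3) * (4 * a0 + 3 * ('X^3 * a1)) + 6 * r%:R * ('X^3 * a0) -
    r%:R * (3 * r%:R - 1) * a2)).
  by clear; move: 'X => X; ring.
by rewrite hA hB !mulr0 subrr.
Qed.

Lemma padeAB1 (R : numFieldType) r : (padeA R r).[1] = (padeB R r).[1].
Proof.
rewrite !horner_poly (reindex_inj rev_ord_inj) /=; apply: eq_bigr => i _.
by rewrite !expr1n subSS.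
Qed.

Lemma padeF_root1 (R : numFieldType) r : root (padeF R r) 1.
Proof.
rewrite /root /padeF hornerD hornerN hornerM hornerX !horner_comp !hornerXn.
by rewrite expr1n mul1r padeAB1 subrr.
Qed.

(** The differential equation forbids a zero at 1 of order strictly between 0 and
    2 r + 1. *)
Lemma padeF_vanish (R : numFieldType) r :
  exists C, padeF R r = ('X - 1%:P) ^+ (2 * r).+1 * C.
Proof.
suff h j : (j <= 2 * r)%N -> exists C, padeF R r = ('X - 1%:P) ^+ j.+1 * C.
  exact: h (2 * r)%N (leqnn _).
elim: j => [|j IHj] hj.
  by have /factor_theorem[C ->] := padeF_root1 R r; exists C; rewrite mulrC.
have [C eC] := IHj (ltnW hj).
suff /factor_theorem[C' eC'] : root C 1.
  by exists C'; rewrite eC eC' [in RHS]exprSr -[RHS]mulrA (mulrC _ C').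
have := padeF_ode R r; rewrite eC /=.
set Y := 'X - 1%:P; set P := Y ^+ j.
have dY : Y^`() = 1 by rewrite /Y derivB derivX derivC subr0.
have e1 : Y * P^`() = P *+ j.
  rewrite /P deriv_exp dY mul1r mulrnAr; case: (j) => [|j']; first by rewrite !mulr0n.
  by rewrite -exprS.
have e2 : Y * (Y * P^`()^`()) = P *+ j *+ j - P *+ j.
  have := congr1 (fun p => Y * p^`()) e1.
  by rewrite derivM dY mul1r derivMn mulrDr mulrnAr e1 => <-; rewrite addrC addKr.
have P0 : P != 0 by rewrite expf_neq0 // polyXsubC_eq0.
pose Q := 1 + 'X + 'X^2 : {poly R}.
pose E := - Q * (j%:R * ((j%:R + 1) * C + Y * C^`()) + Y * ((j%:R + 2) * C^`() + Y * C^`()^`()))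
   + 6 * r%:R * 'X^2 * ((j%:R + 1) * C + Y * C^`()) - 3 * r%:R * (3 * r%:R + 1) * 'X * (Y * C).
have hQ : 1 - 'X^3 = - Y * Q by rewrite /Y /Q; ring.
have Y1 : Y.[1] = 0 by rewrite /Y !hornerE subrr.
have eP : Y ^+ j.+1 = Y * P by rewrite exprS.
rewrite eP -/Y hQ; clearbody P Y => ode; have {ode} : P * E = 0.
  have D1 : (Y * P * C)^`() = P * C + (Y * P^`()) * C + Y * P * C^`().
    by rewrite !derivM dY mul1r; ring.
  have D2 : Y * (Y * P * C)^`()^`() = 2 * (Y * P^`()) * C + 2 * (Y * P) * C^`() +
      Y * (Y * P^`()^`()) * C + 2 * Y * (Y * P^`()) * C^`() + Y * Y * P * C^`()^`().
    by rewrite D1 !(derivD, derivM) dY; ring.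
  rewrite -[RHS]ode (_ : - Y * Q * _ = - (Q * (Y * (Y * P * C)^`()^`()))); last first.
    by move: (_^`()^`()) => z; ring.
  rewrite D2 D1 e2 e1 /E.
  by move: (C^`()) (C^`()^`()) (Q) => C' C'' Q'; ring.
move/eqP; rewrite mulf_eq0 (negbTE P0) /= => /eqP /(congr1 (fun p => p.[1])).
have hn n : (n%:R : {poly R}).[1] = n%:R by rewrite -polyC_natr hornerC.
rewrite /E /Q !(hn, hornerD, hornerN, hornerM, hornerX, hornerXn, hornerC) Y1.
rewrite !mul0r !addr0 !mulr0 !mulr1 subr0 => e.
have {}e : (j%:R + 1) * (2 * r%:R - j%:R) * C.[1] = 0.
  apply: (mulfI (_ : 3 != 0)); first by rewrite pnatr_eq0.
  by rewrite mulr0 -[RHS]e; ring.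
move/eqP: e; rewrite !mulf_eq0 natr1 pnatr_eq0 subr_eq0 -natrM eqr_nat /=.
by rewrite gtn_eqF.
Qed.

(** Dividing by t - 1 at most doubles this norm: the coefficients of the quotient
    are partial sums. *)
Lemma half_norm_div (R : numFieldType) (q : {poly R}) (N : nat) :
  \sum_(i < N) `|q`_i| / 2 ^+ i <= 2 * \sum_(i < N) `|(('X - 1%:P) * q)`_i| / 2 ^+ i.
Proof.
set p := ('X - 1%:P) * q.
have cp i : p`_i = (if i == 0%N then 0 else q`_i.-1) - q`_i.
  by rewrite /p mulrBl coefB coefXM mul1r.
suff h : \sum_(i < N) `|q`_i| / 2 ^+ i + (if N == 0%N then 0 else `|q`_N.-1| / 2 ^+ N.-1)
    <= 2 * \sum_(i < N) `|p`_i| / 2 ^+ i.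
  apply: le_trans h; rewrite lerDl; case: ifP => // _.
  by rewrite divr_ge0 ?exprn_ge0.
elim: N => [|N IHN]; first by rewrite !big_ord0 mulr0 addr0.
rewrite !big_ord_recr /= mulrDr -addrA.
set S := \sum_(i < N) _ in IHN *; set T := \sum_(i < N) _ in IHN *.
set z := (if N == 0%N then _ else _) in IHN.
have {}IHN : S <= 2 * T - z by rewrite lerBrDr.
apply: le_trans (lerD IHN (lexx _)) _; rewrite -addrA lerD2l addrC lerBlDr.
pose x := if N == 0%N then 0 else q`_N.-1.
have ez : z = 2 * (`|x| / 2 ^+ N).
  rewrite /z /x; case: (N) => [|n] /=; first by rewrite normr0 mul0r mulr0.
  by rewrite exprS invfM mulrCA mulVKf ?pnatr_eq0 // mulrC.
rewrite ez -mulr2n -[X in X <= _]mulr_natl -mulrDr ler_wpM2l // -mulrDl.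
rewrite ler_wpM2r ?invr_ge0 ?exprn_ge0 //.
have -> : q`_N = x - p`_N by rewrite cp subKr.
by rewrite [X in _ <= X]addrC ler_normB.
Qed.

Lemma half_norm_divX (R : numFieldType) (q : {poly R}) (n N : nat) :
  \sum_(i < N) `|q`_i| / 2 ^+ i <=
    2 ^+ n * \sum_(i < N) `|(('X - 1%:P) ^+ n * q)`_i| / 2 ^+ i.
Proof.
elim: n q => [|n IHn] q; first by rewrite expr0 !mul1r.
apply: le_trans (half_norm_div q N) _.
by rewrite (exprS 2) -mulrA ler_wpM2l // exprSr -mulrA IHn.
Qed.

Lemma size_padeA (R : numFieldType) r : (size (padeA R r) <= r.+1)%N.
Proof. exact: size_poly. Qed.

Lemma size_padeB (R : numFieldType) r : (size (padeB R r) <= r.+1)%N.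
Proof. exact: size_poly. Qed.

Lemma padeA_coef_leq (R : numFieldType) r k : `|(padeA R r)`_k| <= 2 * 36 ^+ r.
Proof.
rewrite coef_poly; case: ifP => h; last by rewrite normr0 mulr_ge0 ?exprn_ge0.
by rewrite normr_nat -natrX -natrM ler_nat pade_coef_leq.
Qed.

Lemma padeB_coef_leq (R : numFieldType) r k : `|(padeB R r)`_k| <= 2 * 36 ^+ r.
Proof.
rewrite coef_poly; case: ifP => h; last by rewrite normr0 mulr_ge0 ?exprn_ge0.
by rewrite normr_nat -natrX -natrM ler_nat pade_coef_leq // leq_subr.
Qed.

Lemma size_comp_Xn3 (R : numFieldType) (p : {poly R}) n :
  (size p <= n.+1)%N -> (size (p \Po 'X^3) <= 3 * n + 1)%N.
Proof.
move=> h; apply/leq_sizeP => j hj; rewrite coef_comp_poly_Xn //.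
case: ifP => // /dvdnP[i ei]; rewrite ei mulnK // nth_default // (leq_trans h) //.
by move: hj; rewrite ei; lia.
Qed.

Lemma geom_half_leq (R : numFieldType) n : \sum_(i < n) (2 ^+ i)^-1 <= 2 :> R.
Proof.
suff h : \sum_(i < n) (2 ^+ i)^-1 + 2 / 2 ^+ n = 2 :> R.
  by rewrite -[leRHS]h lerDl divr_ge0 ?exprn_ge0.
elim: n => [|n IHn]; first by rewrite big_ord0 add0r expr0 divr1.
rewrite big_ord_recr /= -[RHS]IHn -addrA; congr (_ + _).
have n0 : 2 ^+ n != 0 :> R by rewrite expf_neq0 // pnatr_eq0.
by rewrite exprS; field; rewrite n0.
Qed.

(** The order of vanishing makes padeF small near 1. *)
Lemma padeF_leq (R : numFieldType) r (t : R) : `|t| <= 1 ->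
  `|(padeF R r).[t]| <= 16 * 288 ^+ r * `|t - 1| ^+ (2 * r).+1.
Proof.
move=> t1; have [C eC] := padeF_vanish R r.
have sC : (size C <= r.+1)%N.
  have [->|C0] := eqVneq C 0; first by rewrite size_poly0.
  have sF : (size (padeF R r) <= 3 * r + 2)%N.
    rewrite (leq_trans (size_polyD _ _)) // geq_max size_polyN; apply/andP; split.
      by rewrite (leq_trans (size_comp_Xn3 (size_padeA R r))) //; lia.
    rewrite (leq_trans (size_polyMleq _ _)) // size_polyX.
    move: (size_comp_Xn3 (size_padeB R r)).
    by move: (size (padeB R r \Po 'X^3)) => n; clear; lia.
  move: sF; rewrite eC size_proper_mul; last first.
    by rewrite (eqP (monic_exp _ (monicXsubC _))) mul1r lead_coef_eq0.
  by rewrite size_exp_XsubC; move: (size C) => n; clear; lia.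
have cF i : `|(padeF R r)`_i| <= 4 * 36 ^+ r.
  rewrite coefB coefXM !coef_comp_poly_Xn //.
  have -> : 4 * 36 ^+ r = 2 * 36 ^+ r + 2 * 36 ^+ r :> R by rewrite -mulrDl -natrD.
  have hAB (b : bool) (x : R) : `|x| <= 2 * 36 ^+ r -> `|if b then x else 0| <= 2 * 36 ^+ r.
    by case: b => //; rewrite normr0 => _; rewrite mulr_ge0 ?exprn_ge0.
  apply: le_trans (ler_normB _ _) _; apply: lerD.
    exact/hAB/padeA_coef_leq.
  case: ifP => _; first by rewrite normr0 mulr_ge0 ?exprn_ge0.
  exact/hAB/padeB_coef_leq.
have sumC : \sum_(i < r.+1) `|C`_i| / 2 ^+ i <= 16 * 144 ^+ r.
  apply: le_trans (half_norm_divX C (2 * r).+1 r.+1) _; rewrite -eC.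
  apply: (@le_trans _ _ (2 ^+ (2 * r).+1 * (4 * 36 ^+ r * 2))).
    rewrite ler_wpM2l ?exprn_ge0 //.
    apply: (@le_trans _ _ (4 * 36 ^+ r * \sum_(i < r.+1) (2 ^+ i)^-1)); last first.
      by rewrite ler_wpM2l ?mulr_ge0 ?exprn_ge0 ?geom_half_leq.
    by rewrite mulr_sumr; apply: ler_sum => i _; rewrite ler_wpM2r ?invr_ge0 ?exprn_ge0.
  have -> : 144 ^+ r = 4 ^+ r * 36 ^+ r :> R by rewrite -exprMn -natrM.
  have -> : 2 ^+ (2 * r).+1 = 2 * 4 ^+ r :> R by rewrite exprS exprM -natrX.
  by move: (4 ^+ r) (36 ^+ r) => x y; rewrite le_eqVlt; apply/orP; left; apply/eqP; ring.
have Ct : `|C.[t]| <= 16 * 288 ^+ r.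
  rewrite (horner_coef_wide _ sC); apply: le_trans (ler_norm_sum _ _ _) _.
  apply: (@le_trans _ _ (2 ^+ r * \sum_(i < r.+1) `|C`_i| / 2 ^+ i)); last first.
    by rewrite -[288]/(2 * 144)%:R natrM exprMn mulrCA ler_wpM2l ?exprn_ge0.
  rewrite mulr_sumr; apply: ler_sum => i _; rewrite normrM normrX.
  apply: (@le_trans _ _ (`|C`_i| * 1)).
    by rewrite ler_wpM2l // exprn_ile1.
  rewrite mulrCA ler_wpM2l // ler_pdivlMr ?exprn_gt0 // mul1r.
  by rewrite ler_weXn2l ?ler1n // -ltnS.
by rewrite eC hornerM horner_exp hornerXsubC normrM normrX mulrC ler_wpM2r // exprn_ge0.
Qed.

(** The map t -> t^3 is unramified at t = 1, so orders of vanishing there agree. *)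
Lemma dvdp_XsubC_comp3 (R : numFieldType) n (p : {poly R}) :
  ('X - 1%:P) ^+ n %| (p \Po 'X^3) * 'X -> ('X - 1%:P) ^+ n %| p.
Proof.
elim: n p => [|n IHn] p; first by rewrite expr0 !dvd1p.
move=> h.
have /factor_theorem[q eq] : root p 1.
  have /rootP : root ((p \Po 'X^3) * 'X) 1.
    by rewrite -dvdp_XsubCl; apply: dvdp_trans h; rewrite exprS dvdp_mulr.
  by rewrite hornerM horner_comp hornerX hornerXn expr1n mulr1 => /rootP.
move: h; rewrite eq comp_polyM comp_polyB comp_polyX comp_polyC.
have -> : (q \Po 'X^3) * ('X^3 - 1%:P) * 'X =
   ('X - 1%:P) * ((q \Po 'X^3) * 'X * (1 + 'X + 'X^2)) :> {poly R}.
  by rewrite polyC1; move: (q \Po 'X^3) 'X => z X; ring.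
rewrite exprS dvdp_mul2l ?polyXsubC_eq0 // [q * _]mulrC dvdp_mul2l ?polyXsubC_eq0 //.
rewrite Gauss_dvdpl; first exact: IHn.
rewrite coprimep_expl // coprimep_sym coprimep_XsubC /root.
rewrite !hornerD !hornerX hornerXn hornerC expr1n.
by rewrite (_ : 1 + 1 + 1 = 3%:R) ?pnatr_eq0 //; ring.
Qed.

(** Consecutive approximants agree to order 2 r + 1 at 1, and their degrees leave
    no room for another common value. *)
Lemma pade_det_neq0 (R : numFieldType) r (w : R) : w != 1 ->
  (padeA R r).[w] * (padeB R r.+1).[w] - (padeA R r.+1).[w] * (padeB R r).[w] != 0.
Proof.
move=> w1; pose D := padeA R r * padeB R r.+1 - padeA R r.+1 * padeB R r.
have [C eC] := padeF_vanish R r; have [C' eC'] := padeF_vanish R r.+1.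
have /dvdpP[E eE] : ('X - 1%:P) ^+ (2 * r).+1 %| D.
  apply: dvdp_XsubC_comp3; rewrite comp_polyB !comp_polyM.
  set a := padeA R r \Po _; set b := padeB R r \Po _.
  set a' := padeA R r.+1 \Po _; set b' := padeB R r.+1 \Po _.
  have -> : (a * b' - a' * b) * 'X = a' * padeF R r - a * padeF R r.+1.
    by rewrite /padeF -/a -/b -/a' -/b'; move: a b a' b' 'X => z1 z2 z3 z4 X; ring.
  rewrite eC eC' (_ : (2 * r.+1).+1 = (2 * r).+1 + 2)%N; last by lia.
  by rewrite exprD -mulrA dvdp_sub // dvdp_mull // dvdp_mulr.
have D0 : D.[0] != 0.
  rewrite /D hornerD hornerN !hornerM !horner_coef0 !coef_poly /= !subn0 -!natrM.
  by rewrite subr_eq0 eqr_nat gtn_eqF // pade_coef_det.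
have sD : (size D <= 2 * r + 2)%N.
  have hA n := size_padeA R n; have hB n := size_padeB R n.
  rewrite (leq_trans (size_polyD _ _)) // size_polyN geq_max; apply/andP; split.
    rewrite (leq_trans (size_polyMleq _ _)) //; have := hA r; have := hB r.+1.
    by move: (size (padeA R r)) (size (padeB R r.+1)) => x y; clear; lia.
  rewrite (leq_trans (size_polyMleq _ _)) //; have := hA r.+1; have := hB r.
  by move: (size (padeA R r.+1)) (size (padeB R r)) => x y; clear; lia.
have E0 : E != 0 by apply: contraNneq D0 => E0; rewrite eE E0 mul0r horner0.
have sE : (size E <= 1)%N.
  move: sD; rewrite eE size_Mmonic ?monic_exp ?monicXsubC // size_exp_XsubC.
  by move: (size E) => n; clear; lia.
have := congr1 (fun p => p.[w]) eE.
rewrite /D hornerD hornerN !hornerM horner_exp hornerXsubC => ->.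
rewrite mulf_neq0 ?expf_neq0 ?subr_eq0 //.
by rewrite (size1_polyC sE) hornerC; apply: contraNneq E0 => e; rewrite (size1_polyC sE) e.
Qed.

Lemma horner_lipschitz (R : numFieldType) (p : {poly R}) (M : R) n (x y : R) :
    (size p <= n.+1)%N -> (forall i, `|p`_i| <= M) -> `|x| <= 1 -> `|y| <= 1 ->
  `|p.[x] - p.[y]| <= M * 4 ^+ n * `|x - y|.
Proof.
move=> sp hM x1 y1; have M0 : 0 <= M by apply: le_trans (hM 0%N).
rewrite !(horner_coef_wide _ sp) -sumrB; apply: le_trans (ler_norm_sum _ _ _) _.
apply: (@le_trans _ _ (\sum_(i < n.+1) M * n%:R * `|x - y|)).
  apply: ler_sum => i _; rewrite -mulrBr normrM -mulrA ler_pM //.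
  rewrite subrXX normrM mulrC ler_wpM2r //.
  apply: le_trans (ler_norm_sum _ _ _) _.
  apply: (@le_trans _ _ (\sum_(j < i) 1)).
    by apply: ler_sum => j _; rewrite normrM !normrX mulr_ile1 ?exprn_ge0 ?exprn_ile1.
  by rewrite sumr_const card_ord ler_nat -ltnS.
rewrite sumr_const card_ord -[leLHS]mulr_natr mulrAC ler_wpM2r // -mulrA ler_wpM2l //.
rewrite -natrM -natrX ler_nat -[4%N]/(2 * 2)%N expnMn.
by apply: leq_mul; [apply: ltnW; apply: ltn_expl | apply: ltn_expl].
Qed.

(** Combines the order of vanishing at t^3 with the distance from t^3 to w. *)
Lemma pade_approx (R : numFieldType) r (t w : R) : `|t| = 1 -> `|w| <= 1 ->
  `|(padeA R r).[w] - t * (padeB R r).[w]| <=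
     16 * 288 ^+ r * (`|t - 1| ^+ (2 * r).+1 + `|w - t ^+ 3|).
Proof.
move=> t1 w1; have t3 : `|t ^+ 3| <= 1 by rewrite normrX t1 expr1n.
have hA := horner_lipschitz (size_padeA R r) (padeA_coef_leq R r) w1 t3.
have hB := horner_lipschitz (size_padeB R r) (padeB_coef_leq R r) w1 t3.
have tle1 : `|t| <= 1 by rewrite t1.
have hF := padeF_leq r tle1.
have -> : (padeA R r).[w] - t * (padeB R r).[w] = (padeF R r).[t] +
   ((padeA R r).[w] - (padeA R r).[t ^+ 3] - t * ((padeB R r).[w] - (padeB R r).[t ^+ 3])).
  rewrite /padeF hornerD hornerN hornerM hornerX !horner_comp !hornerXn.
  by move: (horner (padeA R r)) (horner (padeB R r)) => a b; ring.
apply: le_trans (ler_normD _ _) _; rewrite [leRHS]mulrDr; apply: lerD => //.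
apply: le_trans (ler_normB _ _) _; rewrite normrM t1 mul1r.
apply: le_trans (lerD hA hB) _; rewrite -mulrDl ler_wpM2r //.
rewrite -mulrDl -mulrDl -natrD -mulrA -exprMn -natrM ler_pM ?exprn_ge0 //.
  by rewrite ler_nat.
by rewrite lerXn2r ?nnegrE ?ler_nat.
Qed.

(** * The descent map into Q(omega) *)

Definition omega : algC := (-1 + 'i * sqrtC 3) / 2.

Lemma omega_sqr : omega ^+ 2 = -1 - omega.
Proof.
have s3 : sqrtC 3 ^+ 2 = 3 :> algC by rewrite sqrtCK.
have i2 : 'i ^+ 2 = -1 :> algC by rewrite sqrCi.
have two : (2 : algC) != 0 by rewrite pnatr_eq0.
apply: (mulfI (_ : 4 != 0)); first by rewrite pnatr_eq0.
transitivity (1 - 2 * ('i * sqrtC 3) + 'i ^+ 2 * sqrtC 3 ^+ 2 : algC).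
  by rewrite /omega; field.
by rewrite s3 i2 /omega; field.
Qed.

Lemma omega_conj : omega^* = -1 - omega.
Proof.
have s3 : (sqrtC 3)^* = sqrtC 3 :> algC by apply: geC0_conj; rewrite sqrtC_ge0.
have two : (2 : algC) != 0 by rewrite pnatr_eq0.
rewrite /omega fmorph_div rmorphD rmorphN rmorphM /= rmorph1 conjCi s3 rmorph_nat.
by field.
Qed.

Lemma omega_cube : omega ^+ 3 = 1.
Proof. by rewrite exprS omega_sqr mulrBr mulrN1 -expr2 omega_sqr; ring. Qed.

Lemma conj_ratr (a : rat) : (ratr a)^* = ratr a :> algC.
Proof. exact: conj_Crat (Crat_rat a). Qed.

(** The field Q(omega). *)
Definition inK (x : algC) : Prop := exists a b : rat, x = ratr a + ratr b * omega.

Lemma inK_ratr (a : rat) : inK (ratr a).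
Proof. by exists a, 0; rewrite rmorph0 mul0r addr0. Qed.

Lemma inK_omega : inK omega.
Proof. by exists 0, 1; rewrite rmorph0 rmorph1 mul1r add0r. Qed.

Lemma inKD x y : inK x -> inK y -> inK (x + y).
Proof.
by move=> [a [b ->]] [c [d ->]]; exists (a + c), (b + d); rewrite !rmorphD /=; ring.
Qed.

Lemma inKN x : inK x -> inK (- x).
Proof. by move=> [a [b ->]]; exists (- a), (- b); rewrite !rmorphN /=; ring. Qed.

Lemma inKM x y : inK x -> inK y -> inK (x * y).
Proof.
move=> [a [b ->]] [c [d ->]]; exists (a * c - b * d), (a * d + b * c - b * d).
rewrite !(rmorphB, rmorphD, rmorphM) /=.
transitivity (ratr a * ratr c + (ratr a * ratr d + ratr b * ratr c) * omega +
  ratr b * ratr d * omega ^+ 2 : algC); first by ring.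
by rewrite omega_sqr; ring.
Qed.

Lemma conj_K (a b : rat) :
  (ratr a + ratr b * omega)^* = ratr a + ratr b * (-1 - omega) :> algC.
Proof. by rewrite rmorphD (rmorphM _ (ratr b)) /= !conj_ratr omega_conj. Qed.

Lemma inK_conj x : inK x -> inK x^*.
Proof.
move=> [a [b ->]]; rewrite conj_K.
by exists (a - b), (- b); rewrite rmorphB rmorphN /=; ring.
Qed.

Lemma inK_norm x : inK x -> x * x^* \in Crat.
Proof.
move=> [a [b ->]]; apply/CratP; exists (a ^+ 2 - a * b + b ^+ 2).
rewrite conj_K !(rmorphB, rmorphD, rmorphM, rmorphXn) /=.
transitivity (ratr a ^+ 2 - ratr a * ratr b  - ratr b ^+ 2 * omega - ratr b ^+ 2 * omega ^+ 2 : algC); first by ring.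
by rewrite omega_sqr; ring.
Qed.

Lemma inKV x : inK x -> inK x^-1.
Proof.
move=> hx; have [->|x0] := eqVneq x 0; first by rewrite invr0 -(rmorph0 (@ratr algC)); apply: inK_ratr.
have /CratP[n en] := inK_norm hx.
have -> : x^-1 = x^* * ratr n^-1 by rewrite (fmorphV (@ratr algC)) /= -en invfM mulrCA mulfV ?conjC_eq0 // mulr1.
exact: inKM (inK_conj hx) (inK_ratr _).
Qed.

Definition cubeK (x : algC) : Prop := exists2 z, inK z & z != 0 /\ x = z ^+ 3.

Lemma cubeK1 : cubeK 1.
Proof.
exists 1; last by rewrite oner_eq0 expr1n.
by rewrite -(rmorph1 (@ratr algC)); apply: inK_ratr.
Qed.

Lemma cubeKM x y : cubeK x -> cubeK y -> cubeK (x * y).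
Proof.
move=> [z hz [z0 ->]] [z' hz' [z'0 ->]]; exists (z * z'); first exact: inKM.
by rewrite mulf_neq0 // exprMn.
Qed.

Lemma cubeKV x : cubeK x -> cubeK x^-1.
Proof.
move=> [z hz [z0 ->]]; exists z^-1; first exact: inKV.
by rewrite invr_eq0 exprVn.
Qed.

(** The linear form vanishing at the point at infinity (1 : - omega^2 : 0), scaled so
    that its trace is u + v. Its norm is u^2 - u v + v^2. *)
Definition eta (u v : rat) : algC := (1 + omega) * ratr v - omega * ratr u.

Lemma eta_conj u v : (eta u v)^* = eta v u.
Proof.
rewrite /eta rmorphB (rmorphM _ (1 + omega)) (rmorphM _ omega) rmorphD rmorph1 /=.
by rewrite !conj_ratr omega_conj; ring.
Qed.

Lemma eta_trace u v : eta u v + (eta u v)^* = ratr (u + v).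
Proof. by rewrite eta_conj /eta rmorphD /=; ring. Qed.

Lemma eta_norm u v : eta u v * (eta u v)^* = ratr (u ^+ 2 - u * v + v ^+ 2).
Proof.
rewrite eta_conj /eta !(rmorphB, rmorphD, rmorphM, rmorphXn) /=.
transitivity (ratr u * ratr v * (1 + 2 * omega + 2 * omega ^+ 2) - (omega + omega ^+ 2) * (ratr u ^+ 2 + ratr v ^+ 2) : algC); first by ring.
by rewrite omega_sqr; ring.
Qed.

Lemma inK_eta u v : inK (eta u v).
Proof.
by exists v, (v - u); rewrite /eta rmorphB /=; ring.
Qed.

Lemma eta_linear u v t d1 d2 : eta (u + t * d1) (v + t * d2) = eta u v + ratr t * eta d1 d2.
Proof. by rewrite /eta !(rmorphD, rmorphM) /=; ring. Qed.

Lemma eta_neq0 u v : u + v != 0 -> eta u v != 0.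
Proof.
move=> s0; apply: contraNneq s0 => e; have := eta_trace u v.
by rewrite e rmorph0 addr0 => /esym/eqP; rewrite fmorph_eq0.
Qed.

(** Up to cubes of Q(omega), this is a homomorphism from the curve to the
    multiplicative group of Q(omega): its divisor is three times a difference of points
    of order 3. *)
Definition descent (P : rat_point) : algC :=
  if P is Affine u v then eta u v / (eta u v)^* else 1.

Lemma inK_descent P : inK (descent P).
Proof.
case: P => [|u v]; first by rewrite -[descent _](rmorph1 (@ratr algC)); apply: inK_ratr.
by apply: inKM (inK_eta u v) (inKV (inK_conj (inK_eta u v))).
Qed.

Lemma descent_neq0 (m : int) P : m != 0 -> on_curve m P -> descent P != 0.
Proof.
move=> m0; case: P => [|u v] hP; first exact: oner_neq0.
have s0 := sum_neq0_on_curve m0 hP.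
by rewrite mulf_neq0 ?invr_eq0 ?conjC_eq0 // eta_neq0.
Qed.

Lemma descent_reflect (m : int) P : m != 0 -> on_curve m P ->
  descent (reflect_point P) = (descent P)^-1.
Proof.
move=> m0; case: P => [|u v] hP; first by rewrite /= invr1.
by rewrite /= eta_conj eta_conj -invf_div.
Qed.

(** The cubic polynomial that describes the curve along a line, evaluated
    (homogeneously) at the point of the line where eta vanishes: there the sum of
    the cubes of the coordinates is 0. *)
Lemma eta_line (u v d1 d2 : rat) : let e := eta u v in let d := eta d1 d2 in
  ratr (u ^+ 3 + v ^+ 3) * d ^+ 3 - ratr (3 * (u ^+ 2 * d1 + v ^+ 2 * d2)) * e * d ^+ 2
  + ratr (3 * (u * d1 ^+ 2 + v * d2 ^+ 2)) * e ^+ 2 * d - ratr (d1 ^+ 3 + d2 ^+ 3) * e ^+ 3 = 0.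
Proof.
move=> e d; rewrite !(rmorph_nat, rmorphD, rmorphM, rmorphXn) /=.
transitivity ((d * ratr u - e * ratr d1) ^+ 3 + (d * ratr v - e * ratr d2) ^+ 3).
  by move: e d (ratr u : algC) (ratr v : algC) (ratr d1 : algC) (ratr d2 : algC) => *; ring.
have -> : d * ratr u - e * ratr d1 = (1 + omega) * (ratr d2 * ratr u - ratr v * ratr d1).
  by rewrite /e /d /eta; ring.
have -> : d * ratr v - e * ratr d2 = omega * (ratr d2 * ratr u - ratr v * ratr d1).
  by rewrite /e /d /eta; ring.
move: (ratr d2 * ratr u - ratr v * ratr d1) => z.
transitivity (((1 + omega) ^+ 3 + omega ^+ 3) * z ^+ 3); first by move: omega => w; ring.
have -> : (1 + omega) ^+ 3 + omega ^+ 3 = 0.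
  transitivity (1 + 3 * (omega + omega ^+ 2) + 2 * omega ^+ 3); first by ring.
  by rewrite omega_cube omega_sqr; ring.
by rewrite mul0r.
Qed.

(** Rational factors cancel in the quotient by the conjugate, which leaves the cube
    of d / d^*. *)
Lemma cubeK_quotient (x y z d : algC) (m D : rat) : m != 0 -> D != 0 ->
    x != 0 -> y != 0 -> z != 0 -> d != 0 -> inK d ->
    x * y * z * ratr D = ratr m * d ^+ 3 ->
  cubeK (x / x^* * (y / y^*) * (z / z^*)).
Proof.
move=> m0 D0 x0 y0 z0 d0 kd e.
have e' : x^* * y^* * z^* * ratr D = ratr m * (d^*) ^+ 3.
  rewrite -[ratr D]conj_ratr -[ratr m]conj_ratr -!rmorphM -rmorphXn /= -rmorphM /=.
  by rewrite e.
have [x0' y0' z0' d0'] : [/\ x^* != 0, y^* != 0, z^* != 0 & d^* != 0].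
  by rewrite !conjC_eq0.
exists (d / d^*); first exact: inKM (kd) (inKV (inK_conj kd)).
split; first by rewrite mulf_neq0 ?invr_eq0.
have m0' : ratr m != 0 :> algC by rewrite fmorph_eq0.
have D0' : ratr D != 0 :> algC by rewrite fmorph_eq0.
have -> : x / x^* * (y / y^*) * (z / z^*) =
   (x * y * z * ratr D) / (x^* * y^* * z^* * ratr D).
  by field; rewrite x0' y0' z0' D0'.
by rewrite e e'; field; rewrite d0' m0'.
Qed.

(** Along a line eta is an affine function, and the product of its values at the
    three intersection points is the value of the cubic polynomial of the line at the
    zero of eta, which eta_line computes. *)
Lemma descent_third_point (m : int) P Q : m != 0 -> on_curve m P -> on_curve m Q ->
  cubeK (descent P * descent Q * descent (third_point P Q)).
Proof.
move=> m0 hP hQ.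
have inv (R : rat_point) : on_curve m R -> descent R * descent (reflect_point R) = 1.
  by move=> hR; rewrite (descent_reflect m0 hR) mulfV // (descent_neq0 m0 hR).
case: P hP => [|u1 v1] hP; first by rewrite mul1r inv //; exact: cubeK1.
case: Q hQ => [|u2 v2] hQ; first by rewrite mulr1 inv //; exact: cubeK1.
have s1 := sum_neq0_on_curve m0 hP; have s2 := sum_neq0_on_curve m0 hQ.
have m0' : m%:~R != 0 :> rat by rewrite intr_eq0.
have hT := third_on_curve hP hQ.
have [/andP[/eqP eu /eqP ev]|hne] := boolP ((u1 == u2) && (v1 == v2)).
  subst u2 v2; rewrite third_point_tangent /= in hT *.
  case: eqVneq hT => [hd _|hd hT].
    have -> : descent Infinity = 1 by [].
    have uv : v1 = u1.
      have : (v1 - u1) * (u1 + v1) = 0 by rewrite -hd; ring.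
      by move/eqP; rewrite mulf_eq0 (negbTE s1) orbF subr_eq0 => /eqP.
    rewrite eta_conj uv mulfV; last by apply: eta_neq0; rewrite -{2}uv.
    by rewrite !mulr1; exact: cubeK1.
  have s3 := sum_neq0_on_curve m0 hT.
  have D0 : (v1 ^+ 2) ^+ 3 + (- u1 ^+ 2) ^+ 3 != 0 by rewrite sum_cubes_eq0.
  apply: (cubeK_quotient m0' D0 (eta_neq0 s1) (eta_neq0 s1) (eta_neq0 s3) (eta_neq0 hd) (inK_eta _ _)).
  have := eta_line u1 v1 (v1 ^+ 2) (- u1 ^+ 2); rewrite /=.
  rewrite eta_linear; move: hP => /= ->.
  have -> : u1 ^+ 2 * v1 ^+ 2 + v1 ^+ 2 * - u1 ^+ 2 = 0 by ring.
  set D := _ ^+ 3 + _; set q := 3 * (u1 * _ + _); move: (eta u1 v1) (eta _ _) => e d.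
  rewrite mulr0 rmorph0 !mul0r subr0 => h.
  have et : ratr (- (q / D)) * ratr D = - ratr q :> algC.
    by rewrite -rmorphM mulNr divfK // rmorphN.
  transitivity (e ^+ 2 * (e * ratr D + d * (ratr (- (q / D)) * ratr D))); first by ring.
  by rewrite et; apply/eqP; rewrite -subr_eq0 -oppr_eq0; apply/eqP; rewrite -[RHS]h; ring.
rewrite third_point_chord //= in hT *.
case: eqVneq hT => [hd _|hd hT].
  have [-> ->] := opposite_of_same_sum m0 hP hQ hne hd.
  rewrite mulr1; have := inv (Affine u1 v1) hP; rewrite /= => ->.
  exact: cubeK1.
have s3 := sum_neq0_on_curve m0 hT.
have D0 : (u2 - u1) ^+ 3 + (v2 - v1) ^+ 3 != 0 by rewrite sum_cubes_eq0.
apply: (cubeK_quotient m0' D0 (eta_neq0 s1) (eta_neq0 s2) (eta_neq0 s3) (eta_neq0 hd) (inK_eta _ _)).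
have := eta_line u1 v1 (u2 - u1) (v2 - v1); rewrite /= eta_linear.
have -> : eta u2 v2 = eta u1 v1 + eta (u2 - u1) (v2 - v1).
  by rewrite -[eta (_ - _) _]mul1r -(rmorph1 (@ratr algC)) -eta_linear !mul1r !subrKC.
have er : (u2 - u1) ^+ 3 + (v2 - v1) ^+ 3 + 3 * (u1 * (u2 - u1) ^+ 2 + v1 * (v2 - v1) ^+ 2)
   + 3 * (u1 ^+ 2 * (u2 - u1) + v1 ^+ 2 * (v2 - v1)) = 0.
  transitivity (u2 ^+ 3 + v2 ^+ 3 - (u1 ^+ 3 + v1 ^+ 3)); first by ring.
  by move: hP hQ => /= -> ->; rewrite subrr.
move: hP => /= ->; move: er.
set D := _ ^+ 3 + _; set q := 3 * (u1 * _ + _); set r := 3 * (u1 ^+ 2 * _ + _).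
move: (eta u1 v1) (eta _ _) => e d er h.
have er' : ratr r = - ratr q - ratr D :> algC.
  by rewrite -rmorphN -rmorphB; congr ratr; move: er => /eqP; rewrite addr_eq0 => /eqP er; rewrite -[r]opprK -er; ring.
have et : ratr (- (q / D) - 1) * ratr D = - ratr q - ratr D :> algC.
  by rewrite -rmorphM mulrBl mulNr divfK // mul1r rmorphB rmorphN.
rewrite er' in h.
transitivity (e * (e + d) * (e * ratr D + d * (ratr (- (q / D) - 1) * ratr D))); first by ring.
by rewrite et; apply/eqP; rewrite -subr_eq0 -oppr_eq0; apply/eqP; rewrite -[RHS]h; ring.
Qed.

Lemma descent_add (m : int) P Q : m != 0 -> on_curve m P -> on_curve m Q ->
  cubeK (descent P * descent Q / descent (add_point P Q)).
Proof.
move=> m0 hP hQ; rewrite /add_point (descent_reflect m0 (third_on_curve hP hQ)) invrK.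
exact: descent_third_point hQ.
Qed.

(** The class of the descent map at n R is the n-th power of the class at R. *)
Lemma descent_mul_point (m : int) R n1 n2 : m != 0 -> on_curve m R ->
    n1 = n2 %[mod 3] ->
  cubeK (descent (mul_point n1 R) / descent (mul_point n2 R)).
Proof.
move=> m0 hR; have R0 := descent_neq0 m0 hR; have kR := inK_descent R.
have hn n := mul_point_on_curve n hR; have dn n := descent_neq0 m0 (hn n).
have pow n : cubeK (descent R ^+ n / descent (mul_point n R)).
  elim: n => [|n IHn]; first by rewrite expr0 /= divr1; exact: cubeK1.
  have := cubeKM IHn (descent_add m0 hR (hn n)).
  rewrite -[add_point R (mul_point n R)]/(mul_point n.+1 R) exprS.
  move: (descent (mul_point n R)) (descent (mul_point n.+1 R)) (dn n) (dn n.+1) => x y x0 y0.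
  by congr cubeK; field; rewrite x0 y0.
have pow3 k : cubeK (descent R ^+ (3 * k)).
  exists (descent R ^+ k); last by rewrite expf_neq0 // mulnC exprM.
  by elim: (k) => [|k' IHk]; rewrite ?expr0 ?exprS; [exact: (inK_descent Infinity) | exact: inKM].
wlog le : n1 n2 / (n2 <= n1)%N => [hw|].
  have [/hw h|/ltnW/hw h] := leqP n2 n1; first exact: h.
  by move/esym/h/cubeKV; rewrite invf_div.
move=> /eqP; rewrite eqn_mod_dvd // => /dvdnP[k ek].
have -> : descent (mul_point n1 R) / descent (mul_point n2 R) =
  (descent R ^+ n1 / descent (mul_point n1 R))^-1 *
  (descent R ^+ n2 / descent (mul_point n2 R)) * descent R ^+ (3 * k).
  rewrite (_ : n1 = n2 + 3 * k)%N; last by lia.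
  rewrite exprD; move: (dn n2) (dn (n2 + 3 * k)%N) (expf_neq0 n2 R0) (expf_neq0 (3 * k) R0).
  move: (descent (mul_point _ R)) (descent (mul_point _ R)) (descent R ^+ _) (descent R ^+ _).
  by move=> x y z t x0 y0 z0 t0; field; rewrite ?x0 ?y0 ?z0 ?t0.
by apply: cubeKM (pow3 k); apply: cubeKM (pow n2); apply: cubeKV.
Qed.

(** * Integers of Q(omega) *)

Lemma Aint_omega : omega \in Aint.
Proof.
apply: (@Aint_unity_root 3) => //.
by rewrite unity_rootE omega_cube.
Qed.

Lemma Aint_conj x : (x^* \in Aint) = (x \in Aint).
Proof. exact: Aint_aut. Qed.

Lemma Aint_eta (U V : int) : eta U%:~R V%:~R \in Aint.
Proof.
rewrite /eta !ratr_int; apply: rpredB; apply: rpredM; rewrite ?Aint_int ?Aint_omega //.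
by apply: rpredD; rewrite ?Aint1 ?Aint_omega.
Qed.

Lemma inK_trace x : inK x -> x + x^* \in Crat.
Proof.
move=> [a [b ->]]; rewrite conj_K; apply/CratP; exists (a + a - b).
by rewrite rmorphB rmorphD /=; ring.
Qed.

(** With c = x^3, the product (X^3 - c) (X^3 - c^* ) has rational, hence integral
    coefficients. *)
Lemma Aint_cube_root x : inK (x ^+ 3) -> x ^+ 3 \in Aint -> x \in Aint.
Proof.
move=> kx ax; set c := x ^+ 3 in kx ax.
have tr : c + c^* \in Num.int.
  by apply: Cint_rat_Aint (inK_trace kx) _; rewrite rpredD ?Aint_conj.
have nm : c * c^* \in Num.int.
  by apply: Cint_rat_Aint (inK_norm kx) _; rewrite rpredM ?Aint_conj.
apply: (@root_monic_Aint ('X^6 - (c + c^*) *: 'X^3 + (c * c^*)%:P)).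
- rewrite /root hornerD hornerC hornerD hornerN hornerZ !hornerXn.
  apply/eqP; transitivity ((x ^+ 3 - c) * (x ^+ 3 - c^*)); first by ring.
  by rewrite subrr mul0r.
- rewrite -addrA monicE lead_coefDl ?lead_coefXn // size_polyXn.
  rewrite (leq_ltn_trans (size_polyD _ _)) // gtn_max size_polyN.
  rewrite (leq_ltn_trans (size_scale_leq _ _)) ?size_polyXn //=.
  by rewrite (leq_ltn_trans (size_polyC_leq1 _)).
apply/polyOverP => i; rewrite coefD coefB coefZ coefC !coefXn.
apply: rpredD; last by case: ifP => // _; apply: rpred0.
by apply: rpredB; [apply: rpred_nat | apply: rpredM => //; apply: rpred_nat].
Qed.

(** A nonzero integer of Q(omega) has absolute value at least 1: its norm is a
    nonzero rational integer. *)
Lemma Aint_inK_ge1 x : inK x -> x \in Aint -> x != 0 -> 1 <= `|x|.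
Proof.
move=> kx ax x0.
have nm : x * x^* \in Num.int.
  by apply: Cint_rat_Aint (inK_norm kx) _; rewrite rpredM ?Aint_conj.
have := norm_intr_ge1 nm; rewrite mulf_neq0 ?conjC_eq0 // => /(_ isT).
by rewrite normrM norm_conjC -expr2 expr_ge1.
Qed.

(** The factor e ^ r clears the denominators, leaving the value at (e, f) of a
    binary form with integral coefficients. *)
Lemma scaled_horner (p : {poly algC}) r (e f : algC) :
    (size p <= r.+1)%N -> (forall k, p`_k \in Num.nat) -> e != 0 ->
  e \in Aint -> f \in Aint -> inK e -> inK f ->
  e ^+ r * p.[f / e] \in Aint /\ inK (e ^+ r * p.[f / e]).
Proof.
move=> sp np e0 ae af ke kf.
have -> : e ^+ r * p.[f / e] = \sum_(k < r.+1) p`_k * f ^+ k * e ^+ (r - k).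
  rewrite (horner_coef_wide _ sp) mulr_sumr; apply: eq_bigr => k _.
  have kr : (k <= r)%N by rewrite -ltnS.
  have -> : e ^+ r = e ^+ (r - k) * e ^+ k by rewrite -exprD subnK.
  rewrite expr_div_n; move: (e ^+ k) (e ^+ (r - k)) (f ^+ k) (p`_k) (expf_neq0 k e0).
  by move=> x y z c x0; field.
have kX x n : inK x -> inK (x ^+ n).
  move=> kx; elim: n => [|n IHn]; first by rewrite expr0 -(rmorph1 (@ratr algC)); exact: inK_ratr.
  by rewrite exprS; apply: inKM.
split.
  by apply: rpred_sum => k _; rewrite !rpredM ?rpredX // Aint_Cnat.
apply: (big_ind inK) => [|x y|k _]; first by rewrite -(rmorph0 (@ratr algC)); exact: inK_ratr.
  exact: inKD.
apply: inKM (kX _ _ ke); apply: inKM (kX _ _ kf).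
by have /natrP[n ->] := np k; rewrite -(rmorph_nat (@ratr algC)); exact: inK_ratr.
Qed.

(** * From the descent class to an approximated cube root *)

Lemma omega_mul_conj : omega * omega^* = 1.
Proof. by rewrite omega_conj mulrBr mulrN1 -expr2 omega_sqr; ring. Qed.

(** Of the three cube roots t of a number of absolute value 1, one has nonnegative
    real part; it is at most as far from 1 as t^3 is. *)
Lemma cube_root_unit (y : algC) : cubeK y -> `|y| = 1 ->
  exists t, [/\ inK t, `|t| = 1, t ^+ 3 = y & 0 <= t + t^*].
Proof.
move=> [z kz [z0 ->]] hz.
have z1 : `|z| = 1.
  apply/eqP; have := @pexprn_eq1 _ `|z| 3 (normr_ge0 _).
  by rewrite -normrX hz eqxx /= => <-.
have w1 : `|omega| = 1.
  apply/eqP; have := @pexprn_eq1 _ `|omega| 2 (normr_ge0 _).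
  by rewrite normCK omega_mul_conj eqxx /= => <-.
have tr_real (x : algC) : x + x^* \is Num.real.
  by rewrite CrealE rmorphD /= conjCK addrC.
have [h0|h0] := real_leP (real0 _) (tr_real z); first by exists z.
have [h1|h1] := real_leP (real0 _) (tr_real (omega * z)).
  exists (omega * z); split=> //; first exact: inKM inK_omega kz.
    by rewrite normrM w1 z1 mulr1.
  by rewrite exprMn omega_cube mul1r.
exists (omega ^+ 2 * z); split.
- by rewrite expr2; apply: inKM kz; apply: inKM inK_omega inK_omega.
- by rewrite normrM normrX w1 z1 expr1n mulr1.
- by rewrite exprMn -exprM mulnC exprM omega_cube expr1n mul1r.
have -> : omega ^+ 2 * z + (omega ^+ 2 * z)^* = - (z + z^*) - (omega * z + (omega * z)^*).
  by rewrite omega_sqr mulrBl mulN1r rmorphB rmorphN /=; ring.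
by rewrite addr_ge0 // oppr_ge0 ltW.
Qed.

Lemma cube_root_close (t : algC) : `|t| = 1 -> 0 <= t + t^* ->
  `|t - 1| <= `|t ^+ 3 - 1|.
Proof.
move=> t1 ht; have -> : t ^+ 3 - 1 = (t - 1) * (t * (t + t^* + 1)).
  have tt : t * t^* = 1 by rewrite -normCK t1 expr1n.
  by rewrite !mulrDr tt; ring.
rewrite !normrM t1 mul1r ler_peMr // ger0_norm; last by rewrite addr_ge0.
by rewrite lerDr.
Qed.

(** The quotient of two linear forms with the same descent class is a cube; this
    exhibits the cube root as K^* / K with K an integer of Q(omega). The relation
    between the norms is what makes the cube of K, hence K, integral. *)
Lemma exists_conj_cube_root (e1 e2 : algC) (k : int) (W : nat) :
    e1 != 0 -> e2 != 0 -> inK e1 -> inK e2 -> e1 \in Aint -> e2 \in Aint ->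
    (0 < W)%N -> (e1 * e1^*) * (e2 * e2^*) = k%:~R * W%:R ^+ 3 ->
    cubeK (e1 / e1^* / (e2 / e2^*)) ->
  exists K t, [/\ inK K, K \in Aint, K != 0 & K ^+ 3 = k%:~R * (e1 * e2^*)] /\
    [/\ K^* = t * K, `|t| = 1, t ^+ 3 = (e1^* / e1) * (e2 / e2^*) & 0 <= t + t^*].
Proof.
move=> e10 e20 ke1 ke2 ae1 ae2 W0 ekW cub.
have e10' : e1^* != 0 by rewrite conjC_eq0.
have e20' : e2^* != 0 by rewrite conjC_eq0.
have w0 : W%:R != 0 :> algC by rewrite pnatr_eq0 -lt0n.
have inv : (e1 / e1^* / (e2 / e2^*))^-1 = (e1^* / e1) * (e2 / e2^*).
  by field; rewrite e10 e20 e10' e20'.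
have [||t [kt t1 et ht]] := @cube_root_unit ((e1^* / e1) * (e2 / e2^*)).
- by rewrite -inv; apply: cubeKV.
- by rewrite !(normrM, normfV) !norm_conjC !divff ?normr_eq0 // mulr1.
have t0 : t != 0 by rewrite -normr_eq0 t1 oner_neq0.
have tV : t^* = t^-1.
  by apply: (mulfI t0); rewrite mulfV // -normCK t1 expr1n.
pose K := t * e1 * e2^* / W%:R.
have K3 : K ^+ 3 = k%:~R * (e1 * e2^*).
  apply: (mulIf (expf_neq0 3 w0)); rewrite [RHS]mulrAC -ekW /K.
  transitivity (t ^+ 3 * (e1 * e2^*) ^+ 3); first by field.
  by rewrite et; field; rewrite e10 e20'.
exists K, t; split; split=> //.
- apply: inKM; first by apply: inKM (inK_conj ke2); apply: inKM.
  by apply: inKV; rewrite -(rmorph_nat (@ratr algC)); exact: inK_ratr.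
- apply: Aint_cube_root; rewrite K3.
    apply: inKM; last by apply: inKM (inK_conj ke2).
    by rewrite -(ratr_int algC); exact: inK_ratr.
  by apply: rpredM; [exact: Aint_int | apply: rpredM; rewrite ?Aint_conj].
- by rewrite /K !mulf_neq0 ?invr_eq0.
rewrite /K fmorph_div rmorphM (rmorphM _ t) /= conjCK rmorph_nat tV.
apply: (mulfI (expf_neq0 2 t0)); transitivity (t * e1^* * e2 / W%:R); first by field; rewrite w0 t0.
transitivity (t ^+ 3 * (t * e1 * e2^* / W%:R)); last by ring.
by rewrite et; field; rewrite w0 e10 e20'.
Qed.

(** * Gaps between points of one descent class *)

(** Here x and y stand for the absolute values of the two forms and z for that of
    K; one of the two terms of the sum contributes at least 1/2. *)
Lemma pade_size_dichotomy (x y z c M : algC) r : 0 < x -> 0 < y -> 0 <= z -> 0 <= c -> 0 <= M ->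
  1 <= x ^+ r * z * (c * ((M / x) ^+ (2 * r).+1 + M / y)) ->
  x ^+ (2 * r).+1 <= 2 * c * x ^+ r * z * M ^+ (2 * r).+1 \/ y <= 2 * c * x ^+ r * z * M.
Proof.
move=> x0 y0 z0 c0 M0; have [x0w y0w] := (ltW x0, ltW y0); rewrite !mulrDr.
set X := x ^+ r * z * _; set Y := x ^+ r * z * _.
have X0 : 0 <= X by apply: mulr_ge0; apply: mulr_ge0; rewrite ?exprn_ge0 ?divr_ge0.
have Y0 : 0 <= Y by apply: mulr_ge0; apply: mulr_ge0; rewrite ?exprn_ge0 ?divr_ge0.
move=> h.
have half : 2^-1 <= X \/ 2^-1 <= Y.
  have r2 : (2^-1 : algC) \is Num.real by rewrite realV realn.
  have [?|hX] := real_leP r2 (ger0_real X0); first by left.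
  have [?|hY] := real_leP r2 (ger0_real Y0); first by right.
  have := ltrD hX hY; have -> : 2^-1 + 2^-1 = 1 :> algC by field.
  by move/(le_lt_trans h); rewrite ltxx.
have two (a : algC) : 2^-1 <= a -> 1 <= 2 * a.
  by move=> ha; rewrite -[leLHS](@mulfV _ (2 : algC)) ?pnatr_eq0 // ler_pM2l.
have x0' := expf_neq0 (2 * r).+1 (lt0r_neq0 x0).
case: half => hh; [left|right].
  have -> : 2 * c * x ^+ r * z * M ^+ (2 * r).+1 = 2 * X * x ^+ (2 * r).+1.
    rewrite /X expr_div_n; move: (x ^+ (2 * r).+1) x0' (x ^+ r) (M ^+ _) => a a0 b d.
    by field.
  by apply: ler_peMl; [apply: exprn_ge0 | apply: two].
have -> : 2 * c * x ^+ r * z * M = 2 * Y * y.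
  by rewrite /Y; move: (x ^+ r) => a; field; rewrite lt0r_neq0.
by apply: ler_peMl; last exact: two.
Qed.

(** The alternative obtained by comparing the absolute value of a nonzero
    integer of Q(omega), built from the r-th approximant, with its size; q1 and q2 are the
    norms of the linear forms at two points of the same descent class. *)
Definition pade_alternative (L q1 q2 r : nat) : Prop :=
  (q1 ^ (3 * r + 2) <= L ^ (12 * r + 10) * q2)%N \/
  (q2 ^ 2 <= L ^ (12 * r + 10) * q1 ^ (3 * r + 1))%N.

Lemma pade_const_leq (k mu r n : nat) : (0 < mu)%N -> (k <= mu ^ 2)%N -> (n <= 12 * r + 6)%N ->
  ((2 * (16 * 288 ^ r)) ^ 6 * k ^ 2 * (2 * mu) ^ n <= (64 * mu) ^ (12 * r + 10))%N.
Proof.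
move=> mu0 hk hn.
apply: (@leq_trans ((2 ^ 5 * (2 ^ 9) ^ r) ^ 6 * (mu ^ 2) ^ 2 * (2 * mu) ^ (12 * r + 6))).
  apply: leq_mul; last by rewrite leq_pexp2l // muln_gt0.
  apply: leq_mul; last by rewrite leq_exp2r.
  rewrite leq_exp2r // mulnA leq_mul //; case: (r) => // r'; rewrite leq_exp2r //.
have -> : ((2 ^ 5 * (2 ^ 9) ^ r) ^ 6 = 2 ^ (54 * r + 30))%N.
  by rewrite -expnM -expnD -expnM; congr expn; lia.
have -> : ((64 * mu) ^ (12 * r + 10) = 2 ^ (6 * (12 * r + 10)) * mu ^ (12 * r + 10))%N.
  by rewrite expnMn -[64%N]/(2 ^ 6)%N -expnM.
rewrite -expnM (expnMn 2) mulnACA -!expnD.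
by apply: leq_mul; rewrite leq_pexp2l //; lia.
Qed.

Lemma sixth_power_leq (u x z : algC) (c M k N q1 q2 r n : nat) :
    0 <= u -> 0 <= x -> 0 <= z -> u ^+ 6 = N%:R -> x ^+ 2 = q1%:R ->
    z ^+ 6 = (k ^ 2 * (q1 * q2))%:R -> u <= 2 * c%:R * x ^+ r * z * M%:R ^+ n ->
  (N <= (2 * c) ^ 6 * k ^ 2 * M ^ (6 * n) * (q1 ^ (3 * r) * (q1 * q2)))%N.
Proof.
move=> u0 x0 z0 eu ex ez h; rewrite -(@ler_nat algC) -eu.
apply: (@le_trans _ _ ((2 * c%:R * x ^+ r * z * M%:R ^+ n) ^+ 6)).
  by apply: lerXn2r => //; rewrite nnegrE ?(le_trans u0 h).
have ex6 : (x ^+ r) ^+ 6 = (q1 ^ (3 * r))%:R.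
  rewrite -exprM (_ : r * 6 = 2 * (3 * r))%N; last by lia.
  by rewrite exprM ex natrX.
have eM : (M%:R ^+ n) ^+ 6 = (M ^ (6 * n))%:R :> algC by rewrite -exprM mulnC natrX.
have -> : (2 * c%:R * x ^+ r * z * M%:R ^+ n) ^+ 6 =
    ((2 * c) ^ 6)%:R * (q1 ^ (3 * r))%:R * (k ^ 2 * (q1 * q2))%:R * (M ^ (6 * n))%:R.
  have e2c : ((2 * c) ^ 6)%:R = 2 ^+ 6 * c%:R ^+ 6 :> algC by rewrite natrX natrM exprMn.
  by rewrite !(exprMn 6) ex6 ez eM e2c.
rewrite -!natrM ler_nat; apply: eq_leq.
by move: ((2 * c) ^ 6)%N (M ^ _)%N (q1 ^ _)%N => a b d; ring.
Qed.

(** The integer e1^r (K A_r - K^* B_r) has absolute value at least 1, while the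
    factor A_r - t B_r is small by pade_approx at w = - e1^* / e1: both t - 1 and
    w - t^3 are quotients of a bounded trace by one of the forms. *)
Lemma pade_alternative_of (e1 e2 K t : algC) (k s1 s2 : int) (q1 q2 mu r : nat) :
    inK e1 -> e1 \in Aint -> inK K -> K \in Aint -> (0 < mu)%N -> (0 < q1)%N -> (q1 <= q2)%N ->
    (`|k| <= mu ^ 2)%N -> (`|s1| <= mu)%N -> (`|s2| <= mu)%N ->
    e1 * e1^* = q1%:R -> e2 * e2^* = q2%:R ->
    e1 + e1^* = s1%:~R -> e2 + e2^* = s2%:~R ->
    K ^+ 3 = k%:~R * (e1 * e2^*) ->
    K^* = t * K -> `|t| = 1 -> t ^+ 3 = (e1^* / e1) * (e2 / e2^*) -> 0 <= t + t^* ->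
    K * (padeA algC r).[- e1^* / e1] - K^* * (padeB algC r).[- e1^* / e1] != 0 ->
  pade_alternative (64 * mu) q1 q2 r.
Proof.
move=> ke1 ae1 kK aK mu0 q10 q12 hk hs1 hs2 n1 n2 tr1 tr2 K3 Kt t1 t3 ht nz.
have q20 := leq_trans q10 q12.
have e10 : e1 != 0.
  by apply: contraTneq q10 => e0; move/eqP: n1; rewrite e0 mul0r eq_sym pnatr_eq0 -leqn0 leqNgt.
have e20 : e2 != 0.
  by apply: contraTneq q20 => e0; move/eqP: n2; rewrite e0 mul0r eq_sym pnatr_eq0 -leqn0 leqNgt.
have e10' : e1^* != 0 by rewrite conjC_eq0.
have e20' : e2^* != 0 by rewrite conjC_eq0.
set w := - e1^* / e1 in nz.
have w1 : `|w| = 1 by rewrite /w normrM normrN normfV norm_conjC divff ?normr_eq0.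
have mu2 : 0 <= 2 * mu%:R :> algC by rewrite mulr_ge0.
have le_mu (s : int) (e : algC) : (`|s| <= mu)%N -> `|s%:~R / e| <= mu%:R / `|e|.
  move=> hs; rewrite normrM normfV ler_wpM2r ?invr_ge0 //.
  by rewrite -intr_norm -[ `|s|]abszE -pmulrn ler_nat.
have dw : `|w - t ^+ 3| <= mu%:R / `|e2|.
  have -> : w - t ^+ 3 = - (e1^* / e1) * (s2%:~R / e2^*).
    by rewrite t3 -tr2 /w; field; rewrite e10 e20'.
  rewrite normrM normrN normrM normfV norm_conjC divff ?normr_eq0 // mul1r.
  by rewrite -(norm_conjC e2) le_mu.
have dw1 : `|w - 1| <= mu%:R / `|e1|.
  have -> : w - 1 = - (s1%:~R / e1) by rewrite -tr1 /w; field.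
  by rewrite normrN le_mu.
have E12 : `|e1| <= `|e2|.
  by rewrite -(@ler_pXn2r _ 2) ?nnegrE // !normCK n1 n2 ler_nat.
have E10 : 0 < `|e1| by rewrite normr_gt0.
have E20 : 0 < `|e2| by rewrite normr_gt0.
have dt : `|t - 1| <= 2 * mu%:R / `|e1|.
  apply: le_trans (cube_root_close t1 ht) _.
  have -> : t ^+ 3 - 1 = (w - 1) - (w - t ^+ 3) by ring.
  apply: le_trans (ler_normB _ _) _; apply: le_trans (lerD dw1 dw) _.
  have -> : 2 * mu%:R / `|e1| = mu%:R / `|e1| + mu%:R / `|e1| by ring.
  by rewrite lerD2l ler_wpM2l // lef_pV2 ?posrE.
have [ax kx] : e1 ^+ r * (padeA algC r).[w] \in Aint /\ inK (e1 ^+ r * (padeA algC r).[w]).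
  apply: scaled_horner => //; rewrite ?size_padeA // ?rpredN ?Aint_conj //.
    by move=> j; rewrite coef_poly; case: ifP.
  exact: inKN (inK_conj ke1).
have [ay ky] : e1 ^+ r * (padeB algC r).[w] \in Aint /\ inK (e1 ^+ r * (padeB algC r).[w]).
  apply: scaled_horner => //; rewrite ?size_padeB // ?rpredN ?Aint_conj //.
    by move=> j; rewrite coef_poly; case: ifP.
  exact: inKN (inK_conj ke1).
have D1 : 1 <= `|K * (e1 ^+ r * (padeA algC r).[w]) - K^* * (e1 ^+ r * (padeB algC r).[w])|.
  apply: Aint_inK_ge1.
  - by apply: inKD; [apply: inKM | apply: inKN; apply: inKM (inK_conj kK) _].
  - by apply: rpredB; apply: rpredM; rewrite ?Aint_conj.
  by rewrite !(mulrCA _ (e1 ^+ r)) -mulrBr mulf_neq0 ?expf_neq0.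
have {D1} D1 : 1 <= `|e1| ^+ r * `|K| * (16 * 288 ^+ r *
   ((2 * mu%:R / `|e1|) ^+ (2 * r).+1 + 2 * mu%:R / `|e2|)).
  apply: le_trans D1 _.
  have -> : K * (e1 ^+ r * (padeA algC r).[w]) - K^* * (e1 ^+ r * (padeB algC r).[w]) =
      e1 ^+ r * K * ((padeA algC r).[w] - t * (padeB algC r).[w]).
    by rewrite Kt; move: (e1 ^+ r) => z; ring.
  rewrite !normrM normrX ler_wpM2l ?mulr_ge0 ?exprn_ge0 //.
  apply: le_trans (pade_approx r t1 (w := w) _) _; first by rewrite w1.
  rewrite ler_wpM2l ?mulr_ge0 ?exprn_ge0 // lerD //.
    by rewrite lerXn2r ?nnegrE ?divr_ge0.
  apply: le_trans dw _; rewrite ler_wpM2r ?invr_ge0 // ler_peMl ?ler1n //.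
have C0 : 0 <= 16 * 288 ^+ r :> algC by rewrite mulr_ge0 ?exprn_ge0.
have alt := pade_size_dichotomy E10 E20 (normr_ge0 K) C0 mu2 D1.
have E1q : `|e1| ^+ 2 = q1%:R by rewrite normCK.
have E2q : `|e2| ^+ 2 = q2%:R by rewrite normCK.
have Kq : `|K| ^+ 6 = (`|k| ^ 2 * (q1 * q2))%:R.
  rewrite -[6%N]/(3 * 2)%N exprM -normrX K3 !normrM norm_conjC !exprMn E1q E2q.
  by rewrite -intr_norm -[ `|k|]abszE -pmulrn natrM natrX natrM.
have const n := pade_const_leq mu0 hk (n := n) (r := r).
rewrite -natrX -natrM -(natrM _ 2 mu) in alt.
rewrite /pade_alternative; case: alt => h; [left|right].
  have E1r : (`|e1| ^+ (2 * r).+1) ^+ 6 = (q1 ^ (6 * r + 3))%:R.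
    rewrite -exprM (_ : (2 * r).+1 * 6 = 2 * (6 * r + 3))%N; last by clear; lia.
    by rewrite exprM E1q natrX.
  have := sixth_power_leq (exprn_ge0 _ (ltW E10)) (ltW E10) (normr_ge0 K) E1r E1q Kq h.
  have -> : (6 * r + 3 = 3 * r + 2 + (3 * r + 1))%N by clear; lia.
  have -> : (q1 ^ (3 * r) * (q1 * q2) = q2 * q1 ^ (3 * r + 1))%N.
    by rewrite addn1 expnSr; move: (q1 ^ (3 * r))%N => z; clear; ring.
  rewrite expnD mulnA leq_pmul2r ?expn_gt0 ?q10 // => hq.
  apply: leq_trans hq _; rewrite leq_mul2r const ?orbT //; clear; lia.
have E2r : `|e2| ^+ 6 = (q2 ^ 3)%:R.
  by rewrite -[6%N]/(2 * 3)%N exprM E2q natrX.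
rewrite -[X in _ <= _ * X]expr1 in h.
have := sixth_power_leq (ltW E20) (ltW E10) (normr_ge0 K) E2r E1q Kq h.
have -> : (q1 ^ (3 * r) * (q1 * q2) = q1 ^ (3 * r + 1) * q2)%N.
  by rewrite addn1 expnSr; move: (q1 ^ (3 * r))%N => z; clear; ring.
rewrite expnSr mulnA leq_pmul2r // => hq.
apply: leq_trans hq _; rewrite leq_mul2r const ?orbT //; clear; lia.
Qed.

(** The second alternative would give q2^2 <= L^10 q1, which q1 <= q2 excludes. *)
Lemma pade_gap (L q1 q2 : nat) : (1 < L)%N -> (L ^ 40 <= q1)%N -> (q1 <= q2)%N ->
  pade_alternative L q1 q2 0 -> (q1 ^ 3 <= q2 ^ 2)%N.
Proof.
move=> L1 hL q12; rewrite /pade_alternative muln0 add0n => alt.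
have q1_gt1 : (1 < q1)%N.
  by apply: leq_trans hL; rewrite -[1%N](exp1n 40) ltn_exp2r.
have q2_gt1 := leq_trans q1_gt1 q12.
case: alt => h.
  rewrite -(@leq_pmul2l q1); last by apply: ltnW.
  rewrite -expnS -[4%N]/(2 * 2)%N expnM.
  apply: (@leq_trans ((L ^ 10 * q2) ^ 2)); first by rewrite leq_exp2r.
  rewrite expnMn leq_mul2r; apply/orP; right; apply: leq_trans hL.
  by rewrite -expnM leq_exp2l.
have : (q2 ^ 8 <= q2 ^ 5)%N.
  apply: (@leq_trans ((L ^ 10 * q1) ^ 4)).
    by rewrite -[8%N]/(2 * 4)%N expnM leq_exp2r.
  rewrite expnMn -expnM; apply: (@leq_trans (q2 * q2 ^ 4)); last by rewrite -expnS.
  by apply: leq_mul; [apply: leq_trans q12 | rewrite leq_exp2r].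
by rewrite leq_exp2l.
Qed.

(** If q1^16 <= q2, choose r with q1^(2 r) <= q2 < q1^(2 r + 2): the approximants of
    orders r and r + 1 are then both too good, as r >= 8. *)
Lemma pade_far (L q1 q2 : nat) : (1 < L)%N -> (L ^ 40 <= q1)%N ->
  (forall r, pade_alternative L q1 q2 r \/ pade_alternative L q1 q2 r.+1) ->
  (q2 < q1 ^ 16)%N.
Proof.
move=> L1 hL alt; rewrite ltnNge; apply/negP => far.
have q1_gt1 : (1 < q1)%N.
  by apply: leq_trans hL; rewrite -[1%N](exp1n 40) ltn_exp2r.
have q2_gt0 : (0 < q2)%N by apply: leq_trans far; rewrite expn_gt0 ltnW.
have q1q1 : (1 < q1 ^ 2)%N by rewrite -[1%N](exp1n 2) ltn_exp2r.
have [r [r8 lo hi]] : exists r, [/\ (8 <= r)%N, (q1 ^ (2 * r) <= q2)%N & (q2 < q1 ^ (2 * r + 2))%N].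
  exists (trunc_log (q1 ^ 2) q2); have /andP[h1 h2] := trunc_log_bounds q1q1 q2_gt0.
  rewrite -expnM in h1; rewrite -expnM in h2; split=> //.
    by apply: trunc_log_max => //; rewrite -expnM.
  by rewrite (_ : 2 * trunc_log (q1 ^ 2) q2 + 2 = 2 * (trunc_log (q1 ^ 2) q2).+1)%N // mulnS addnC.
have [p [rp pr hp]] : exists p, [/\ (r <= p)%N, (p <= r.+1)%N & pade_alternative L q1 q2 p].
  by case: (alt r) => h; [exists r | exists r.+1].
have hLp n : (L ^ (40 * n) <= q1 ^ n)%N.
  by rewrite expnM; case: n => // n; rewrite leq_exp2r.
case: hp => h.
  have : (q1 ^ p * q1 ^ (2 * p + 2) < q1 ^ p * q1 ^ (2 * p + 2))%N.
    rewrite -expnD (_ : p + (2 * p + 2) = 3 * p + 2)%N; last by clear; lia.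
    apply: leq_ltn_trans h _; rewrite (_ : 3 * p + 2 = p + (2 * p + 2))%N; last by clear; lia.
    rewrite (expnD q1); apply: (@leq_ltn_trans (q1 ^ p * q2)).
      rewrite leq_mul2r; apply/orP; right; apply: (@leq_trans (L ^ (40 * p))) => //.
      by rewrite leq_exp2l //; move: rp r8; clear; lia.
    rewrite ltn_pmul2l ?expn_gt0 ?(ltnW q1_gt1) //; apply: leq_trans hi _.
    by rewrite leq_exp2l //; move: rp; clear; lia.
  by rewrite ltnn.
have : (q1 ^ (p - 5) * q1 ^ (3 * p + 1) <= L ^ (12 * p + 10) * q1 ^ (3 * p + 1))%N.
  apply: leq_trans h; rewrite -expnD; apply: (@leq_trans (q1 ^ (2 * r * 2))).
    by rewrite leq_exp2l //; move: rp pr r8; clear; lia.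
  by rewrite expnM leq_exp2r.
rewrite leq_pmul2r ?expn_gt0 ?(ltnW q1_gt1) // => h'.
have := leq_trans (hLp (p - 5)%N) h'; rewrite leq_exp2l //.
by move: rp r8; clear; lia.
Qed.

(** Each term exceeds the 3/2-th power of the one before, and none may exceed the
    16th power of another: (3/2)^8 > 16 leaves room for eight. *)
Lemma gap_chain_size (f : nat -> nat) (l : seq nat) : uniq l ->
    {in l, forall x, (1 < f x)%N} ->
    {in l &, forall x y, x != y -> (f x <= f y)%N ->
      (f x ^ 3 <= f y ^ 2)%N /\ (f y < f x ^ 16)%N} ->
  (size l <= 8)%N.
Proof.
move=> ul l1 hl; rewrite leqNgt; apply/negP => sl.
pose s := sort (relpre f leq) l.
have ss : size s = size l by rewrite size_sort.
have us : uniq s by rewrite sort_uniq.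
have so : sorted (relpre f leq) s by apply: sort_sorted => x y; exact: leq_total.
have ms i : (i < 9)%N -> nth 0%N s i \in l.
  by move=> hi; rewrite -(mem_sort (relpre f leq)) mem_nth // ss (leq_trans hi).
have tr : transitive (relpre f leq) by move=> x y z /=; exact: leq_trans.
have le i j : (i < j)%N -> (j < 9)%N -> (f (nth 0%N s i) <= f (nth 0%N s j))%N.
  move=> ij j9; have := sorted_ltn_nth tr 0%N so; apply=> //; rewrite inE ss.
    exact: leq_trans (ltn_trans ij j9) sl.
  exact: leq_trans j9 sl.
have ne i j : (i < j)%N -> (j < 9)%N -> nth 0%N s i != nth 0%N s j.
  move=> ij j9; rewrite nth_uniq ?ss //; first by rewrite neq_ltn ij.
    exact: leq_trans (ltn_trans ij j9) sl.
  exact: leq_trans j9 sl.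
pose x i := f (nth 0%N s i).
have gap i : (i.+1 < 9)%N -> (x i ^ 3 <= x i.+1 ^ 2)%N.
  move=> hi; have hi' := ltnW hi.
  by case: (hl _ _ (ms _ hi') (ms _ hi) (ne _ _ (ltnSn i) hi) (le _ _ (ltnSn i) hi)).
have gap2 i : (i.+2 < 9)%N -> (x i ^ 2 <= x i.+2)%N.
  move=> hi; have x1 : (0 < x i)%N by apply: ltnW; apply: l1; apply: ms; do 2!apply: ltnW.
  rewrite -(@leq_exp2r _ _ 4) // -expnM; apply: (@leq_trans (x i ^ 9)).
    by rewrite leq_pexp2l.
  rewrite -[9%N]/(3 * 3)%N expnM; apply: (@leq_trans ((x i.+1 ^ 2) ^ 3)).
    by rewrite leq_exp2r // gap // ltnW.
  by rewrite -expnM mulnC expnM -[4%N]/(2 * 2)%N expnM leq_exp2r // gap.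
have : (x 0 ^ 16 <= x 8)%N.
  rewrite -[16%N]/(2 * 2 * 2 * 2)%N !expnM.
  apply: leq_trans (gap2 6%N isT); rewrite leq_exp2r //.
  apply: leq_trans (gap2 4%N isT); rewrite leq_exp2r //.
  by apply: leq_trans (gap2 2%N isT); rewrite leq_exp2r // gap2.
have [|_] := hl _ _ (ms 0%N isT) (ms 8%N isT) (ne 0%N 8%N isT isT); first exact: le.
by rewrite ltnNge => /negP.
Qed.

(** For these points 12 m W / (U + V), a Weierstrass coordinate, is an integer. As
    U + V is at most |m|, they are near the point at infinity when W is large. *)
Definition norm_point (m : int) (P : rat_point) (U V : int) (W : nat) (k : int) : Prop :=
  [/\ lowest_terms P U V W, coprimez U V, m = k * (U + V) & qform U V = k * W%:Z ^+ 3].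

Lemma eta_eq0 (u v : rat) : eta u v = 0 -> u = 0 /\ v = 0.
Proof.
move=> e; have := eta_norm u v; rewrite e mul0r => /esym/eqP.
rewrite fmorph_eq0 => /eqP h.
have [h1 h2] : u ^+ 2 = 0 /\ v ^+ 2 = 0.
  have := sqr_ge0 (u - v); have := sqr_ge0 u; have := sqr_ge0 v.
  have : u ^+ 2 + v ^+ 2 + (u - v) ^+ 2 = 0 by transitivity (2 * (u ^+ 2 - u * v + v ^+ 2)); [ring | rewrite h mulr0].
  by move: (u ^+ 2) (v ^+ 2) ((u - v) ^+ 2) => a b c; lra.
by split; apply/eqP; rewrite -sqrf_eq0; apply/eqP.
Qed.

Lemma descent_lowest P U V W : lowest_terms P U V W ->
  descent P = eta U%:~R V%:~R / (eta U%:~R V%:~R)^*.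
Proof.
move=> [W0 _ ->] /=; have w0 : ratr (W%:R)^-1 != 0 :> algC.
  by rewrite fmorph_eq0 invr_eq0 pnatr_eq0 -lt0n.
have -> : eta (U%:~R / W%:R) (V%:~R / W%:R) = ratr (W%:R)^-1 * eta U%:~R V%:~R.
  by rewrite /eta !(rmorphM (@ratr algC)) /=; ring.
by rewrite rmorphM /= conj_ratr -mulf_div divff // mul1r.
Qed.

(** Proportional linear forms come from equal points, by coprimality and because
    W > 0 fixes the sign. *)
Lemma norm_point_eq (m : int) P1 P2 U1 V1 W1 k1 U2 V2 W2 k2 : m != 0 ->
    norm_point m P1 U1 V1 W1 k1 -> norm_point m P2 U2 V2 W2 k2 ->
    (U1 + V1)%:~R * eta U2%:~R V2%:~R = (U2 + V2)%:~R * eta U1%:~R V1%:~R ->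
  P1 = P2.
Proof.
move=> m0 [lt1 c1 em1 eq1] [lt2 c2 em2 eq2] e.
have [eU eV] : (U1 + V1) * U2 = (U2 + V2) * U1 /\ (U1 + V1) * V2 = (U2 + V2) * V1.
  have : eta ((U1 + V1) * U2 - (U2 + V2) * U1)%:~R ((U1 + V1) * V2 - (U2 + V2) * V1)%:~R = 0.
    transitivity ((U1 + V1)%:~R * eta U2%:~R V2%:~R - (U2 + V2)%:~R * eta U1%:~R V1%:~R).
      by rewrite /eta !ratr_int !(intrB, intrM); ring.
    by rewrite e subrr.
  move/eta_eq0 => [/eqP h1 /eqP h2]; rewrite !intr_eq0 !subr_eq0 in h1 h2.
  by split; apply/eqP.
have s10 : U1 + V1 != 0 by apply: contraNneq m0 => h; rewrite em1 h mulr0.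
have k10 : k1 != 0 by apply: contraNneq m0 => h; rewrite em1 h mul0r.
have s20 : U2 + V2 != 0 by apply: contraNneq m0 => h; rewrite em2 h mulr0.
have dv (a b c d x y : int) : coprimez a b -> x * c = y * a -> x * d = y * b -> (x %| y)%Z.
  move=> /coprimezP[[p q] /= pq] h1 h2; apply/dvdzP; exists (p * c + q * d).
  by rewrite -[y]mulr1 -pq; transitivity (p * (x * c) + q * (x * d)); [rewrite h1 h2 | ]; ring.
have d12 := dv _ _ _ _ _ _ c1 eU eV.
have d21 := dv _ _ _ _ _ _ c2 (esym eU) (esym eV).
have es : `|(U1 + V1)%R|%N = `|(U2 + V2)%R|%N.
  by apply/eqP; rewrite eqn_dvd -!dvdzE d12.
case: (lt1) => W10 _ eP1; case: (lt2) => W20 _ eP2.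
have [s12|s12] : U2 + V2 = U1 + V1 \/ U2 + V2 = - (U1 + V1).
  by move: es; clear; move: (U1 + V1) (U2 + V2) => a b; lia.
  rewrite s12 in eU eV; have eU' := mulfI s10 eU; have eV' := mulfI s10 eV.
  have ek : k1 = k2 by apply: (mulIf s10); rewrite -em1 em2 s12.
  have eW : W1%:Z ^+ 3 = W2%:Z ^+ 3.
    by apply: (mulfI k10); rewrite -eq1 ek -eq2 eU' eV'.
  have /eqP : (W1 ^ 3)%N = (W2 ^ 3)%N by have := congr1 absz eW; rewrite !abszX.
  by rewrite eqn_exp2r // => /eqP {}eW; rewrite eP1 eP2 eU' eV' eW.
exfalso; have eU' : U2 = - U1 by apply: (mulfI s10); rewrite eU s12; ring.
have eV' : V2 = - V1 by apply: (mulfI s10); rewrite eV s12; ring.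
have ek : k2 = - k1.
  by apply: (mulIf s10); rewrite mulNr -em1 em2 s12 mulrN opprK.
have : k1 * (W1%:Z ^+ 3 + W2%:Z ^+ 3) = 0.
  rewrite mulrDr -eq1 -[k1]opprK -ek mulNr -eq2 eU' eV' /qform; ring.
move/eqP; rewrite mulf_eq0 (negbTE k10) /= => /eqP.
have : 0 < W1%:Z ^+ 3 by rewrite exprn_gt0.
have : 0 < W2%:Z ^+ 3 by rewrite exprn_gt0.
by lia.
Qed.

(** The integers of order 0 do not vanish because the points differ, and those of
    two consecutive orders do not both vanish by pade_det_neq0. *)
Lemma norm_point_pade (m : int) P1 P2 U1 V1 W1 k1 U2 V2 W2 k2 : m != 0 ->
    norm_point m P1 U1 V1 W1 k1 -> norm_point m P2 U2 V2 W2 k2 ->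
    P1 <> P2 -> cubeK (descent P1 / descent P2) ->
    (`|qform U1 V1| <= `|qform U2 V2|)%N ->
  let alt := pade_alternative (64 * `|m|) `|qform U1 V1| `|qform U2 V2| in
  alt 0%N /\ forall r, alt r \/ alt r.+1.
Proof.
move=> m0 np1 np2 ne cub q12 alt.
case: (np1) (np2) => [lt1 c1 em1 eq1] [lt2 c2 em2 eq2].
have s10 : U1 + V1 != 0 by apply: contraNneq m0 => h; rewrite em1 h mulr0.
have k10 : k1 != 0 by apply: contraNneq m0 => h; rewrite em1 h mul0r.
have s20 : U2 + V2 != 0 by apply: contraNneq m0 => h; rewrite em2 h mulr0.
have k20 : k2 != 0 by apply: contraNneq m0 => h; rewrite em2 h mul0r.
have W10 : (0 < W1)%N by case: lt1.
have W20 : (0 < W2)%N by case: lt2.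
rewrite (descent_lowest lt1) (descent_lowest lt2) in cub.
set e1 := eta U1%:~R V1%:~R in cub; set e2 := eta U2%:~R V2%:~R in cub.
have norm (U V : int) : eta U%:~R V%:~R * (eta U%:~R V%:~R)^* = `|qform U V|%:R.
  rewrite eta_norm -[X in _ = X](ratr_nat algC) -[X in ratr X](_ : (qform U V)%:~R = _); last first.
    by rewrite /qform !(rmorphB, rmorphD, rmorphM, rmorphXn).
  by rewrite -[in LHS](gez0_abs (qform_ge0 U V)) -pmulrn.
have trace (U V : int) : eta U%:~R V%:~R + (eta U%:~R V%:~R)^* = (U + V)%:~R.
  by rewrite eta_trace -intrD ratr_int.
have e10 : e1 != 0 by apply: eta_neq0; rewrite -intrD intr_eq0.
have e20 : e2 != 0 by apply: eta_neq0; rewrite -intrD intr_eq0.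
have ke1 : inK e1 := inK_eta _ _; have ke2 : inK e2 := inK_eta _ _.
have ae1 := Aint_eta U1 V1; have ae2 := Aint_eta U2 V2.
have ek : (e1 * e1^*) * (e2 * e2^*) = (k1 * k2)%:~R * (W1 * W2)%:R ^+ 3.
  have toC (U V : int) : `|qform U V|%:R = (qform U V)%:~R :> algC.
    by rewrite -[in RHS](gez0_abs (qform_ge0 U V)) -pmulrn.
  rewrite !norm !toC eq1 eq2 natrM !(intrM, rmorphXn) /= -!pmulrn; ring.
have W120 : (0 < W1 * W2)%N by rewrite muln_gt0 W10.
have [K [t [[kK aK K0 K3] [Kt t1 t3 ht]]]] := exists_conj_cube_root e10 e20 ke1 ke2 ae1 ae2 W120 ek cub.
have hk : (`|(k1 * k2)%R| <= `|m| ^ 2)%N.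
  rewrite abszM -mulnn; apply: leq_mul.
    by rewrite em1 abszM leq_pmulr // absz_gt0.
  by rewrite em2 abszM leq_pmulr // absz_gt0.
have hs1 : (`|(U1 + V1)%R| <= `|m|)%N by rewrite em1 abszM leq_pmull // absz_gt0.
have hs2 : (`|(U2 + V2)%R| <= `|m|)%N by rewrite em2 abszM leq_pmull // absz_gt0.
have q10 : (0 < `|qform U1 V1|)%N.
  by rewrite absz_gt0 eq1 mulf_neq0 // expf_neq0 // eqz_nat -lt0n.
have main r := @pade_alternative_of e1 e2 K t (k1 * k2) (U1 + V1) (U2 + V2) _ _ _ r
  ke1 ae1 kK aK (_ : 0 < `|m|)%N q10 q12 hk hs1 hs2 (norm _ _) (norm _ _) (trace _ _) (trace _ _)
  K3 Kt t1 t3 ht.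
have m0' : (0 < `|m|)%N by rewrite absz_gt0.
have w1 : - e1^* / e1 != 1.
  rewrite -subr_eq0; have -> : - e1^* / e1 - 1 = - ((U1 + V1)%:~R / e1).
    by rewrite -trace -/e1; field.
  by rewrite oppr_eq0 mulf_neq0 ?invr_eq0 // intr_eq0.
split.
  apply: main => //.
  have A0 : padeA algC 0 = 1 by apply/polyP => -[|i]; rewrite coef_poly coef1 //= /pade_coef !binom3_0.
  have B0 : padeB algC 0 = 1 by apply/polyP => -[|i]; rewrite coef_poly coef1 //= /pade_coef !binom3_0.
  rewrite A0 B0 !hornerC !mulr1 subr_eq0; apply/eqP => eK; apply: ne.
  apply: (norm_point_eq m0 np1 np2); rewrite -/e1 -/e2.
  have tt : t = 1 by apply: (mulIf K0); rewrite -Kt mul1r.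
  have e20' : e2^* != 0 by rewrite conjC_eq0.
  have h : e1^* * e2 = e1 * e2^*.
    move: t3; rewrite tt expr1n mulf_div => /(congr1 (fun z => z * (e1 * e2^*))).
    by rewrite mul1r divfK ?mulf_neq0.
  by rewrite -!trace -/e1 -/e2 mulrDl h [RHS]mulrDl (mulrC e2 e1) (mulrC e2^*).
move=> r; have det := pade_det_neq0 r w1.
have [z|z] := eqVneq (K * (padeA algC r).[- e1^* / e1] - K^* * (padeB algC r).[- e1^* / e1]) 0; last first.
  by left; apply: main.
right; apply: main => //; apply: contraNneq det => z'.
move: (padeA algC r).[_] (padeB algC r).[_] (padeA algC r.+1).[_] (padeB algC r.+1).[_] z z' => a b a' b' z z'.
rewrite -(mulrI_eq0 _ (lregP K0)); apply/eqP.
transitivity ((K * a - K^* * b) * b' - (K * a' - K^* * b') * b); first by ring.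
by rewrite z z' !mul0r subrr.
Qed.

(** * Counting *)

(** The growth hypothesis provides the lower bound on q that makes the powers of m
    in the gap inequalities negligible. *)
Lemma norm_points_class_size (m : int) R (l : seq nat) :
    m != 0 -> on_curve m R -> nontorsion R -> uniq l ->
    {in l &, forall x y, x = y %[mod 3]} ->
    {in l, forall n, exists U V W k,
      norm_point m (mul_point n R) U V W k /\ ((64 * `|m|) ^ 40 <= `|qform U V|)%N} ->
  (size l <= 8)%N.
Proof.
move=> m0 hR nt ul lmod hl; have L1 : (1 < 64 * `|m|)%N.
  by have : (0 < `|m|)%N; [rewrite absz_gt0 | clear; lia].
have [f hf] : exists f : nat -> nat, {in l, forall n, exists U V W k,
    [/\ norm_point m (mul_point n R) U V W k, f n = `|qform U V|%N
      & ((64 * `|m|) ^ 40 <= f n)%N]}.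
  have h n : exists q : nat, n \in l -> exists U V W k,
    [/\ norm_point m (mul_point n R) U V W k, q = `|qform U V|%N
      & ((64 * `|m|) ^ 40 <= q)%N].
    have [nl|] := boolP (n \in l); last by exists 0%N.
    have [U [V [W [k [np hq]]]]] := hl _ nl.
    by exists `|qform U V|%N => _; exists U, V, W, k.
  by have [f hf] := choice h; exists f.
apply: (gap_chain_size (f := f)) => // [x xl|x y xl yl xy fxy].
  have [U [V [W [k [_ _ hq]]]]] := hf _ xl; apply: leq_trans hq.
  by rewrite -[1%N](exp1n 40) ltn_exp2r.
have [U1 [V1 [W1 [k1 [np1 e1 h1]]]]] := hf _ xl.
have [U2 [V2 [W2 [k2 [np2 e2 h2]]]]] := hf _ yl.
have ne : mul_point x R <> mul_point y R.
  by move/(mul_point_inj m0 hR nt)/eqP; rewrite (negbTE xy).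
have cub := descent_mul_point m0 hR (lmod _ _ xl yl).
rewrite e1 e2 in fxy h1 *.
have [alt0 alt] := norm_point_pade m0 np1 np2 ne cub fxy.
by split; [exact: pade_gap alt0 | exact: pade_far alt].
Qed.

Lemma uniq_size_mod (p : pred nat) (d B : nat) : (0 < d)%N ->
    (forall l, uniq l -> all p l -> {in l &, forall x y, x = y %[mod d]} -> (size l <= B)%N) ->
  forall l, uniq l -> all p l -> (size l <= d * B)%N.
Proof.
move=> d0 h l ul pl.
have -> : size l = (\sum_(i < d) size [seq x <- l | (x %% d == i)%N])%N.
  under eq_bigr => i _ do rewrite size_filter -sum1_count big_mkcond.
  rewrite exchange_big /= -sum1_size; apply: eq_bigr => x _.
  by rewrite -big_mkcond /= (big_pred1 (Ordinal (ltn_pmod x d0))).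
rewrite -[X in (_ <= X * B)%N]card_ord -sum_nat_const; apply: leq_sum => i _.
apply: h; first exact: filter_uniq.
  by apply/allP => x; rewrite mem_filter => /andP[_] /(allP pl).
by move=> x y; rewrite !mem_filter => /andP[/eqP-> _] /andP[/eqP-> _].
Qed.

Lemma card_le_uniq (T : choiceType) (A : set T) (K : nat) :
    (forall l : seq T, uniq l -> (forall x, x \in l -> A x) -> (size l <= K)%N) ->
  (A #<= `I_K)%card.
Proof.
move=> h; have [fA|iA] := pselect (finite_set A).
  have [n An] := (finite_setP A).1 fA.
  rewrite (card_le_eql An) card_le_II -(card_fset_set An).
  by apply: h => [|x]; [exact: fset_uniq | rewrite in_fset_set // inE].
have [B sB cB] := infinite_set_fset K.+1 iA.
have := h (enum_fset B) (fset_uniq B) (fun x xB => sB _ xB).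
by move=> /(leq_trans cB); rewrite ltnn.
Qed.

Local Open Scope classical_set_scope.
Local Open Scope card_scope.

Theorem theorem1p1 :
  (exists K : nat, forall (m : int) (R : rat_point),
     m != 0 -> cube_free m -> on_curve m R -> nontorsion R ->
     ([set n : nat | (0 < n)%N /\ exists2 W, is_denom R n W & prime_power W]
        #<= `I_K) /\
     ([set n : nat | (0 < n)%N /\ exists2 W, is_denom R n W & prime W]
        #<= `I_K))
  /\
  (forall F : realType, ABC F ->
   exists N : nat, forall (m : int) (R : rat_point),
     m != 0 -> cube_free m -> on_curve m R -> nontorsion R ->
     forall n : nat, (0 < n)%N ->
     (exists2 W, is_denom R n W & prime_power W) -> (n <= N)%N).
Proof.
(* Beyond n0 the first case of prime_power_denom is excluded. *)
have [n0 hn0] : exists n0, forall (m : int) R n W, m != 0 -> cube_free m ->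
    on_curve m R -> nontorsion R -> (n0 < n)%N -> is_denom R n W -> prime_power W ->
    exists U V k, norm_point m (mul_point n R) U V W k.
  have [n0 hn0] := uniform_growth 4 1; exists n0.
  move=> m R n W m0 cf hR nt ltn [U [V lt]] pW; exists U, V.
  have hP := mul_point_on_curve n hR.
  have [small|[k [em eq]]] := prime_power_denom m0 cf hP lt pW.
    have := leq_trans (hn0 _ _ _ _ _ _ m0 cf hR nt ltn lt) small.
    by rewrite expn1 leq_pmul2r // absz_gt0.
  by exists k; split=> //; exact: lowest_coprime m0 cf hP lt.
split.
  have [c hc] : exists c, (64 ^ 40 <= c)%N by eexists; exact: leqnn.
  have [n1 hn1] := uniform_growth c 40.
  (* At most N + 1 indices up to N, and 8 in each of the 3 classes beyond. *)
  pose N := maxn n0 n1; exists (N.+1 + 3 * 8)%N => m R m0 cf hR nt.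
  have bound : [set n : nat | (0 < n)%N /\ exists2 W, is_denom R n W & prime_power W]
      #<= `I_(N.+1 + 3 * 8).
    apply: card_le_uniq => l ul hl.
    rewrite -(count_predC (fun n => n <= N)%N l) leq_add // -size_filter.
      rewrite -(size_iota 0 N.+1); apply: uniq_leq_size; first exact: filter_uniq.
      by move=> x; rewrite mem_filter mem_iota /= add0n ltnS => /andP[].
    pose p n := `[< (N < n)%N /\ exists2 W, is_denom R n W & prime_power W >].
    apply: (@uniq_size_mod p 3 8) => //; last 2 first.
    - exact: filter_uniq.
    - apply/allP => x; rewrite mem_filter /= -ltnNge => /andP[Nx /hl[_ hx]].
      exact/asboolP.
    move=> s us ps smod; apply: (norm_points_class_size m0 hR nt us smod) => n ns.
    have /asboolP[Nn [W dW pW]] := allP ps _ ns.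
    have [U [V [k np]]] := hn0 _ _ _ _ m0 cf hR nt (leq_ltn_trans (leq_maxl _ _) Nn) dW pW.
    exists U, V, W, k; split=> //; case: np => lt _ _ _.
    apply: leq_trans (hn1 _ _ _ _ _ _ m0 cf hR nt (leq_ltn_trans (leq_maxr _ _) Nn) lt).
    by rewrite expnMn leq_mul2r hc orbT.
  split=> //; apply: card_le_trans bound; apply: subset_card_le => n [n_gt0 [W dW pW]].
  by split=> //; exists W => //; exists W, 1%N; rewrite expn1.
move=> F /ABC_qform_bound[c hc]; have [n1 hn1] := uniform_growth c.+1 24.
exists (maxn n0 n1) => m R m0 cf hR nt n _ [W dW pW]; rewrite leqNgt gtn_max.
apply/negP => /andP[n0n n1n].
have [U [V [k [lt cUV em eq]]]] := hn0 _ _ _ _ m0 cf hR nt n0n dW pW.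
have W0 : (0 < W)%N by case: lt.
have := leq_trans (hn1 _ _ _ _ _ _ m0 cf hR nt n1n lt) (hc _ _ _ _ _ m0 W0 cUV em eq).
by rewrite leq_pmul2r ?ltnn // expn_gt0 absz_gt0 m0.
Qed.
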